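(* For each integer $N$, suppose $\Gamma=\Gamma(N)$ is a piecewise smooth, simple, closed curve that encircles $\mathrm{supp}(\mu)\cup\mathrm{supp}(\nu)$ and is such that the operator norm of $\mathcal C_\Gamma^-$ on $L^2(\Gamma)$ is bounded by $C_N$. Suppose $n=n(N)$ and $\nu=\nu(N)$ are functions of $N$ such that $C_N\|J_n-I\|_{L^\infty(\Gamma)}\to 0$ as $N\to\infty$. Then $$X_n(z;\mu,\nu)=I+\frac{1}{2\pi \mathrm i}\int_\Gamma \frac{c_0(z';\mu-\nu)\,M_n(z';\mu)}{z'-z}\,dz'+O\!\left(C_N\frac{\|J_n-I\|_{L^\infty(\Gamma)}^2}{1+|z|}\right),$$ $$M_n(z;\mu)=\check Y_n^-(z;\mu)\begin{bmatrix}0&1\\0&0\end{bmatrix}\check Y_n^-(z;\mu)^{-1},$$ uniformly on subsets of $\mathbb C$ bounded uniformly away from $\Gamma$.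
   Context: $\mu$ and $\nu$ are measures on $\mathbb R$ without singular continuous part, each with absolutely continuous density supported on a finite number of disjoint compact intervals together with a finite number of point masses (''spikes''); the intervals, densities, spikes, and their numbers may differ for $\mu$ and $\nu$. $\mu$ is a probability measure with intervals $[\mathtt a_j,\mathtt b_j]$, $1\le j\le g+1$ ($\mathtt a_1<\mathtt b_1<\mathtt a_2<\cdots<\mathtt b_{g+1}$), and $p$ spikes. For a measure $\mu$ with finite moments, $\pi_n(\cdot;\mu)$ is the monic orthogonal polynomial of degree $n$, $c_n(z;\mu)=\frac1{2\pi \mathrm i}\int_{\mathbb R}\frac{\pi_n(\lambda;\mu)}{\lambda-z}\mu(d\lambda)$, $c_0(z;\mu-\nu)=c_0(z;\mu)-c_0(z;\nu)$, $\gamma_n(\mu)=-2\pi \mathrm i\,\|\pi_n(\cdot;\mu)\|_{L^2(\mu)}^{-2}$, and for $n\ge 1$ $$Y_n(z;\mu)=\begin{bmatrix}\pi_n(z;\mu)&c_n(z;\mu)\\ \gamma_{n-1}(\mu)\pi_{n-1}(z;\mu)&\gamma_{n-1}(\mu)c_{n-1}(z;\mu)\end{bmatrix},\quad z\notin\mathrm{supp}(\mu).$$ $\Gamma$ is oriented counter-clockwise; superscripts $+$/$-$ on $\Gamma$ denote non-tangential limits from the interior/exterior. Define $$\tilde Y_n(z;\mu)=\begin{cases}Y_n(z;\mu)\begin{bmatrix}1&-c_0(z;\mu)\\0&1\end{bmatrix}& z\text{ inside }\Gamma,\\ Y_n(z;\mu)&\text{otherwise},\end{cases}\qquad \check Y_n(z;\mu)=\mathfrak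 c^{(n-p)\sigma_3}\tilde Y_n(z;\mu),\quad \sigma_3=\mathrm{diag}(1,-1),$$ and $\tilde Y_n(z;\nu),\check Y_n(z;\nu)$ likewise with $\nu$ in place of $\mu$ in $Y_n$ and $c_0$, but with the same $\Gamma$, the same constant $\mathfrak c\neq0$ and the same $p$. Here $\mathfrak c$ is: let $R$ be analytic off $\bigcup_j[\mathtt a_j,\mathtt b_j]$ with $R(z)^2=\prod_j(z-\mathtt a_j)(z-\mathtt b_j)$, $R(z)/z^{g+1}\to1$ as $z\to\infty$; let $Q_g$ be the unique monic polynomial of degree $g$ such that $\mathfrak g'=Q_g/R$ satisfies $\int_{\mathtt b_j}^{\mathtt a_{j+1}}\mathfrak g'(z)dz=0$, $1\le j\le g$; let $\mathfrak g(z)=\int_{\mathtt a_1}^z\mathfrak g'$ (straight line); then $\mathfrak c=\lim_{z\to\infty}e^{\mathfrak g(z)}/z$. Set $X_n(z;\mu,\nu)=\check Y_n(z;\nu)\check Y_n(z;\mu)^{-1}$ and, on $\Gamma$, $J_n(z;\mu,\nu)=I+c_0(z;\mu-\nu)\,\check Y_n^-(z;\mu)\begin{bmatrix}0&1\\0&0\end{bmatrix}\check Y_n^-(z;\mu)^{-1}$. The Cauchy operator is $\mathcal C_\Gamma U(z)=\frac1{2\pi \mathrm i}\int_\Gamma\frac{U(z')}{z'-z}dz'$, and $\mathcal C_\Gamma^-U$ is its non-tangential boundary value on $\Gamma$ from the exterior.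
   Formalization: The constant in the O depends, besides the distance to Γ, on an upper bound for the length of Γ(N), and the estimate is asserted only for N whose Γ(N) obeys that bound; with unbounded lengths a constant independent of N fails. *)

(* Defs.v *)
From HB Require Import structures.
From mathcomp Require Export all_boot all_order all_algebra.
From mathcomp Require Export complex.
From mathcomp Require Export all_classical all_reals all_analysis ess_sup_inf.

Set Implicit Arguments.
Unset Strict Implicit.
Unset Printing Implicit Defensive.

Export Order.TTheory GRing.Theory Num.Theory.
Export numFieldNormedType.Exports.

Global Open Scope classical_set_scope.
Global Open Scope ring_scope.

(* The complex plane is [R[i]]; its topology is the one carried by [R[i]^o].
   The norms provided by the libraries on [R[i]] and on its matrices take
   their values in [R[i]]; [cabs] and [mxabs] (largest modulus of an entry) are
   their real versions. *)

Definition cabs (R : realType) (z : R[i]) : R := complex.Re `|z|.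

Definition mxabs (R : realType) (A : 'M[R[i]]_2) : R := complex.Re `|A|.

Definition mx2 (R : realType) (a b c d : R[i]) : 'M[R[i]]_2 :=
  \matrix_(i, j) if i == 0 then (if j == 0 then a else b)
                 else (if j == 0 then c else d).

Definition cexp (R : realType) (z : R[i]) : R[i] :=
  Complex (expR (complex.Re z) * cos (complex.Im z))
          (expR (complex.Re z) * sin (complex.Im z)).

Definition twopii (R : realType) : R[i] := Complex 0 (2 * pi).

Definition creal (R : realType) (x : R) : R[i] := Complex x 0.

Definition cinfty (R : realType) : set_system R[i]^o :=
  [set A | exists r : R, forall z : R[i], r < cabs z -> A z].

Definition clim (R : realType) (F : set_system R[i]^o) (f : R[i] -> R[i]) :
    R[i] :=
  lim ((f : R[i]^o -> R[i]^o) @ F).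

Definition mxlim (R : realType) (F : set_system R[i]^o)
    (f : R[i] -> 'M[R[i]]_2) : 'M[R[i]]_2 :=
  \matrix_(i, j) clim F (fun z => f z i j).

Definition cintegral (R : realType)
    (m : {measure set (measurableTypeR R) -> \bar R})
    (D : set (measurableTypeR R)) (f : R -> R[i]) : R[i] :=
  Complex (\int[m]_(x in D) complex.Re (f x))
          (\int[m]_(x in D) complex.Im (f x)).

Definition msupp (R : realType)
    (m : {measure set (measurableTypeR R) -> \bar R}) : set R :=
  [set x : R | forall e : R, 0 < e -> (0 < m (ball x e))%E].

Definition cuts (R : realType) (k : nat) (a b : 'I_k -> R) : set R :=
  [set x | exists j, a j <= x <= b j].

(* The last clause says that the support of the density h is the whole of
   the intervals.  k = 0 and q = 0 are allowed. *)
Definition spiked_measure (R : realType)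
    (m : {measure set (measurableTypeR R) -> \bar R})
    (k : nat) (a b : 'I_k -> R) (q : nat) (s : 'I_q -> R) : Prop :=
  [/\ forall j, a j < b j,
      forall i j : 'I_k, (i < j)%N -> b i < a j,
      injective s &
      exists (h : measurableTypeR R -> R) (w : 'I_q -> R),
        [/\ measurable_fun setT h,
            forall x, 0 <= h x,
            forall i, 0 < w i,
            forall A : set (measurableTypeR R), measurable A ->
              m A = (\int[lebesgue_measure]_(x in A `&` cuts a b) (h x)%:E
                     + (\sum_i w i * \1_A (s i))%:E)%E &
            forall (x e : R), cuts a b x -> 0 < e ->
              (0 < \int[lebesgue_measure]_(t in ball x e `&` cuts a b)
                     (h t)%:E)%E]].

Definition monic_orthogonal (R : realType)
    (m : {measure set (measurableTypeR R) -> \bar R}) (n : nat)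
    (P : {poly R}) : Prop :=
  [/\ P \is monic, size P = n.+1 &
      forall Q : {poly R}, (size Q <= n)%N ->
        \int[m]_x (P.[x] * Q.[x]) = 0].

Definition opoly (R : realType)
    (m : {measure set (measurableTypeR R) -> \bar R}) (n : nat) : {poly R} :=
  xget 0 [set P | monic_orthogonal m n P].

Definition copoly (R : realType)
    (m : {measure set (measurableTypeR R) -> \bar R}) (n : nat) (z : R[i]) :
    R[i] :=
  (map_poly (@creal R) (opoly m n)).[z].

(* c_n(z; m) *)
Definition cauchyop (R : realType)
    (m : {measure set (measurableTypeR R) -> \bar R}) (n : nat) (z : R[i]) :
    R[i] :=
  (twopii R)^-1 *
    cintegral m setT (fun x => creal (opoly m n).[x] / (creal x - z)).

Definition gammaop (R : realType)
    (m : {measure set (measurableTypeR R) -> \bar R}) (n : nat) : R[i] :=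
  - twopii R / creal (\int[m]_x ((opoly m n).[x] ^+ 2)).

(* meant for n >= 1 and z outside of the support of m *)
Definition Yop (R : realType)
    (m : {measure set (measurableTypeR R) -> \bar R}) (n : nat) (z : R[i]) :
    'M[R[i]]_2 :=
  mx2 (copoly m n z) (cauchyop m n z)
      (gammaop m n.-1 * copoly m n.-1 z) (gammaop m n.-1 * cauchyop m n.-1 z).

Definition sqrt_branch (R : realType) (g : nat) (a b : 'I_g.+1 -> R)
    (rt : R[i] -> R[i]) : Prop :=
  [/\ forall z : R[i], ~ (@creal R @` cuts a b) z ->
        derivable (rt : R[i]^o -> R[i]^o) z 1,
      forall z : R[i], ~ (@creal R @` cuts a b) z ->
        rt z ^+ 2 = \prod_j ((z - creal (a j)) * (z - creal (b j))) &
      ((fun z => rt z / z ^+ g.+1) : R[i]^o -> R[i]^o) @ @cinfty R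
        --> (1 : R[i]^o)].

(* For j in 'I_g, [widen_ord _ j] and [lift ord0 j] are the indices j and
   j + 1 in 'I_g.+1. *)
Definition gap_poly (R : realType) (g : nat) (a b : 'I_g.+1 -> R)
    (rt : R[i] -> R[i]) (Q : {poly R[i]}) : Prop :=
  [/\ Q \is monic, size Q = g.+1 &
      forall j : 'I_g,
        cintegral lebesgue_measure
          `[b (widen_ord (leqnSn g) j), a (lift ord0 j)]
          (fun x => Q.[creal x] / rt (creal x)) = 0].

(* integral of Q / rt along the segment from a_1 to z *)
Definition gfun (R : realType) (g : nat) (a : 'I_g.+1 -> R)
    (rt : R[i] -> R[i]) (Q : {poly R[i]}) (z : R[i]) : R[i] :=
  let w (t : R) := creal (a ord0) + creal t * (z - creal (a ord0)) in
  cintegral lebesgue_measure `[0, 1]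
    (fun t => Q.[w t] / rt (w t) * (z - creal (a ord0))).

(* The limit at infinity is taken off the half-line [a_1, +oo[: for z on it
   the segment from a_1 to z runs along the cuts. *)
Definition cconst (R : realType) (g : nat) (a b : 'I_g.+1 -> R) (cc : R[i]) :
    Prop :=
  exists (rt : R[i] -> R[i]) (Q : {poly R[i]}),
    [/\ sqrt_branch a b rt, gap_poly a b rt Q &
        ((fun z => cexp (gfun a rt Q z) / z) : R[i]^o -> R[i]^o) @
          within (~` (@creal R @` `[a ord0, +oo[)) (@cinfty R)
          --> (cc : R[i]^o)].

(* A curve is a parametrization G by [0, 1].  Smooth pieces are C^1 up to
   their end points, with nonvanishing derivative. *)
Definition piecewise_smooth (R : realType) (G : R -> R[i]) : Prop :=
  {within `[0, 1], continuous (G : R -> R[i]^o)} /\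
  exists (k : nat) (tau : nat -> R),
    [/\ tau 0%N = 0, tau k = 1 &
        forall i, (i < k)%N ->
          tau i < tau i.+1 /\
          exists v : R -> R[i],
            [/\ {within `[tau i, tau i.+1], continuous (v : R -> R[i]^o)},
                forall t, t \in `[tau i, tau i.+1] -> v t != 0 &
                forall t, t \in `]tau i, tau i.+1[ ->
                  is_derive t 1 (fun u => complex.Re (G u))
                    (complex.Re (v t)) /\
                  is_derive t 1 (fun u => complex.Im (G u))
                    (complex.Im (v t))]].

Definition simple_closed (R : realType) (G : R -> R[i]) : Prop :=
  G 0 = G 1 /\
  forall t u, t \in `[0, 1[ -> u \in `[0, 1[ -> G t = G u -> t = u.

Definition trace (R : realType) (G : R -> R[i]) : set R[i]^o := G @` `[0, 1].

Definition velocity (R : realType) (G : R -> R[i]) (t : R) : R[i] :=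
  Complex (derive1 (fun u => complex.Re (G u)) t)
          (derive1 (fun u => complex.Im (G u)) t).

Definition curve_length (R : realType) (G : R -> R[i]) : R :=
  \int[lebesgue_measure]_(t in `[0, 1]) cabs (velocity G t).

Definition contour_integral (R : realType) (G : R -> R[i])
    (f : R[i] -> R[i]) : R[i] :=
  cintegral lebesgue_measure `[0, 1] (fun t => f (G t) * velocity G t).

Definition cauchy_transform (R : realType) (G : R -> R[i])
    (U : R[i] -> R[i]) (z : R[i]) : R[i] :=
  (twopii R)^-1 * contour_integral G (fun s => U s / (s - z)).

Definition mxcauchy_transform (R : realType) (G : R -> R[i])
    (U : R[i] -> 'M[R[i]]_2) (z : R[i]) : 'M[R[i]]_2 :=
  \matrix_(i, j) cauchy_transform G (fun s => U s i j) z.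

Definition cbounded (R : realType) (A : set R[i]^o) : Prop :=
  exists M : R, forall z, A z -> cabs z <= M.

Definition inside (R : realType) (G : R -> R[i]) : set R[i]^o :=
  [set z | ~ trace G z /\ cbounded (connected_component (~` trace G) z)].

Definition outside (R : realType) (G : R -> R[i]) : set R[i]^o :=
  [set z | ~ trace G z /\ ~ cbounded (connected_component (~` trace G) z)].

(* winding number 1 around each interior point *)
Definition counterclockwise (R : realType) (G : R -> R[i]) : Prop :=
  forall z, inside G z -> cauchy_transform G (fun=> 1) z = 1.

(* Convergence along this filter is convergence, for each aperture c, in the
   nontangential region |z - s| <= c dist(z, G) of the exterior of G. *)
Definition nt_exterior (R : realType) (G : R -> R[i]) (s : R[i]) :
    set_system R[i]^o :=
  [set A | forall c : R,
     within [set z : R[i]^o | outside G z /\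
               forall t, t \in `[0, 1] -> cabs (z - s) <= c * cabs (z - G t)]
       (nbhs (s : R[i]^o)) A].

Definition in_L2 (R : realType) (G : R -> R[i]) (U : R[i] -> R[i]) : Prop :=
  [/\ measurable_fun (`[0, 1] : set (measurableTypeR R))
        (fun t => complex.Re (U (G t))),
      measurable_fun (`[0, 1] : set (measurableTypeR R))
        (fun t => complex.Im (U (G t))) &
      (\int[lebesgue_measure]_(t in `[0%R, 1%R])
         (cabs (U (G t)) ^+ 2 * cabs (velocity G t))%:E < +oo)%E].

Definition norm_L2 (R : realType) (G : R -> R[i]) (U : R[i] -> R[i]) : R :=
  Num.sqrt (\int[lebesgue_measure]_(t in `[0, 1])
              (cabs (U (G t)) ^+ 2 * cabs (velocity G t))).

(* V represents the class of the exterior boundary values of the Cauchy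
   transform of U; the null sets of arc length are those of the parameter,
   as the velocity vanishes nowhere. *)
Definition cauchy_minus (R : realType) (G : R -> R[i]) (U V : R[i] -> R[i]) :
    Prop :=
  {ae (@lebesgue_measure R), forall t : measurableTypeR R, t \in `[0, 1] ->
    ((cauchy_transform G U : R[i]^o -> R[i]^o) @ nt_exterior G (G t)
       --> (V (G t) : R[i]^o))}.

Definition cauchy_minus_bounded_by (R : realType) (G : R -> R[i]) (C : R) :
    Prop :=
  forall U, in_L2 G U ->
    exists V, [/\ in_L2 G V, cauchy_minus G U V &
                  norm_L2 G V <= C * norm_L2 G U].

Definition norm_Linfty (R : realType) (G : R -> R[i])
    (F : R[i] -> 'M[R[i]]_2) : R :=
  fine (ess_sup (mrestr (@lebesgue_measure R) (measurable_itv `[0, 1]))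
          (fun t => (mxabs (F (G t)))%:E)).

(* At the points of the support, where Y and c_0 are not defined but their
   combination has removable singularities, the value is the limit from the
   complement of the support. *)
Definition Ytilde (R : realType) (G : R -> R[i])
    (m : {measure set (measurableTypeR R) -> \bar R}) (n : nat) (z : R[i]) :
    'M[R[i]]_2 :=
  let S : set R[i]^o := @creal R @` msupp m in
  let Yin w := Yop m n w *m mx2 1 (- cauchyop m 0 w) 0 1 in
  if `[< inside G z >] then
    if `[< S z >] then mxlim (within (~` S) (nbhs (z : R[i]^o))) Yin
    else Yin z
  else Yop m n z.

Definition Ycheck (R : realType) (G : R -> R[i]) (cc : R[i]) (p : nat)
    (m : {measure set (measurableTypeR R) -> \bar R}) (n : nat) (z : R[i]) :
    'M[R[i]]_2 :=
  let e : int := n%:Z - p%:Z in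
  mx2 (cc ^ e) 0 0 (cc ^ (- e)) *m Ytilde G m n z.

Definition Xmat (R : realType) (G : R -> R[i]) (cc : R[i]) (p : nat)
    (mu nu : {measure set (measurableTypeR R) -> \bar R}) (n : nat)
    (z : R[i]) : 'M[R[i]]_2 :=
  Ycheck G cc p nu n z *m invmx (Ycheck G cc p mu n z).

Definition c0diff (R : realType)
    (mu nu : {measure set (measurableTypeR R) -> \bar R}) (z : R[i]) : R[i] :=
  cauchyop mu 0 z - cauchyop nu 0 z.

Definition Mmat (R : realType) (G : R -> R[i]) (cc : R[i]) (p : nat)
    (mu : {measure set (measurableTypeR R) -> \bar R}) (n : nat) (s : R[i]) :
    'M[R[i]]_2 :=
  let Ym := mxlim (nt_exterior G s) (Ycheck G cc p mu n) in
  Ym *m mx2 0 1 0 0 *m invmx Ym.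

Definition Jmat (R : realType) (G : R -> R[i]) (cc : R[i]) (p : nat)
    (mu nu : {measure set (measurableTypeR R) -> \bar R}) (n : nat)
    (s : R[i]) : 'M[R[i]]_2 :=
  1%:M + c0diff mu nu s *: Mmat G cc p mu n s.

(* Main.v *)
Require Import Defs.
From mathcomp Require Import ring lra measurable_realfun.

(** Write X for the quotient of the two matrices and X_- for its boundary
    values on the curve from the exterior. X is analytic off the curve, tends to
    1 at infinity, and on the curve its interior values are X_- J. Cauchy's
    formula therefore gives, off the curve,

      X = 1 + C(X_- (J - 1)),

    where C is the Cauchy operator, and, at the boundary,
    X_- - 1 = C^-(X_- (J - 1)). If j is the essential supremum of J - 1, the
    bound on C^- makes the squared L2 norms S of the rows of X_- - 1 satisfy
    S <= 6 (C_N j)^2 (length + S), and as C_N j is small the last term is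
    absorbed ([row_energy_le]). The error in the statement is
    C((X_- - 1) (J - 1)), which a weighted arithmetic-geometric mean inequality
    bounds by a multiple of C_N j^2 length / dist(z, curve) ([error_bound]).
    The distance of z to the curve is comparable to 1 + |z|, because the curve
    winds once around a fixed point and has bounded length ([curve_bounded]).

    Cauchy's formula is only needed for functions that are known explicitly.
    Inside the curve X is a polynomial matrix ([Xmat_inside]). By orthogonality,
    an entry of X outside the curve is that of the identity matrix plus a
    constant times the difference of the Cauchy transforms of r d(mu) and
    r d(nu), with r a polynomial ([Yop_quotient]). Exchanging the integrals, all
    reduces to the integrals along the curve of polynomials and of simple
    fractions, that is, to primitives and to winding numbers ([cauchy_horner],
    [cauchy_ctr_inside], [cauchy_ctr_outside], and then [Xmat_cauchy]). The
    winding number is 1 inside by hypothesis. It is 0 outside: it is locally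
    constant, since the integral of (s - z)^-2 along a closed curve vanishes,
    and it tends to 0 at infinity ([winding_outside]).

    The non-tangential limits from the exterior are meaningful only at the
    points of the curve that are accessible in this way. Smooth points are: the
    winding number jumps across the curve there, so one of the sides lies in the
    exterior ([exterior_approach]). This leaves out finitely many parameters. *)

Set Implicit Arguments.
Unset Strict Implicit.
Unset Printing Implicit Defensive.

(** * The complex plane *)

Section Cabs.
Variable R : realType.
Implicit Types (z w : R[i]) (x y : R).

Lemma normcE z : `|z| = creal (cabs z).
Proof. by case: z. Qed.

Lemma cabsE z : cabs z = Num.sqrt (complex.Re z ^+ 2 + complex.Im z ^+ 2).
Proof. by case: z. Qed.

Lemma creal_inj : injective (@creal R). Proof. by move=> x y []. Qed.

Lemma crealD x y : creal (x + y) = creal x + creal y.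
Proof. exact: (rmorphD (real_complex R)). Qed.

Lemma crealB x y : creal (x - y) = creal x - creal y.
Proof. exact: (rmorphB (real_complex R)). Qed.

Lemma crealM x y : creal (x * y) = creal x * creal y.
Proof. exact: (rmorphM (real_complex R)). Qed.

Lemma crealV x : creal x^-1 = (creal x)^-1.
Proof. exact: (fmorphV (real_complex R)). Qed.

Lemma creal_nat n : creal n%:R = n%:R :> R[i].
Proof. exact: (rmorph_nat (real_complex R)). Qed.

Lemma creal_eq0 x : (creal x == 0) = (x == 0).
Proof. exact: (fmorph_eq0 (real_complex R)). Qed.

Lemma ler_creal x y : (creal x <= creal y) = (x <= y).
Proof. exact: lecR. Qed.

Lemma ltr_creal x y : (creal x < creal y) = (x < y).
Proof. exact: ltcR. Qed.

Lemma cabs_ge0 z : 0 <= cabs z. Proof. by rewrite cabsE sqrtr_ge0. Qed.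

Lemma cabs0 : cabs (0 : R[i]) = 0. Proof. by rewrite /cabs normr0. Qed.

Lemma cabs1 : cabs (1 : R[i]) = 1. Proof. by rewrite /cabs normr1. Qed.

Lemma cabsM z w : cabs (z * w) = cabs z * cabs w.
Proof. by apply: creal_inj; rewrite crealM -!normcE normrM. Qed.

Lemma cabsX z n : cabs (z ^+ n) = cabs z ^+ n.
Proof. by elim: n => [|n IH]; rewrite ?expr0 ?cabs1 // !exprS cabsM IH. Qed.

Lemma cabsV z : cabs z^-1 = (cabs z)^-1.
Proof. by apply: creal_inj; rewrite crealV -!normcE normfV. Qed.

Lemma cabsN z : cabs (- z) = cabs z.
Proof. by rewrite /cabs normrN. Qed.

Lemma cabsBC z w : cabs (z - w) = cabs (w - z).
Proof. by rewrite -cabsN opprB. Qed.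

Lemma cabsD z w : cabs (z + w) <= cabs z + cabs w.
Proof. by rewrite -ler_creal crealD -!normcE ler_normD. Qed.

Lemma cabsB z w : cabs (z - w) <= cabs z + cabs w.
Proof. by rewrite -(cabsN w) cabsD. Qed.

Lemma cabsBB z w : cabs z - cabs w <= cabs (z - w).
Proof. by rewrite lerBlDr (le_trans _ (cabsD _ _)) // subrK. Qed.

Lemma cabs_eq0 z : (cabs z == 0) = (z == 0).
Proof. by rewrite -creal_eq0 -normcE normr_eq0. Qed.

Lemma cabs_gt0 z : (0 < cabs z) = (z != 0).
Proof. by rewrite lt_def cabs_eq0 cabs_ge0 andbT. Qed.

Lemma cabs_creal x : cabs (creal x) = `|x|.
Proof. by rewrite cabsE /= expr0n addr0 sqrtr_sqr. Qed.

Lemma ler_Re_cabs z : `|complex.Re z| <= cabs z.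
Proof. by rewrite cabsE -sqrtr_sqr ler_wsqrtr // lerDl sqr_ge0. Qed.

Lemma ler_Im_cabs z : `|complex.Im z| <= cabs z.
Proof. by rewrite cabsE -sqrtr_sqr ler_wsqrtr // lerDr sqr_ge0. Qed.

Lemma complexDi z :
  z = creal (complex.Re z) + Complex 0 1 * creal (complex.Im z).
Proof. by rewrite {1}[z]complexE. Qed.

Lemma cabs_le z : cabs z <= `|complex.Re z| + `|complex.Im z|.
Proof.
rewrite {1}[z]complexDi (le_trans (cabsD _ _)) // cabsM !cabs_creal.
by rewrite cabsE /= expr0n expr1n add0r sqrtr1 mul1r.
Qed.

Lemma ReD z w : complex.Re (z + w) = complex.Re z + complex.Re w.
Proof. by case: z; case: w. Qed.
Lemma ImD z w : complex.Im (z + w) = complex.Im z + complex.Im w.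
Proof. by case: z; case: w. Qed.
Lemma ReN z : complex.Re (- z) = - complex.Re z.
Proof. by case: z. Qed.
Lemma ImN z : complex.Im (- z) = - complex.Im z.
Proof. by case: z. Qed.
Lemma ReM z w : complex.Re (z * w) =
  complex.Re z * complex.Re w - complex.Im z * complex.Im w.
Proof. by case: z; case: w. Qed.
Lemma ImM z w : complex.Im (z * w) =
  complex.Re z * complex.Im w + complex.Im z * complex.Re w.
Proof. by case: z; case: w. Qed.
Lemma ReV z : complex.Re z^-1 = complex.Re z / (cabs z ^+ 2).
Proof.
rewrite cabsE sqr_sqrtr; first by case: z.
by rewrite addr_ge0 // sqr_ge0.
Qed.
Lemma ImV z : complex.Im z^-1 = - (complex.Im z / (cabs z ^+ 2)).
Proof.
rewrite cabsE sqr_sqrtr; first by case: z.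
by rewrite addr_ge0 // sqr_ge0.
Qed.

Lemma complexP z w :
  complex.Re z = complex.Re w -> complex.Im z = complex.Im w -> z = w.
Proof. by case: z w => ? ? [? ?] /= -> ->. Qed.

Lemma cabs_sqr z : cabs z ^+ 2 = complex.Re z ^+ 2 + complex.Im z ^+ 2.
Proof. by rewrite cabsE sqr_sqrtr // addr_ge0 // sqr_ge0. Qed.

Lemma Re_ge z : complex.Re z >= 1 - cabs (z - 1).
Proof.
have := ler_Re_cabs (z - 1); rewrite ReD ReN /= ler_norml => /andP[+ _]; lra.
Qed.

Lemma twopii_neq0 : twopii R != 0.
Proof.
by rewrite eq_complex /= eqxx /= mulf_neq0 // gt_eqF // pi_gt0.
Qed.

Lemma cabs_twopii : cabs (twopii R) = 2 * pi.
Proof.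
rewrite cabsE /= expr0n add0r sqrtr_sqr ger0_norm //.
by rewrite mulr_ge0 // pi_ge0.
Qed.

(** The norm of the complex plane takes complex values; neighbourhoods can
    nevertheless be described with real radii. *)
Lemma nbhs_cabsP z (A : set R[i]^o) :
  nbhs (z : R[i]^o) A <->
  exists2 e : R, 0 < e & forall w, cabs (w - z) < e -> A w.
Proof.
split.
  rewrite -nbhs_ballE => -[e /= e0 eA].
  exists (complex.Re e); first by move: e0; rewrite ltcE => /andP[].
  move=> w wz; apply: eA; rewrite -ball_normE /= distrC normcE.
  move: e0 wz; case: e => e1 e2; rewrite ltcE /= => /andP[/eqP -> _].
  by rewrite ltcE /= eqxx.
move=> [e e0 eA]; rewrite -nbhs_ballE; exists (creal e) => /=.
  by rewrite ltr_creal.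
move=> w; rewrite -ball_normE /= distrC normcE ltr_creal; exact: eA.
Qed.

Lemma cvg_cabsP (T : Type) (F : set_system T) {FF : Filter F}
    (f : T -> R[i]) (l : R[i]) :
  (f : T -> R[i]^o) @ F --> (l : R[i]^o) <->
  forall e : R, 0 < e -> \forall x \near F, cabs (f x - l) < e.
Proof.
split=> [fl e e0|fl A].
  by apply: (fl [set w | cabs (w - l) < e]); apply/nbhs_cabsP; exists e.
move=> /nbhs_cabsP[e e0 eA].
by move: (fl e e0); apply: filterS => x; exact: eA.
Qed.

Lemma cvg_nbhs_cabsP (f : R[i] -> R[i]) (z l : R[i]) :
  (f : R[i]^o -> R[i]^o) @ (z : R[i]^o) --> (l : R[i]^o) <->
  forall e : R, 0 < e -> exists2 d : R, 0 < d &
    forall w, cabs (w - z) < d -> cabs (f w - l) < e.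
Proof.
split=> [/(cvg_cabsP (F := nbhs (z : R[i]^o))) fl e /fl|fl].
  by move=> /nbhs_cabsP.
apply/(cvg_cabsP (F := nbhs (z : R[i]^o))) => e /fl h; exact/nbhs_cabsP.
Qed.

End Cabs.

Section Ccvg.
Variable R : realType.
Implicit Types (f h : R[i] -> R[i]) (z a b c : R[i]).

Lemma ccvg_cst c z : ((fun=> c) : R[i]^o -> R[i]^o) @ (z : R[i]^o) --> (c : R[i]^o).
Proof. by apply/cvg_nbhs_cabsP => e e0; exists 1 => // w _; rewrite subrr cabs0. Qed.

Lemma ccvgD f h z a b :
  (f : R[i]^o -> R[i]^o) @ (z : R[i]^o) --> (a : R[i]^o) ->
  (h : R[i]^o -> R[i]^o) @ (z : R[i]^o) --> (b : R[i]^o) ->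
  ((fun w => f w + h w) : R[i]^o -> R[i]^o) @ (z : R[i]^o) --> (a + b : R[i]^o).
Proof.
move=> /cvg_nbhs_cabsP fa /cvg_nbhs_cabsP hb; apply/cvg_nbhs_cabsP => e e0.
have e20 : 0 < e / 2 by rewrite divr_gt0.
have [d1 d10 h1] := fa _ e20; have [d2 d20 h2] := hb _ e20.
exists (Num.min d1 d2); first by rewrite lt_min d10.
move=> w; rewrite lt_min => /andP[/h1 k1 /h2 k2].
rewrite opprD addrACA (le_lt_trans (cabsD _ _)) //.
by rewrite [ltRHS]splitr ltrD.
Qed.

Lemma ccvgM f h z a b :
  (f : R[i]^o -> R[i]^o) @ (z : R[i]^o) --> (a : R[i]^o) ->
  (h : R[i]^o -> R[i]^o) @ (z : R[i]^o) --> (b : R[i]^o) ->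
  ((fun w => f w * h w) : R[i]^o -> R[i]^o) @ (z : R[i]^o) --> (a * b : R[i]^o).
Proof.
move=> /cvg_nbhs_cabsP fa /cvg_nbhs_cabsP hb; apply/cvg_nbhs_cabsP => e e0.
have b0 : 0 < 2 * (cabs b + 1) by rewrite mulr_gt0 // ltr_wpDl ?cabs_ge0.
have a0 : 0 < 2 * (cabs a + 1) by rewrite mulr_gt0 // ltr_wpDl ?cabs_ge0.
have [d1 d10 h1] := fa _ (divr_gt0 e0 b0).
have [d2 d20 h2] := hb _ (divr_gt0 e0 a0).
have [d3 d30 h3] := hb _ ltr01.
exists (Num.min d1 (Num.min d2 d3)); first by rewrite !lt_min d10 d20.
move=> w; rewrite !lt_min => /andP[/h1 k1 /andP[/h2 k2 /h3 k3]].
have -> : f w * h w - a * b = (f w - a) * h w + a * (h w - b) by ring.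
rewrite (le_lt_trans (cabsD _ _)) // !cabsM.
have hw : cabs (h w) <= cabs b + 1.
  have -> : h w = b + (h w - b) by ring.
  by rewrite (le_trans (cabsD _ _)) // lerD2l ltW.
rewrite [ltRHS]splitr; apply: ltr_leD.
  apply: (@le_lt_trans _ _ (cabs (f w - a) * (cabs b + 1))).
    by rewrite ler_wpM2l ?cabs_ge0.
  rewrite -ltr_pdivlMr; last by rewrite ltr_wpDl ?cabs_ge0.
  by move: k1; rewrite invfM mulrA.
apply: (@le_trans _ _ ((cabs a + 1) * cabs (h w - b))).
  by rewrite ler_wpM2r ?cabs_ge0 // lerDl.
rewrite mulrC -ler_pdivlMr; last by rewrite ltr_wpDl ?cabs_ge0.
by move: k2 => /ltW; rewrite invfM mulrA.
Qed.

Lemma horner_cvg (P : {poly R[i]}) z :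
  ((fun w => P.[w]) : R[i]^o -> R[i]^o) @ (z : R[i]^o) --> (P.[z] : R[i]^o).
Proof.
elim/poly_ind: P => [|P c IH].
  by under eq_fun do rewrite horner0; rewrite horner0; exact: ccvg_cst.
under eq_fun do rewrite hornerMXaddC; rewrite hornerMXaddC.
apply: (@ccvgD (fun w => P.[w] * w) (fun=> c)); last exact: ccvg_cst.
apply: (@ccvgM (fun w => P.[w]) id); first exact: IH.
by apply/cvg_nbhs_cabsP => e e0; exists e.
Qed.

End Ccvg.

(** * Bounded measurable complex functions and their integrals *)

(** The function f is bounded and measurable on D; measurability is that of the
    real and imaginary parts. On a set of finite measure such functions are
    integrable, and unlike integrable functions they are stable by product. *)
Definition bmfun (R : realType) d (T : measurableType d) (D : set T)
    (f : T -> R[i]) : Prop :=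
  [/\ measurable_fun D (fun x => complex.Re (f x)),
      measurable_fun D (fun x => complex.Im (f x)) &
      exists M : R, forall x, D x -> cabs (f x) <= M].

Section Bmfun.
Variables (R : realType) (d : measure_display) (T : measurableType d).
Variable D : set T.
Implicit Types f h : T -> R[i].

Lemma eq_bmfun f h : (forall x, D x -> f x = h x) -> bmfun D f -> bmfun D h.
Proof.
move=> fh [mr mi [M fM]]; split.
- by apply: eq_measurable_fun mr => x /set_mem Dx; rewrite fh.
- by apply: eq_measurable_fun mi => x /set_mem Dx; rewrite fh.
- by exists M => x Dx; rewrite -fh // fM.
Qed.

Lemma bmfunS (E : set T) f : measurable D -> E `<=` D ->
  bmfun D f -> bmfun E f.
Proof.
move=> mD ED [mr mi [M fM]]; split.
- exact: measurable_funS mr.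
- exact: measurable_funS mi.
- by exists M => x /ED /fM.
Qed.

Lemma bmfun_cst (c : R[i]) : bmfun D (fun=> c).
Proof. by split; [exact: measurable_cst..|exists (cabs c)]. Qed.

Lemma bmfunN f : bmfun D f -> bmfun D (fun x => - f x).
Proof.
move=> [mr mi [M fM]]; split.
- apply: eq_measurable_fun (measurable_funN mr) => x _ /=.
  by rewrite ReN.
- apply: eq_measurable_fun (measurable_funN mi) => x _ /=.
  by rewrite ImN.
- by exists M => x Dx; rewrite cabsN fM.
Qed.

Lemma bmfunD f h : bmfun D f -> bmfun D h -> bmfun D (fun x => f x + h x).
Proof.
move=> [mr mi [M fM]] [mr' mi' [M' hM]]; split.
- apply: eq_measurable_fun (measurable_funD mr mr') => x _ /=.
  by rewrite ReD.
- apply: eq_measurable_fun (measurable_funD mi mi') => x _ /=.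
  by rewrite ImD.
- exists (M + M') => x Dx.
  by rewrite (le_trans (cabsD _ _)) // lerD ?fM ?hM.
Qed.

Lemma bmfunB f h : bmfun D f -> bmfun D h -> bmfun D (fun x => f x - h x).
Proof. by move=> bf bh; apply: bmfunD => //; exact: bmfunN. Qed.

Lemma bmfunM f h : bmfun D f -> bmfun D h -> bmfun D (fun x => f x * h x).
Proof.
move=> [mr mi [M fM]] [mr' mi' [M' hM]]; split.
- apply: eq_measurable_fun
    (measurable_funB (measurable_funM mr mr') (measurable_funM mi mi')) => x _ /=.
  by rewrite ReM.
- apply: eq_measurable_fun
    (measurable_funD (measurable_funM mr mi') (measurable_funM mi mr')) => x _ /=.
  by rewrite ImM.
- exists (M * M') => x Dx.
  by rewrite cabsM ler_pM ?cabs_ge0 ?fM ?hM.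
Qed.

Lemma bmfunZ (c : R[i]) f : bmfun D f -> bmfun D (fun x => c * f x).
Proof. by move=> bf; apply: bmfunM => //; exact: bmfun_cst. Qed.

Lemma bmfunX f n : bmfun D f -> bmfun D (fun x => f x ^+ n).
Proof.
move=> bf; elim: n => [|n IH].
  by apply: eq_bmfun (bmfun_cst 1) => x _; rewrite expr0.
by apply: eq_bmfun (bmfunM bf IH) => x _; rewrite exprS.
Qed.

Lemma bmfun_sum (I : Type) (r : seq I) (P : pred I) (F : I -> T -> R[i]) :
  (forall i, P i -> bmfun D (F i)) ->
  bmfun D (fun x => \sum_(i <- r | P i) F i x).
Proof.
move=> bF; elim: r => [|i r IH].
  by apply: eq_bmfun (bmfun_cst 0) => x _; rewrite big_nil.
case Pi : (P i); last first.
  by apply: eq_bmfun IH => x _; rewrite big_cons Pi.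
by apply: eq_bmfun (bmfunD (bF _ Pi) IH) => x _; rewrite big_cons Pi.
Qed.

Lemma bmfun_cabs2_measurable f : bmfun D f ->
  measurable_fun D (fun x => cabs (f x) ^+ 2).
Proof.
move=> [mr mi _]; apply: eq_measurable_fun
  (measurable_funD (measurable_funX 2 mr) (measurable_funX 2 mi)) => x _ /=.
by rewrite cabs_sqr.
Qed.

Lemma bmfun_cabs_measurable f : bmfun D f ->
  measurable_fun D (fun x => cabs (f x)).
Proof.
move=> /bmfun_cabs2_measurable mf.
apply: eq_measurable_fun (measurableT_comp (measurable_powR 2^-1) mf) => x _ /=.
by rewrite powR12_sqrt ?sqr_ge0 // sqrtr_sqr ger0_norm // cabs_ge0.
Qed.

Lemma bmfunV f (e : R) : 0 < e -> (forall x, D x -> e <= cabs (f x)) ->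
  bmfun D f -> bmfun D (fun x => (f x)^-1).
Proof.
move=> e0 fe bf; have [mr mi _] := bf.
have mV : measurable_fun D (fun x => (cabs (f x) ^+ 2)^-1).
  apply: eq_measurable_fun (measurableT_comp (measurable_powR (-1))
    (bmfun_cabs2_measurable bf)) => x _ /=.
  by rewrite powR_inv1 // sqr_ge0.
split.
- by apply: eq_measurable_fun (measurable_funM mr mV) => x _ /=; rewrite ReV.
- apply: eq_measurable_fun (measurable_funN (measurable_funM mi mV)) => x _ /=.
  by rewrite ImV.
- exists e^-1 => x Dx; rewrite cabsV lef_pV2 ?fe // posrE.
  exact: lt_le_trans (fe x Dx).
Qed.

Lemma bmfun_creal (f : T -> R) (M : R) : measurable_fun D f ->
  (forall x, D x -> `|f x| <= M) -> bmfun D (fun x => creal (f x)).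
Proof.
move=> mf fM; split => //=.
by exists M => x Dx; rewrite cabs_creal fM.
Qed.

Lemma bmfun_cabs f : bmfun D f -> bmfun D (fun x => creal (cabs (f x))).
Proof.
move=> bf; have [_ _ [M fM]] := bf.
apply: (bmfun_creal (M := M)); first exact: bmfun_cabs_measurable.
by move=> x Dx; rewrite ger0_norm ?cabs_ge0 ?fM.
Qed.

End Bmfun.

Lemma bmfun_comp (R : realType) d1 d2 (T1 : measurableType d1)
    (T2 : measurableType d2) (D : set T2) (E : set T1) (f : T2 -> R[i])
    (phi : T1 -> T2) : measurable D -> measurable_fun E phi ->
  (forall x, E x -> D (phi x)) -> bmfun D f -> bmfun E (fun x => f (phi x)).
Proof.
move=> mD mphi ED [mr mi [M fM]]; split.
- apply: (measurable_comp mD _ mr mphi) => _ [x Ex <-]; exact: ED.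
- apply: (measurable_comp mD _ mi mphi) => _ [x Ex <-]; exact: ED.
- by exists M => x /ED /fM.
Qed.

Section BmfunIntegral.
Variables (R : realType) (d : measure_display) (T : measurableType d).
Variables (m : {measure set T -> \bar R}) (D : set T).
Hypotheses (mD : measurable D) (mDfin : (m D < +oo)%E).
Implicit Types f h : T -> R[i].

Lemma bounded_integrable (f : T -> R) (M : R) : measurable_fun D f ->
  (forall x, D x -> `|f x| <= M) -> m.-integrable D (EFin \o f).
Proof.
move=> mf fM; apply: measurable_bounded_integrable => //.
exists M; split; first exact: num_real.
by move=> N MN x /= Dx; rewrite (le_trans (fM x Dx)) // ltW.
Qed.

Lemma bmfun_intRe f : bmfun D f ->
  m.-integrable D (EFin \o (fun x => complex.Re (f x))).
Proof.
move=> [mr mi [M fM]]; apply: (bounded_integrable (M := M)) => // x Dx.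
by rewrite (le_trans (ler_Re_cabs _)) // fM.
Qed.

Lemma bmfun_intIm f : bmfun D f ->
  m.-integrable D (EFin \o (fun x => complex.Im (f x))).
Proof.
move=> [mr mi [M fM]]; apply: (bounded_integrable (M := M)) => // x Dx.
by rewrite (le_trans (ler_Im_cabs _)) // fM.
Qed.

Lemma bmfun_intcabs f : bmfun D f ->
  m.-integrable D (EFin \o (fun x => cabs (f x))).
Proof. by move=> /bmfun_cabs /bmfun_intRe. Qed.

End BmfunIntegral.

Section Cintegral.
Variables (R : realType) (m : {measure set (measurableTypeR R) -> \bar R}).
Variable D : set (measurableTypeR R).
Hypotheses (mD : measurable D) (mDfin : (m D < +oo)%E).
Implicit Types f h : R -> R[i].

Lemma eq_cintegral f h : (forall x, D x -> f x = h x) ->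
  cintegral m D f = cintegral m D h.
Proof.
by move=> fh; rewrite /cintegral; congr Complex; apply: eq_Rintegral => x /set_mem Dx;
  rewrite fh.
Qed.

Lemma cintegralD f h : bmfun D f -> bmfun D h ->
  cintegral m D (fun x => f x + h x) = cintegral m D f + cintegral m D h.
Proof.
move=> bf bh; apply: complexP => /=.
  under eq_Rintegral do rewrite ReD.
  by rewrite RintegralD //; exact: bmfun_intRe.
under eq_Rintegral do rewrite ImD.
by rewrite RintegralD //; exact: bmfun_intIm.
Qed.

Lemma cintegralZ (c : R[i]) f : bmfun D f ->
  cintegral m D (fun x => c * f x) = c * cintegral m D f.
Proof.
move=> bf; have iR := bmfun_intRe mD mDfin bf; have iI := bmfun_intIm mD mDfin bf.
have iZ (r : R) (h : R -> R) : m.-integrable D (EFin \o h) ->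
    m.-integrable D (EFin \o (fun x => r * h x)).
  by move=> ih; have := integrableZl mD r ih; apply: eq_integrable.
apply: complexP => /=.
  under eq_Rintegral do rewrite ReM.
  by rewrite RintegralB ?RintegralZl ?ReM //; apply: iZ.
under eq_Rintegral do rewrite ImM.
by rewrite RintegralD ?RintegralZl ?ImM //; apply: iZ.
Qed.

Lemma cintegralN f : bmfun D f ->
  cintegral m D (fun x => - f x) = - cintegral m D f.
Proof.
move=> bf; rewrite -mulN1r -cintegralZ //; apply: eq_cintegral => x _.
by rewrite mulN1r.
Qed.

Lemma cintegralB f h : bmfun D f -> bmfun D h ->
  cintegral m D (fun x => f x - h x) = cintegral m D f - cintegral m D h.
Proof.
by move=> bf bh; rewrite cintegralD ?cintegralN //; exact: bmfunN.
Qed.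

Lemma cintegral_sum (I : Type) (r : seq I) (F : I -> R -> R[i]) :
  (forall i, bmfun D (F i)) ->
  cintegral m D (fun x => \sum_(i <- r) F i x)
  = \sum_(i <- r) cintegral m D (F i).
Proof.
move=> bF; elim: r => [|i r IH].
  rewrite big_nil; under eq_cintegral do rewrite big_nil.
  by rewrite /cintegral /= /Rintegral integral0.
rewrite big_cons -IH -cintegralD //; last exact: bmfun_sum.
by apply: eq_cintegral => x _; rewrite big_cons.
Qed.

(** A crude triangle inequality; the optimal constant is 1. *)
Lemma cabs_cintegral_le f : bmfun D f ->
  cabs (cintegral m D f) <= 2 * \int[m]_(x in D) cabs (f x).
Proof.
move=> bf; have ic := bmfun_intcabs mD mDfin bf.
have iR := bmfun_intRe mD mDfin bf; have iI := bmfun_intIm mD mDfin bf.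
have abs_int (h : R -> R) : m.-integrable D (EFin \o h) ->
    m.-integrable D (EFin \o (fun x => `|h x|)).
  by move=> ih; apply: eq_integrable (integrable_abse ih).
rewrite (le_trans (cabs_le _)) // mulr_natl mulr2n lerD //=.
  rewrite (le_trans (le_normr_Rintegral mD iR)) // le_Rintegral //.
    exact: abs_int.
  by move=> x _; exact: ler_Re_cabs.
rewrite (le_trans (le_normr_Rintegral mD iI)) // le_Rintegral //.
  exact: abs_int.
by move=> x _; exact: ler_Im_cabs.
Qed.

Lemma cabs_cintegral_bound f (B : R) : bmfun D f ->
  (forall x, D x -> cabs (f x) <= B) ->
  cabs (cintegral m D f) <= 2 * (B * fine (m D)).
Proof.
move=> bf fB; rewrite (le_trans (cabs_cintegral_le bf)) // ler_pM2l //.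
rewrite -Rintegral_cst // le_Rintegral //; first exact: bmfun_intcabs.
by apply: (bounded_integrable mD mDfin (M := `|B|)) => // x _.
Qed.

End Cintegral.

(** * Complex functions of a real variable *)

(** Continuity on a segment of a complex function of a real variable. *)
Definition ccont (R : realType) (a b : R) (f : R -> R[i]) : Prop :=
  {within `[a, b], continuous (f : R -> R[i]^o)}.

Section Ccont.
Variables (R : realType) (a b : R).
Implicit Types f h : R -> R[i].

Lemma ccontP f : ccont a b f <->
  forall t, a <= t <= b ->
  (f : R -> R[i]^o) @ within `[a, b] (nbhs t) --> (f t : R[i]^o).
Proof.
split=> [/subspace_continuousP cf t tab|cf]; first by apply: cf; rewrite /= in_itv.
by apply/subspace_continuousP => t /=; rewrite in_itv /= => /cf.
Qed.

Lemma ccont_lip (F : R -> R) f :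
  (forall t u, `|F t - F u| <= cabs (f t - f u)) ->
  ccont a b f -> {within `[a, b], continuous F}.
Proof.
move=> Ff /subspace_continuousP cf; apply/subspace_continuousP => t tab.
apply/cvgrPdist_lt => e e0; have /cvg_cabsP/(_ e e0) := cf t tab.
by apply: filterS => u; rewrite cabsBC; exact: le_lt_trans.
Qed.

Lemma ccontRe f : ccont a b f -> {within `[a, b], continuous (fun t => complex.Re (f t))}.
Proof.
by apply: ccont_lip => t u; rewrite -ReN -ReD ler_Re_cabs.
Qed.

Lemma ccontIm f : ccont a b f -> {within `[a, b], continuous (fun t => complex.Im (f t))}.
Proof.
by apply: ccont_lip => t u; rewrite -ImN -ImD ler_Im_cabs.
Qed.

Lemma ccontcabs f : ccont a b f -> {within `[a, b], continuous (fun t => cabs (f t))}.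
Proof.
apply: ccont_lip => t u; rewrite ler_norml cabsBB andbT.
by rewrite lerNl opprB cabsBC cabsBB.
Qed.

Lemma ccont_cst (c : R[i]) : ccont a b (fun=> c).
Proof. by apply/ccontP => t _; exact: cvg_cst. Qed.

Lemma ccontN f : ccont a b f -> ccont a b (fun t => - f t).
Proof. by move=> /ccontP cf; apply/ccontP => t /cf; exact: cvgN. Qed.

Lemma ccontD f h : ccont a b f -> ccont a b h -> ccont a b (fun t => f t + h t).
Proof.
by move=> /ccontP cf /ccontP ch; apply/ccontP => t tab; apply: cvgD; [exact: cf|exact: ch].
Qed.

Lemma ccontB f h : ccont a b f -> ccont a b h -> ccont a b (fun t => f t - h t).
Proof. by move=> cf ch; exact: ccontD cf (ccontN ch). Qed.

Lemma ccontM f h : ccont a b f -> ccont a b h -> ccont a b (fun t => f t * h t).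
Proof.
by move=> /ccontP cf /ccontP ch; apply/ccontP => t tab; apply: cvgM; [exact: cf|exact: ch].
Qed.

Lemma ccontV f : (forall t, a <= t <= b -> f t != 0) ->
  ccont a b f -> ccont a b (fun t => (f t)^-1).
Proof.
by move=> f0 /ccontP cf; apply/ccontP => t tab; apply: cvgV; [exact: f0|exact: cf].
Qed.

Lemma ccontX f n : ccont a b f -> ccont a b (fun t => f t ^+ n).
Proof.
move=> cf; elim: n => [|n IH].
  have -> : (fun t => f t ^+ 0) = (fun=> 1) by apply/funext => t; rewrite expr0.
  exact: ccont_cst.
have -> : (fun t => f t ^+ n.+1) = (fun t => f t * f t ^+ n).
  by apply/funext => t; rewrite exprS.
exact: ccontM.
Qed.

Lemma ccontS c e f : a <= c -> e <= b -> ccont a b f -> ccont c e f.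
Proof.
move=> ac eb; apply: continuous_subspaceW => t /=; rewrite !in_itv /= => /andP[? ?].
by apply/andP; split; [exact: le_trans ac _|exact: le_trans eb].
Qed.

Lemma ccont_bounded f : ccont a b f ->
  exists M : R, forall t, a <= t <= b -> cabs (f t) <= M.
Proof.
move=> cf; case: (leP a b) => ab; last first.
  by exists 0 => t /andP[/le_trans h /h]; rewrite leNgt ab.
have [c _ cM] := EVT_max ab (ccontcabs cf).
by exists (cabs (f c)) => t tab; apply: cM; rewrite in_itv.
Qed.

Lemma ccont_bmfun f : ccont a b f -> bmfun (`[a, b] : set (measurableTypeR R)) f.
Proof.
move=> cf; split.
- by apply: subspace_continuous_measurable_fun => //; exact: ccontRe.
- by apply: subspace_continuous_measurable_fun => //; exact: ccontIm.
- have [M fM] := ccont_bounded cf.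
  by exists M => t /=; rewrite in_itv /= => /fM.
Qed.

End Ccont.

(** The complex function f of a real variable has derivative v at t. *)
Definition cderiv (R : realType) (f : R -> R[i]) (t : R) (v : R[i]) : Prop :=
  is_derive t 1 (fun u => complex.Re (f u)) (complex.Re v) /\
  is_derive t 1 (fun u => complex.Im (f u)) (complex.Im v).

Section Cderiv.
Variable R : realType.
Implicit Types (f h : R -> R[i]) (t : R) (v w : R[i]).

Lemma cderiv_cst (c : R[i]) t : cderiv (fun=> c) t 0.
Proof. by split; exact: is_derive_cst. Qed.

Lemma cderivD f h t v w : cderiv f t v -> cderiv h t w ->
  cderiv (fun u => f u + h u) t (v + w).
Proof.
move=> [fr fi] [hr hi]; split; rewrite ?ReD ?ImD.
  have -> : (fun u => complex.Re (f u + h u)) =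
    (fun u => complex.Re (f u)) + (fun u => complex.Re (h u)).
    by apply/funext => u; rewrite ReD.
  exact: is_deriveD.
have -> : (fun u => complex.Im (f u + h u)) =
  (fun u => complex.Im (f u)) + (fun u => complex.Im (h u)).
  by apply/funext => u; rewrite ImD.
exact: is_deriveD.
Qed.

Lemma cderivM f h t v w : cderiv f t v -> cderiv h t w ->
  cderiv (fun u => f u * h u) t (v * h t + f t * w).
Proof.
move=> [fr fi] [hr hi]; split.
  have -> : (fun u => complex.Re (f u * h u)) =
    (fun u => complex.Re (f u)) * (fun u => complex.Re (h u))
    - (fun u => complex.Im (f u)) * (fun u => complex.Im (h u)).
    by apply/funext => u; rewrite ReM.
  apply: is_derive_eq (is_deriveB (is_deriveM fr hr) (is_deriveM fi hi)) _.
  rewrite ReD !ReM /GRing.scale /=; ring.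
have -> : (fun u => complex.Im (f u * h u)) =
  (fun u => complex.Re (f u)) * (fun u => complex.Im (h u))
  + (fun u => complex.Im (f u)) * (fun u => complex.Re (h u)).
  by apply/funext => u; rewrite ImM.
apply: is_derive_eq (is_deriveD (is_deriveM fr hi) (is_deriveM fi hr)) _.
rewrite ImD !ImM /GRing.scale /=; ring.
Qed.

Lemma cderivX f t v n : cderiv f t v ->
  cderiv (fun u => f u ^+ n.+1) t (n.+1%:R * f t ^+ n * v).
Proof.
move=> fv; elim: n => [|n IH].
  have -> : (fun u => f u ^+ 1) = f by apply/funext => u; rewrite expr1.
  by rewrite expr0 !mul1r.
have -> : (fun u => f u ^+ n.+2) = (fun u => f u * f u ^+ n.+1).
  by apply/funext => u; rewrite exprS.
have := cderivM fv IH; congr cderiv.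
rewrite -[n.+2]addn1 natrD exprS; ring.
Qed.

Lemma cderivV f t v : f t != 0 -> cderiv f t v ->
  cderiv (fun u => (f u)^-1) t (- v / f t ^+ 2).
Proof.
move=> ft0 [fr fi].
pose N u := cabs (f u) ^+ 2.
have NE : N = (fun u => complex.Re (f u)) ^+ 2 + (fun u => complex.Im (f u)) ^+ 2.
  by apply/funext => u; rewrite /N cabs_sqr.
have Nt0 : N t != 0 by rewrite /N expf_neq0 // cabs_eq0.
set x := complex.Re (f t) in fr *; set y := complex.Im (f t) in fi *.
set x' := complex.Re v in fr *; set y' := complex.Im v in fi *.
have dN : is_derive t 1 N (2 * x * x' + 2 * y * y').
  rewrite NE; apply: is_derive_eq (is_deriveD (is_deriveX 2 fr) (is_deriveX 2 fi)) _.
  by rewrite /GRing.scale /= -/x -/y !expr1; ring.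
have dNV := is_deriveV Nt0 dN.
have NtE : N t = x ^+ 2 + y ^+ 2 by rewrite /N cabs_sqr.
rewrite NtE in Nt0.
have vE : - v / f t ^+ 2 = Complex
  ((- x' * (x ^+ 2 - y ^+ 2) - y' * (2 * x * y)) / (x ^+ 2 + y ^+ 2) ^+ 2)
  ((- y' * (x ^+ 2 - y ^+ 2) + x' * (2 * x * y)) / (x ^+ 2 + y ^+ 2) ^+ 2).
  have sq : cabs (f t ^+ 2) ^+ 2 = (x ^+ 2 + y ^+ 2) ^+ 2.
    by rewrite cabsX -/(N t) NtE.
  apply: complexP; rewrite /= ?ReM ?ImM ReV ImV sq ReN ImN expr2 ReM ImM -/x -/y -/x' -/y'; ring.
rewrite vE; split => /=.
  have -> : (fun u => complex.Re (f u)^-1) =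
      (fun u => complex.Re (f u)) * (fun u => (N u)^-1).
    by apply/funext => u; rewrite ReV.
  apply: is_derive_eq; rewrite /GRing.scale /= -/x NtE; field.
  by [].
have -> : (fun u => complex.Im (f u)^-1) =
    - ((fun u => complex.Im (f u)) * (fun u => (N u)^-1)).
  by apply/funext => u; rewrite ImV.
apply: is_derive_eq; rewrite /GRing.scale /= -/y NtE; field.
by [].
Qed.

(** The fundamental theorem of calculus for complex functions of a real
    variable. *)
Lemma cintegral_FTC (a b : R) (F f : R -> R[i]) : a < b ->
  ccont a b F -> ccont a b f ->
  (forall t, a < t < b -> cderiv F t (f t)) ->
  cintegral lebesgue_measure `[a, b] f = F b - F a.
Proof.
move=> ab cF cf dF.
have ftc (H h : R -> R) : {within `[a, b], continuous H} ->
    {within `[a, b], continuous h} ->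
    (forall t, a < t < b -> is_derive t 1 H (h t)) ->
    \int[lebesgue_measure]_(x in `[a, b]) h x = H b - H a.
  move=> cH ch dH; rewrite /Rintegral (@continuous_FTC2 _ h H) //.
    have /(continuous_within_itvP _ ab) [_ Ha Hb] := cH.
    split => // t; rewrite in_itv /= => /dH tH; exact: ex_derive.
  by move=> t; rewrite in_itv /= => /dH tH; rewrite derive1E derive_val.
apply: complexP; rewrite /= ?ReD ?ImD ?ReN ?ImN.
  apply: (ftc (fun t => complex.Re (F t)) (fun t => complex.Re (f t))).
  - exact: ccontRe.
  - exact: ccontRe.
  - by move=> t /dF[].
apply: (ftc (fun t => complex.Im (F t)) (fun t => complex.Im (f t))).
- exact: ccontIm.
- exact: ccontIm.
- by move=> t /dF[].
Qed.

End Cderiv.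

(** * Piecewise smooth curves *)

Lemma bmfunU (R : realType) d (T : measurableType d) (A B : set T)
    (f : T -> R[i]) : measurable A -> measurable B ->
  bmfun A f -> bmfun B f -> bmfun (A `|` B) f.
Proof.
move=> mA mB [r1 i1 [M1 f1]] [r2 i2 [M2 f2]]; split.
- by apply/measurable_funU.
- by apply/measurable_funU.
- exists (Num.max M1 M2) => x [/f1|/f2] h; rewrite le_max h ?orbT //.
Qed.

Lemma lebesgue_itvcc_fin (R : realType) (a b : R) :
  (@lebesgue_measure R `[a, b] < +oo)%E.
Proof. by rewrite lebesgue_measure_itv /=; case: ifP => _; rewrite ?ltry // -EFinB ltry. Qed.

Section CintegralItv.
Variable R : realType.
Notation mu := (@lebesgue_measure R).

(** Two functions that agree inside an interval have the same integral over
    it, whatever they do at the end points. *)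
Lemma eq_cintegral_oc (a b : R) (f h : R -> R[i]) :
  bmfun (`[a, b] : set (measurableTypeR R)) f ->
  bmfun (`[a, b] : set (measurableTypeR R)) h ->
  (forall t, a < t < b -> f t = h t) ->
  cintegral mu `]a, b] f = cintegral mu `[a, b] h.
Proof.
move=> bf bh fh.
have key (F H : R -> R) : mu.-integrable `[a, b] (EFin \o F) ->
    mu.-integrable `[a, b] (EFin \o H) -> (forall t, a < t < b -> F t = H t) ->
    \int[mu]_(x in `]a, b]) F x = \int[mu]_(x in `[a, b]) H x.
  have sub1 : `]a, b[ `<=` `[a, b] by exact: subset_itv_oo_cc.
  have sub2 : `]a, b] `<=` `[a, b] by exact: subset_itv_oc_cc.
  move=> iF iH FH.
  have iF1 : mu.-integrable `]a, b[ (EFin \o F) by exact: integrableS iF.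
  have iH1 : mu.-integrable `]a, b[ (EFin \o H) by exact: integrableS iH.
  have iH2 : mu.-integrable `]a, b] (EFin \o H) by exact: integrableS iH.
  rewrite -Rintegral_itv_bndo_bndc // -Rintegral_itv_obnd_cbnd //.
  rewrite -[RHS]Rintegral_itv_bndo_bndc //; apply: eq_Rintegral => t.
  by rewrite inE /= in_itv /= => /FH.
have fin := lebesgue_itvcc_fin a b.
apply: complexP => /=; apply: key => [||t tab].
- exact: bmfun_intRe.
- exact: bmfun_intRe.
- by rewrite fh.
- exact: bmfun_intIm.
- exact: bmfun_intIm.
- by rewrite fh.
Qed.

Lemma cintegral_itv_split (a b c : R) (f : R -> R[i]) : a <= b <= c ->
  bmfun (`[a, c] : set (measurableTypeR R)) f ->
  cintegral mu `[a, c] f = cintegral mu `[a, b] f + cintegral mu `]b, c] f.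
Proof.
move=> /andP[ab bc] bf.
have split (F : R -> R) : mu.-integrable `[a, c] (EFin \o F) ->
    \int[mu]_(x in `[a, c]) F x =
    \int[mu]_(x in `[a, b]) F x + \int[mu]_(x in `]b, c]) F x.
  have E : (`[a, c] = `[a, b] `|` `]b, c])%classic.
    by rewrite -itv_bndbnd_setU // bnd_simp.
  move=> iF; rewrite {1}E Rintegral_setU //.
    by rewrite -E.
  apply/disj_setPS => x /= []; rewrite !in_itv /= => /andP[_ xb] /andP[bx _].
  by move: xb; rewrite leNgt bx.
have fin := lebesgue_itvcc_fin a c.
apply: complexP; rewrite ?ReD ?ImD /=; apply: split.
  exact: bmfun_intRe.
exact: bmfun_intIm.
Qed.

End CintegralItv.

(** The parameter t is interior to a segment [c, e] of [0, 1] on which G has a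
    continuous nonvanishing derivative v. *)
Definition smooth_at (R : realType) (G : R -> R[i]) (t : R) : Prop :=
  exists (c e : R) (v : R -> R[i]),
    [/\ 0 <= c, c < t < e, e <= 1, ccont c e v &
        (forall u, c <= u <= e -> v u != 0) /\
        (forall u, c < u < e -> cderiv G u (v u))].

Lemma cderiv_velocity (R : realType) (G : R -> R[i]) t v :
  cderiv G t v -> velocity G t = v.
Proof.
by move=> [[_ gr] [_ gi]]; apply: complexP; rewrite /= derive1E.
Qed.

Section Curve.
Variables (R : realType) (G : R -> R[i]).
Hypothesis ps : piecewise_smooth G.
Notation mu := (@lebesgue_measure R).
Notation I01 := (`[0%R, 1%R]%classic : set (measurableTypeR R)).

Lemma curve_ccont : ccont 0 1 G. Proof. by case: ps. Qed.

(** The pieces of the curve, with the order of all the break points. *)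
Lemma curve_pieces : exists (k : nat) (tau : nat -> R),
  [/\ tau 0%N = 0, tau k = 1,
      forall i j, (i <= j)%N -> (j <= k)%N -> tau i <= tau j &
      forall i, (i < k)%N -> tau i < tau i.+1 /\ exists v,
        [/\ ccont (tau i) (tau i.+1) v,
            forall t, tau i <= t <= tau i.+1 -> v t != 0 &
            forall t, tau i < t < tau i.+1 -> cderiv G t (v t)]].
Proof.
have [_ [k [tau [t0 tk H]]]] := ps; exists k, tau; split => //.
move=> i j ij; elim: j ij => [|j IH]; first by rewrite leqn0 => /eqP ->.
rewrite leq_eqVlt => /orP[/eqP -> //|]; rewrite ltnS => ij jk.
rewrite (le_trans (IH ij (ltnW jk))) //; apply/ltW.
by have [] := H _ jk.
Qed.

(** All but finitely many parameters are smooth. *)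
Lemma curve_smooth_at : exists l : seq R,
  forall t, 0 <= t <= 1 -> t \notin l -> smooth_at G t.
Proof.
have [k [tau [t0 tk mon H]]] := curve_pieces.
exists (map tau (iota 0 k.+1)) => t /andP[t_ge0 t_le1] tl.
have tne i : (i <= k)%N -> t != tau i.
  move=> ik; apply: contra tl => /eqP ->; apply: map_f.
  by rewrite mem_iota /= add0n ltnS.
have [i [ik ti tiS]] : exists i, [/\ (i < k)%N, tau i < t & t < tau i.+1].
  have : t < tau k by rewrite tk lt_neqAle t_le1 andbT -tk tne.
  have : (k <= k)%N by [].
  elim: {1 3}k => [|j IH] jk.
    by rewrite t0 ltNge t_ge0.
  move=> tj; case: (ltP (tau j) t) => [jt|]; first by exists j.
  rewrite le_eqVlt (negPf (tne _ (ltnW jk))) /=.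
  by move=> /(IH (ltnW jk)).
have [lt [v [cv v0 dv]]] := H i ik.
exists (tau i), (tau i.+1), v; split => //; last first.
- by rewrite -tk mon.
- by rewrite ti.
- by rewrite -t0 mon // ltnW.
Qed.

Lemma bmfun_velocity : bmfun I01 (velocity G).
Proof.
have [k [tau [t0 tk mon H]]] := curve_pieces.
suff: forall i, (i <= k)%N ->
    bmfun (`[0, tau i] : set (measurableTypeR R)) (velocity G).
  by move=> /(_ k (leqnn k)); rewrite tk.
have bm1 x : bmfun ([set x] : set (measurableTypeR R)) (velocity G).
  split; [exact: measurable_fun_set1..|].
  by exists (cabs (velocity G x)) => _ ->.
elim=> [|i IH] ik; first by rewrite t0 set_itv1.
have [lt [v [cv _ dv]]] := H i ik.
apply: (@bmfunS _ _ _ ((`[0, tau i] `|` `]tau i, tau i.+1[) `|` [set tau i.+1])).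
- by apply: measurableU => //; exact: measurableU.
- move=> t /=; rewrite !in_itv /= => /andP[t_ge0]; rewrite le_eqVlt => /orP[/eqP ->|tt].
    by right.
  by left; case: (leP t (tau i)) => h; [left|right]; rewrite ?t_ge0.
apply: bmfunU; [exact: measurableU|by []| |exact: bm1].
apply: bmfunU => //; first exact: IH (ltnW ik).
apply: (eq_bmfun (f := v)).
  by move=> t /=; rewrite in_itv /= => /dv /cderiv_velocity.
apply: bmfunS (ccont_bmfun cv) => //; exact: subset_itv_oo_cc.
Qed.

Lemma bmfun_curve (f : R -> R[i]) : ccont 0 1 f ->
  bmfun I01 (fun t => f t * velocity G t).
Proof. by move=> cf; apply: bmfunM; [exact: ccont_bmfun|exact: bmfun_velocity]. Qed.

(** Line integral, along an initial arc of the curve, of a function with a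
    primitive. *)
Lemma curve_FTC_arc (phi Phi : R -> R[i]) (T : R) : 0 <= T <= 1 ->
  ccont 0 1 phi -> ccont 0 1 Phi ->
  (forall t w, 0 <= t <= 1 -> cderiv G t w -> cderiv Phi t (phi t * w)) ->
  cintegral mu `[0, T] (fun t => phi t * velocity G t) = Phi T - Phi 0.
Proof.
move=> T01 cphi cPhi dPhi; have bh := bmfun_curve cphi.
have [k [tau [t0 tk mon H]]] := curve_pieces.
suff: forall i, (i <= k)%N -> forall T, 0 <= T <= tau i ->
    cintegral mu `[0, T] (fun t => phi t * velocity G t) = Phi T - Phi 0.
  by move=> /(_ k (leqnn k) T); apply; rewrite tk.
clear T T01; elim=> [|i IH] ik T /andP[T0 Ti].
  have -> : T = 0 by apply/eqP; rewrite eq_le T0 andbT -t0.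
  rewrite subrr set_itv1 /cintegral.
  by apply: complexP; rewrite /= Rintegral_set1.
case: (leP T (tau i)) => [Tle|Tgt]; first by apply: IH; [exact: ltnW|rewrite T0].
have [lt [v [cv _ dv]]] := H i ik.
have i0 : 0 <= tau i by rewrite -t0 mon // ltnW.
have i1 : T <= 1 by rewrite (le_trans Ti) // -tk mon.
have sub (a b : R) : 0 <= a -> b <= 1 -> `[a, b] `<=` `[0, 1].
  move=> a0 b1 t /=; rewrite !in_itv /= => /andP[at_ tb].
  by rewrite (le_trans a0) // (le_trans tb).
have dvT t : tau i < t < T -> cderiv G t (v t).
  by move=> /andP[h1 h2]; apply: dv; rewrite h1 (lt_le_trans h2).
rewrite (cintegral_itv_split (b := tau i)); first last.
- apply: bmfunS bh => //; exact: sub.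
- by rewrite i0 ltW.
have cphiv : ccont (tau i) T (fun t => phi t * v t).
  apply: ccontM; first exact: ccontS cphi.
  exact: ccontS cv.
rewrite (IH (ltnW ik)); last by rewrite i0 lexx.
rewrite (eq_cintegral_oc (h := fun t => phi t * v t)).
- rewrite (cintegral_FTC Tgt (F := Phi)).
  + by rewrite addrC addrA subrK.
  + exact: ccontS cPhi.
  + exact: cphiv.
  + move=> t tt; apply: dPhi; last exact: dvT.
    by move: tt => /andP[/ltW h1 /ltW h2]; rewrite (le_trans i0) // (le_trans h2).
- apply: bmfunS bh => //; exact: sub.
- exact: ccont_bmfun.
- by move=> t /dvT /cderiv_velocity ->.
Qed.

Lemma curve_FTC (phi Phi : R -> R[i]) : ccont 0 1 phi -> ccont 0 1 Phi ->
  (forall t w, 0 <= t <= 1 -> cderiv G t w -> cderiv Phi t (phi t * w)) ->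
  cintegral mu `[0, 1] (fun t => phi t * velocity G t) = Phi 1 - Phi 0.
Proof. by apply: curve_FTC_arc; rewrite lexx ler01. Qed.

Lemma trace_dist (z : R[i]) : ~ trace G z ->
  exists2 e : R, 0 < e & forall t, 0 <= t <= 1 -> e <= cabs (G t - z).
Proof.
move=> zG.
have cG := ccontB curve_ccont (@ccont_cst R 0 1 z).
have [c c01 cm] := EVT_min (ler01 : (0 : R) <= 1) (ccontcabs cG).
exists (cabs (G c - z)).
  rewrite cabs_gt0 subr_eq0; apply/eqP => Gc; apply: zG.
  by exists c => //; rewrite /= c01.
by move=> t t01; apply: cm; rewrite in_itv.
Qed.

Lemma trace_in t : 0 <= t <= 1 -> trace G (G t).
Proof. by move=> t01; exists t => //=; rewrite in_itv. Qed.

Lemma curve_length_ge0 : 0 <= curve_length G.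
Proof. by apply: Rintegral_ge0 => t _; exact: cabs_ge0. Qed.

(** A chord is not longer than the curve, up to the constant of the crude
    triangle inequality. *)
Lemma curve_chord t u : 0 <= t <= 1 -> 0 <= u <= 1 ->
  cabs (G t - G u) <= 4 * curve_length G.
Proof.
suff chord0 r : 0 <= r <= 1 -> cabs (G r - G 0) <= 2 * curve_length G.
  move=> /chord0 ht /chord0 hu.
  have -> : G t - G u = (G t - G 0) - (G u - G 0) by ring.
  rewrite (le_trans (cabsB _ _)) //; lra.
move: r => {u}{}t t01; have [t0 t1] := andP t01.
have bv := bmfun_velocity; have fin := lebesgue_itvcc_fin (0 : R) t.
have sub : `[0, t] `<=` `[0, 1 : R].
  by move=> u /=; rewrite !in_itv /= => /andP[-> /le_trans]; apply.
have bvt : bmfun (`[0, t] : set (measurableTypeR R)) (velocity G).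
  exact: bmfunS bv.
have <- : cintegral mu `[0, t] (velocity G) = G t - G 0.
  rewrite -(curve_FTC_arc t01 (phi := fun=> 1) (Phi := G)).
  - by apply: eq_cintegral => u _; rewrite mul1r.
  - exact: ccont_cst.
  - exact: curve_ccont.
  - by move=> u w _; rewrite mul1r.
rewrite (le_trans (cabs_cintegral_le _ fin bvt)) // ler_pM2l //.
have fin1 := lebesgue_itvcc_fin (0 : R) 1.
have ic := @bmfun_intcabs _ _ _ mu _ (measurable_itv `[0, 1]) fin1 _ bv.
rewrite /curve_length /Rintegral fine_le //.
- apply: integrable_fin_num => //.
  exact: bmfun_intcabs bvt.
- exact: integrable_fin_num.
- apply: ge0_subset_integral => //.
    by case/integrableP: ic.
  by move=> x _; rewrite lee_fin cabs_ge0.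
Qed.

End Curve.

(** * Winding numbers *)

(** The winding number of G around z. *)
Definition winding (R : realType) (G : R -> R[i]) (z : R[i]) : R[i] :=
  cauchy_transform G (fun=> 1) z.

Section Winding.
Variables (R : realType) (G : R -> R[i]).
Hypotheses (ps : piecewise_smooth G) (closedG : G 0 = G 1).
Notation mu := (@lebesgue_measure R).
Notation I01 := (`[0%R, 1%R]%classic : set (measurableTypeR R)).
Notation cint f := (cintegral mu `[0%R, 1%R]%classic f).

Let mI : measurable I01. Proof. exact: measurable_itv. Qed.
Let fin : (mu I01 < +oo)%E. Proof. exact: lebesgue_itvcc_fin. Qed.

Lemma bmfun_curve_int (f : R -> R[i]) : bmfun I01 f ->
  bmfun I01 (fun t => f t * velocity G t).
Proof. by move=> bf; apply: bmfunM => //; exact: bmfun_velocity. Qed.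

Lemma curve_int_bound (f : R -> R[i]) (B : R) : bmfun I01 f ->
  (forall t, 0 <= t <= 1 -> cabs (f t) <= B) ->
  cabs (cint (fun t => f t * velocity G t)) <= 2 * (B * curve_length G).
Proof.
move=> bf fB; have bfv := bmfun_curve_int bf.
have icv := @bmfun_intcabs _ _ _ mu _ mI fin _ (bmfun_velocity ps).
rewrite (le_trans (cabs_cintegral_le mI fin bfv)) // ler_pM2l //.
rewrite /curve_length -RintegralZl // le_Rintegral //.
- exact: (@bmfun_intcabs _ _ _ mu _ mI fin _ bfv).
- by have := integrableZl mI B icv; apply: eq_integrable.
- move=> t /=; rewrite in_itv /= => t01.
  by rewrite cabsM ler_wpM2r ?cabs_ge0 // fB.
Qed.

Lemma curve_sub_ccont z : ccont 0 1 (fun t => G t - z).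
Proof. exact: ccontB (curve_ccont ps) (@ccont_cst R 0 1 z). Qed.

Lemma curve_inv_ccont z : ~ trace G z -> ccont 0 1 (fun t => (G t - z)^-1).
Proof.
move=> zG; apply: ccontV; last exact: curve_sub_ccont.
move=> t t01; apply/eqP => /eqP; rewrite subr_eq0 => /eqP Gt.
by apply: zG; rewrite -Gt; exact: trace_in.
Qed.

Lemma curve_int_inv2 z : ~ trace G z ->
  cint (fun t => (G t - z)^-1 ^+ 2 * velocity G t) = 0.
Proof.
move=> zG; have ci := curve_inv_ccont zG.
rewrite (curve_FTC ps (Phi := fun t => - (G t - z)^-1)).
- by rewrite closedG subrr.
- exact: ccontX ci.
- exact: ccontN ci.
- move=> t w t01 Gw.
  have Gz0 : G t - z != 0.
    by apply/eqP => /eqP; rewrite subr_eq0 => /eqP Gt; apply: zG; rewrite -Gt; exact: trace_in.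
  have d1 : cderiv (fun t => G t - z) t w.
    by have := cderivD Gw (cderiv_cst (- z) t); rewrite addr0.
  have := cderivM (cderiv_cst (-1) t) (cderivV Gz0 d1).
  have -> : (fun u => -1 * (G u - z)^-1) = (fun u => - (G u - z)^-1).
    by apply/funext => u; rewrite mulN1r.
  by congr cderiv; rewrite mul0r add0r mulN1r mulNr opprK exprVn mulrC.
Qed.

Lemma curve_int_pow n : cint (fun t => G t ^+ n * velocity G t) = 0.
Proof.
have cG := curve_ccont ps.
rewrite (curve_FTC ps (Phi := fun t => n.+1%:R^-1 * G t ^+ n.+1)).
- by rewrite closedG subrr.
- exact: ccontX cG.
- by apply: ccontM; [exact: ccont_cst|exact: ccontX cG].
- move=> t w _ Gw.
  have := cderivM (cderiv_cst n.+1%:R^-1 t) (cderivX n Gw); congr cderiv.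
  by rewrite mul0r add0r !mulrA mulVf ?mul1r // pnatr_eq0.
Qed.

Lemma windingE z :
  winding G z = (twopii R)^-1 * cint (fun t => (G t - z)^-1 * velocity G t).
Proof.
by congr (_ * _); apply: eq_cintegral => t _; rewrite mul1r.
Qed.

Let twopi_le (x : R) : 0 <= x -> (cabs (twopii R))^-1 * x <= x.
Proof.
move=> x0; rewrite cabs_twopii ler_piMl // invf_le1 ?mulr_gt0 ?pi_gt0 //.
by have := pi_ge2 R; lra.
Qed.

Lemma winding_bound z (e : R) : 0 < e ->
  (forall t, 0 <= t <= 1 -> e <= cabs (G t - z)) ->
  cabs (winding G z) <= 2 * (e^-1 * curve_length G).
Proof.
move=> e0 ez; have L0 := curve_length_ge0 G.
rewrite windingE cabsM cabsV (le_trans (twopi_le (cabs_ge0 _))) //.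
have zG : ~ trace G z.
  move=> [t /=]; rewrite in_itv /= => /ez + Gt.
  by rewrite Gt subrr cabs0 leNgt e0.
apply: curve_int_bound => [|t /ez h].
  exact: ccont_bmfun (curve_inv_ccont zG).
by rewrite cabsV lef_pV2 // posrE // (lt_le_trans e0).
Qed.

(** The increments of the winding number are of the second order, since its
    derivative is the integral of a function with a primitive. *)
Lemma winding_incr z w (e : R) : 0 < e ->
  (forall t, 0 <= t <= 1 -> e <= cabs (G t - z)) ->
  (forall t, 0 <= t <= 1 -> e <= cabs (G t - w)) ->
  cabs (winding G z - winding G w) <=
    2 * (e ^- 3 * curve_length G) * cabs (z - w) ^+ 2.
Proof.
move=> e0 ez ew; have L0 := curve_length_ge0 G.
have off x : (forall t, 0 <= t <= 1 -> e <= cabs (G t - x)) -> ~ trace G x.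
  move=> ex [t /=]; rewrite in_itv /= => /ex + Gt.
  by rewrite Gt subrr cabs0 leNgt e0.
have zG := off _ ez; have wG := off _ ew.
have bz := ccont_bmfun (curve_inv_ccont zG).
have bw := ccont_bmfun (curve_inv_ccont wG).
have n0 x t : (forall t, 0 <= t <= 1 -> e <= cabs (G t - x)) ->
    0 <= t <= 1 -> G t - x != 0.
  by move=> ex /ex h; rewrite -cabs_gt0 (lt_le_trans e0).
pose f t := (w - z) ^+ 2 * - ((G t - w)^-1 * (G t - z)^-1 ^+ 2).
have bz2 := bmfunX 2 bz.
have bf : bmfun I01 f by apply: bmfunZ; apply: bmfunN; exact: bmfunM bw bz2.
have E : winding G z - winding G w =
    (twopii R)^-1 * cint (fun t => f t * velocity G t).
  rewrite !windingE -mulrBr; congr (_ * _).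
  rewrite -cintegralB //; [|exact: bmfun_curve_int..].
  have -> : cint (fun t => f t * velocity G t) =
    cint (fun t => f t * velocity G t) +
    (z - w) * cint (fun t => (G t - z)^-1 ^+ 2 * velocity G t).
    by rewrite curve_int_inv2 // mulr0 addr0.
  rewrite -cintegralZ //; last exact: bmfun_curve_int bz2.
  rewrite -cintegralD //.
  - apply: eq_cintegral => t /=; rewrite in_itv /= => t01.
    rewrite /f; have := n0 _ _ ez t01; have := n0 _ _ ew t01.
    by move=> h1 h2; field; rewrite h1 h2.
  - exact: bmfun_curve_int bf.
  - exact/bmfunZ/bmfun_curve_int.
rewrite E cabsM cabsV (le_trans (twopi_le (cabs_ge0 _))) //.
have -> : 2 * (e ^- 3 * curve_length G) * cabs (z - w) ^+ 2 =
    2 * (cabs (z - w) ^+ 2 * (e^-1 * e^-1 ^+ 2) * curve_length G).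
  by field; rewrite gt_eqF.
apply: curve_int_bound => // t t01.
rewrite /f cabsM cabsX cabsN cabsM cabsX !cabsV (cabsBC w).
rewrite ler_wpM2l ?sqr_ge0 //.
have inv_le x : e <= x -> 0 <= x^-1 <= e^-1.
  by move=> ex; rewrite invr_ge0 (le_trans (ltW e0) ex) lef_pV2 // posrE // (lt_le_trans e0).
have /andP[h1 h2] := inv_le _ (ez t t01).
have /andP[h3 h4] := inv_le _ (ew t t01).
by rewrite ler_pM ?sqr_ge0 // lerXn2r // nnegrE // (le_trans h1).
Qed.

Lemma dist_ball z w (e : R) : (forall t, 0 <= t <= 1 -> e <= cabs (G t - z)) ->
  cabs (w - z) <= e / 2 -> forall t, 0 <= t <= 1 -> e / 2 <= cabs (G t - w).
Proof.
move=> ez wz t /ez h.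
have -> : G t - w = (G t - z) - (w - z) by ring.
have := cabsBB (G t - z) (w - z); lra.
Qed.

(** The segment from z to w is cut into N + 1 equal parts; each contributes an
    increment of order N^-2. *)
Lemma winding_locally_constant z w (e : R) : 0 < e ->
  (forall t, 0 <= t <= 1 -> e <= cabs (G t - z)) ->
  cabs (w - z) <= e / 2 -> winding G w = winding G z.
Proof.
move=> e0 ez wz; have e20 : 0 < e / 2 by rewrite divr_gt0.
have L0 := curve_length_ge0 G.
set K := 2 * ((e / 2) ^- 3 * curve_length G) * cabs (w - z) ^+ 2.
have K0 : 0 <= K.
  apply: mulr_ge0; last exact: sqr_ge0.
  apply: mulr_ge0 => //; apply: mulr_ge0 => //.
  by rewrite invr_ge0 exprn_ge0 // ltW.
pose pt (N k : nat) : R[i] := z + creal (k%:R / N.+1%:R) * (w - z).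
have near N k : (k <= N.+1)%N -> cabs (pt N k - z) <= e / 2.
  move=> kN; rewrite /pt addrC addKr cabsM cabs_creal.
  rewrite (le_trans _ wz) // ler_piMl ?cabs_ge0 //.
  rewrite ger0_norm ?divr_ge0 // ler_pdivrMr ?ltr0n // mul1r ler_nat //.
have step N k : (k <= N.+1)%N ->
    cabs (winding G (pt N k) - winding G z) <= k%:R * (K / N.+1%:R ^+ 2).
  elim: k => [|k IH] kN.
    have -> : pt N 0 = z by rewrite /pt mul0r mul0r addr0.
    by rewrite subrr cabs0 mul0r.
  have -> : winding G (pt N k.+1) - winding G z =
    (winding G (pt N k.+1) - winding G (pt N k)) + (winding G (pt N k) - winding G z).
    by rewrite addrA subrK.
  rewrite (le_trans (cabsD _ _)) // -natr1 mulrDl mul1r addrC lerD ?IH ?(ltnW kN) //.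
  rewrite (le_trans (winding_incr e20 (dist_ball ez (near _ _ kN))
    (dist_ball ez (near _ _ (ltnW kN))))) //.
  have -> : pt N k.+1 - pt N k = creal (N.+1%:R^-1) * (w - z).
    rewrite /pt opprD addrACA subrr add0r -mulrBl -crealB -mulrBl; congr (creal _ * _).
    by rewrite -natr1 addrC addKr mul1r.
  rewrite cabsM cabs_creal [(_ * cabs _) ^+ 2]exprMn [`|_|]ger0_norm ?invr_ge0 // /K.
  by rewrite exprVn [X in _ * X <= _]mulrC !mulrA.
apply/eqP; rewrite -subr_eq0 -cabs_eq0 eq_le cabs_ge0 andbT.
rewrite leNgt; apply/negP => D0; set D := cabs _ in D0.
have [N KN] : exists N : nat, K / D < N.+1%:R.
  by exists (Num.truncn (K / D)); exact: truncnS_gt.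
have := step N N.+1 (leqnn _).
have -> : pt N N.+1 = w.
  by rewrite /pt divff ?pnatr_eq0 // mul1r addrCA subrr addr0.
have NN : N.+1%:R != 0 :> R by rewrite pnatr_eq0.
have -> : N.+1%:R * (K / N.+1%:R ^+ 2) = K / N.+1%:R.
  by rewrite expr2 invfM mulrCA [N.+1%:R * _]mulrA divff // mul1r.
rewrite -/D => DK; move: KN; rewrite ltr_pdivrMr // mulrC -ltr_pdivrMr ?ltr0Sn // => KD.
by move: DK; rewrite leNgt KD.
Qed.

(** The winding number vanishes on the exterior: it is constant on the connected
    component of z, which contains points far away, where it is small. *)
Lemma winding_outside z : outside G z -> winding G z = 0.
Proof.
move=> [zG unb]; set Cz := connected_component (~` trace G) z in unb.
have CzG : Cz `<=` ~` trace G by exact: connected_component_sub.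
have zCz : Cz z by exact: connected_component_refl.
have same (P : R[i] -> Prop) :
    open [set w : R[i]^o | ~ trace G w /\ P (winding G w)].
  rewrite openE => w /= [wG Pw]; have [e e0 ew] := trace_dist ps wG.
  apply/nbhs_cabsP; exists (e / 2); first by rewrite divr_gt0.
  move=> u /ltW uw; split.
    move=> [t /=]; rewrite in_itv /= => /(dist_ball ew uw) + Gt.
    by rewrite Gt subrr cabs0 leNgt divr_gt0.
  by rewrite (winding_locally_constant e0 ew uw).
(* a nonempty subset of the component that is both open and closed *)
have constW : [set w | Cz w /\ winding G w = winding G z] = Cz.
  apply: (@component_connected _ (~` trace G) z).
  - by exists z.
  - exists [set w : R[i]^o | ~ trace G w /\ winding G w = winding G z].
      exact: (same (fun x => x = winding G z)).
    by apply/seteqP; split => w /= [Cw]; [move=> ?; split => //; split => //; exact: CzG|move=> []].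
  - exists (~` [set w : R[i]^o | ~ trace G w /\ winding G w <> winding G z]).
      apply: open_closedC; exact: (same (fun x => x <> winding G z)).
    apply/seteqP; split => w /= [Cw h]; split => //.
      by move=> [].
    by apply: contrapT => h'; apply: h; split => //; exact: CzG.
have [M GM] := ccont_bounded (curve_ccont ps).
apply/eqP; rewrite -cabs_eq0 eq_le cabs_ge0 andbT.
apply/ler_addgt0Pr => e e0; rewrite add0r.
have L0 := curve_length_ge0 G.
pose r := 1 + 2 * curve_length G / e.
have r0 : 0 < r.
  by rewrite ltr_pwDl // divr_ge0 ?mulr_ge0 // ltW.
have [w [Cw wM]] : exists w, Cz w /\ M + r < cabs w.
  apply: contrapT => h; apply: unb; exists (M + r) => w Cw.
  by rewrite leNgt; apply/negP => wM; apply: h; exists w.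
have <- : winding G w = winding G z.
  by move: Cw; rewrite -constW => -[].
have wr t : 0 <= t <= 1 -> r <= cabs (G t - w).
  by move=> /GM h; have := cabsBB w (G t); rewrite cabsBC; lra.
rewrite (le_trans (winding_bound r0 wr)) //.
rewrite mulrCA ler_pdivrMl // /r [_ * e]mulrDl mul1r.
by rewrite divfK ?gt_eqF // lerDr ltW.
Qed.

End Winding.

(** * The exterior at a smooth point of the curve *)

(** The imaginary unit. *)
Definition iunit (R : realType) : R[i] := Complex 0 1.

Lemma sqr_iunit (R : realType) : iunit R ^+ 2 = - 1.
Proof. exact: (@sqr_i R). Qed.

Lemma cderiv_approx (R : realType) (f : R -> R[i]) t v (e : R) :
  cderiv f t v -> 0 < e -> exists2 d : R, 0 < d &
    forall u, `|u| < d -> cabs (f (t + u) - f t - creal u * v) <= e * `|u|.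
Proof.
move=> [fr fi] e0.
have real_approx (F : R -> R) x : is_derive t 1 F x ->
    exists2 d : R, 0 < d &
    forall u, `|u| < d -> `|F (t + u) - F t - u * x| <= e / 2 * `|u|.
  move=> [Fd Fx].
  have e20 : 0 < e / 2 by rewrite divr_gt0.
  have : (fun h : R => h^-1 *: ((F \o shift t) (h *: 1) - F t)) @ 0^' --> x.
    by rewrite -Fx; exact: Fd.
  move=> /cvgrPdist_le/(_ _ e20); rewrite near_withinE -nbhs_ballE => -[d /= d0 dF].
  exists d => // u ud; have [->|u0] := eqVneq u 0.
    by rewrite addr0 subrr mul0r subrr normr0 mulr0.
  have := dF u; rewrite -ball_normE /= sub0r normrN => /(_ ud u0).
  rewrite -(ler_pM2r (_ : 0 < `|u|)) ?normr_gt0 // -normrM => h.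
  rewrite (le_trans _ h) // -normrN /GRing.scale /= mulr1 (addrC u t).
  by rewrite le_eqVlt; apply/orP; left; apply/eqP; congr (`|_|); field.
have [d1 d10 h1] := real_approx _ _ fr; have [d2 d20 h2] := real_approx _ _ fi.
exists (Num.min d1 d2); first by rewrite lt_min d10.
move=> u; rewrite lt_min => /andP[/h1 k1 /h2 k2].
rewrite (le_trans (cabs_le _)) // !ReD !ImD !ReN !ImN ReM ImM /= !mul0r subr0 addr0.
by rewrite [e * _](_ : _ = e / 2 * `|u| + e / 2 * `|u|) ?lerD //; field.
Qed.

(** The difference of the Cauchy kernels with poles s + i eps v0 and
    s - i eps v0, on a nearly straight arc: a and b are the positions, relative
    to the two poles, of a point close to s + u v0, and vel is a velocity close
    to v0. On a straight arc the imaginary part is 2 eps / (u^2 + eps^2). *)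
Lemma kernel_jump (R : realType) (u eps : R) (v0 vel a b : R[i]) :
  0 < eps -> v0 != 0 ->
  cabs (a - creal u * v0 + iunit R * creal eps * v0) <= 16^-1 * cabs v0 * `|u| ->
  b = a + 2 * iunit R * creal eps * v0 ->
  cabs (vel - v0) <= 16^-1 * cabs v0 ->
  eps / (u ^+ 2 + eps ^+ 2) <= complex.Im ((a^-1 - b^-1) * vel).
Proof.
move=> eps0 v00 ha bE hvel.
have v0p : 0 < cabs v0 by rewrite cabs_gt0.
pose D := u ^+ 2 + eps ^+ 2.
have D0 : 0 < D by rewrite ltr_wpDl ?sqr_ge0 // exprn_gt0.
pose e1 := (a - creal u * v0 + iunit R * creal eps * v0) / v0.
pose e2 := (vel - v0) / v0.
have he1 : cabs e1 <= 16^-1 * `|u|.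
  by rewrite /e1 cabsM cabsV ler_pdivrMr // [leRHS]mulrAC.
have he2 : cabs e2 <= 16^-1.
  by rewrite /e2 cabsM cabsV ler_pdivrMr.
have velE : vel = v0 * (1 + e2) by rewrite /e2; field.
have aE : a = v0 * (creal u + e1 - iunit R * creal eps) by rewrite /e1; field.
have bE' : b = v0 * (creal u + e1 + iunit R * creal eps).
  by rewrite bE aE; ring.
pose p := 2 * creal u * e1 + e1 ^+ 2.
pose P := creal D + p.
have abE : a * b = v0 ^+ 2 * P.
  rewrite aE bE' /P /p /D crealD !expr2 !crealM.
  have := sqr_iunit R; rewrite expr2 => ii.
  rewrite [RHS](_ : _ = v0 * v0 * ((creal u + e1) * (creal u + e1) - (- 1) * creal eps * creal eps)); last by ring.
  by rewrite -ii; ring.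
have hp : cabs p <= 3 / 16 * D.
  have u2 : `|u| ^+ 2 <= D.
    by rewrite real_normK ?num_real // /D lerDl sqr_ge0.
  rewrite /p (le_trans (cabsD _ _)) // cabsX 2!cabsM cabs_creal.
  have -> : cabs (2 : R[i]) = 2.
    have -> : (2 : R[i]) = creal 2 by rewrite (creal_nat R 2).
    by rewrite cabs_creal normr_nat.
  have c0 := cabs_ge0 e1; have un0 := normr_ge0 u.
  move: he1 u2 c0 un0; move: (cabs e1) `|u| => x y.
  move=> hx hy x0 y0.
  have xy : x * y <= 16^-1 * y * y by rewrite ler_wpM2r.
  have xx : x * x <= x * (16^-1 * y) by rewrite ler_wpM2l.
  by rewrite !expr2 in hy *; lra.
have hP : 13 / 16 * D <= cabs P.
  have := cabsBB (creal D) (- p); rewrite opprK cabsN cabs_creal gtr0_norm //.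
  by rewrite /P; lra.
have Pp : 0 < cabs P by rewrite (lt_le_trans _ hP) // mulr_gt0.
have P0 : P != 0 by rewrite -cabs_gt0.
have Dc0 : creal D != 0 by rewrite creal_eq0 gt_eqF.
pose q := (1 + e2) / P.
have hq : cabs (q * creal D - 1) <= 2^-1.
  have -> : q * creal D - 1 = (e2 * creal D - p) / P.
    by rewrite /q /P; field.
  rewrite cabsM cabsV ler_pdivrMr //.
  rewrite (le_trans (cabsB _ _)) // cabsM cabs_creal gtr0_norm //.
  have : cabs e2 * D <= 16^-1 * D by rewrite ler_pM2r.
  by move: hp hP; lra.
have hRq : 2^-1 / D <= complex.Re q.
  have := Re_ge (q * creal D); rewrite ReM /= mulr0 subr0.
  by rewrite ler_pdivrMr //; move: hq; lra.
have ab0 : (a != 0) /\ (b != 0).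
  have : a * b != 0 by rewrite abE mulf_neq0 // expf_neq0.
  by rewrite mulf_eq0 negb_or => /andP[].
have [a0 b0] := ab0.
have -> : (a^-1 - b^-1) * vel = iunit R * creal (2 * eps) * q.
  have -> : (a^-1 - b^-1) * vel = (b - a) * vel / (a * b).
    by field; rewrite a0 b0.
  rewrite abE bE velE /q addrC addKr crealM.
  have -> : creal 2 = 2 :> R[i] by rewrite (creal_nat R 2).
  by field; rewrite v00 P0.
rewrite -mulrA ImM /= mul0r add0r mul1r ReM /= mul0r subr0.
move: hRq; rewrite ler_pdivrMr // => hRq; rewrite -/D ler_pdivrMr //.
by move: hRq; move: (complex.Re q) => x; nra.
Qed.

Lemma lebesgue_itv_centered (R : realType) (x r : R) : 0 < r ->
  fine (lebesgue_measure `[x - r, x + r]) = 2 * r.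
Proof.
move=> r0; rewrite lebesgue_measure_itv /= lte_fin ifT /=; first by ring.
by lra.
Qed.

Section Jump.
Variables (R : realType) (G : R -> R[i]).
Hypotheses (ps : piecewise_smooth G) (sc : simple_closed G).
Hypothesis ccw : counterclockwise G.
Notation mu := (@lebesgue_measure R).
Notation I01 := (`[0%R, 1%R]%classic : set (measurableTypeR R)).

(** The curve only passes through the point of parameter t0 at time t0. *)
Lemma curve_away (t0 x y : R) : 0 < t0 < 1 -> 0 <= x -> y <= 1 ->
  (forall t, x <= t <= y -> t != t0) ->
  exists2 r : R, 0 < r & forall t, x <= t <= y -> r <= cabs (G t - G t0).
Proof.
move=> /andP[t00 t01] x0 y1 ne; have [G01 Ginj] := sc.
case: (leP x y) => xy; last first.
  by exists 1 => // t /andP[/le_trans h /h]; rewrite leNgt xy.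
have cG : ccont x y (fun t => G t - G t0).
  apply: (ccontS x0 y1).
  exact: ccontB (curve_ccont ps) (@ccont_cst R 0 1 (G t0)).
have [c cxy cm] := EVT_min xy (ccontcabs cG).
exists (cabs (G c - G t0)) => [|t txy]; last by apply: cm; rewrite in_itv.
rewrite cabs_gt0 subr_eq0; apply/eqP => Gc.
move: cxy; rewrite in_itv /= => cxy; have /negP := ne c cxy; apply; apply/eqP.
have /andP[xc cy] := cxy; have c0 := le_trans x0 xc; have c1 := le_trans cy y1.
have t0in : t0 \in `[0, 1[ by rewrite in_itv /= ltW.
have [cE|c_ne] := eqVneq c 1.
  have : 0 = t0.
    by apply: Ginj; [rewrite in_itv /= lexx ltr01|by []|rewrite G01 -cE].
  by move=> E; move: t00; rewrite -E ltxx.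
by apply: Ginj => //; rewrite in_itv /= c0 lt_neqAle c_ne.
Qed.

(** A smooth point is approached non-tangentially by points of the exterior. On
    the normal at this point, the winding number at s + i eps v0 is larger than
    at s - i eps v0; both are 0 or 1, so the second one is 0 and the point
    s - i eps v0 is exterior. *)
Lemma exterior_approach (t0 r : R) : smooth_at G t0 -> 0 < r ->
  exists z : R[i], [/\ outside G z, cabs (z - G t0) < r &
    forall t, 0 <= t <= 1 -> cabs (z - G t0) <= 2 * cabs (z - G t)].
Proof.
move=> [c [e [v [c0 ct0e e1 cv [v_neq0 dv]]]]] r0.
have /andP[ct0 t0e] := ct0e.
have t00 : 0 < t0 by exact: le_lt_trans c0 ct0.
have t01 : t0 < 1 by exact: lt_le_trans t0e e1.
set v0 := v t0; have v00 : v0 != 0 by apply: v_neq0; rewrite !ltW.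
have v0p : 0 < cabs v0 by rewrite cabs_gt0.
have eta0 : 0 < 16^-1 * cabs v0 by rewrite mulr_gt0.
have [d1 d10 hd1] := cderiv_approx (dv _ ct0e) eta0.
have [d2 d20 hd2] : exists2 d : R, 0 < d & forall u, `|u| < d ->
    c < t0 + u < e /\ cabs (v (t0 + u) - v0) <= 16^-1 * cabs v0.
  have : (fun t => v t : R[i]^o) @ nbhs t0 --> (v0 : R[i]^o).
    have cvo : {in `]c, e[, continuous (v : R -> R[i]^o)}.
      have [] : [/\ {in `]c, e[, continuous (v : R -> R[i]^o)},
        (v : R -> R[i]^o) @ c^'+ --> (v c : R[i]^o) &
        (v : R -> R[i]^o) @ e^'- --> (v e : R[i]^o)] => //.
      by apply/continuous_within_itvP; [exact: lt_trans t0e|exact: cv].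
    by apply: cvo; rewrite in_itv /= ct0.
  move=> /cvg_cabsP/(_ _ eta0) h1.
  have h2 : \forall t \near t0, t \in `]c, e[.
    by apply: near_in_itvoo; rewrite in_itv /= ct0.
  have : \forall t \near t0, ((c < t < e) /\ (cabs (v t - v0) < 16^-1 * cabs v0)).
    by near=> t; split; near: t.
  move=> /nbhs_ballP[d /= d0 dB]; exists d => // u ud.
  have [] := dB (t0 + u).
    by rewrite -ball_normE /= opprD addrA subrr add0r normrN.
  by move=> ? /ltW.
(* the arc |t - t0| < d is nearly straight *)
pose d := Num.min d1 d2.
have d0 : 0 < d by rewrite lt_min d10.
have hd u : `|u| < d -> [/\ 0 <= t0 + u <= 1, velocity G (t0 + u) = v (t0 + u),
    cabs (G (t0 + u) - G t0 - creal u * v0) <= 16^-1 * cabs v0 * `|u| &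
    cabs (v (t0 + u) - v0) <= 16^-1 * cabs v0].
  rewrite lt_min => /andP[/hd1 h1 /hd2[/andP[h2 h3] h4]]; split => //.
    by rewrite (le_trans c0 (ltW h2)) (le_trans (ltW h3)).
  by apply: cderiv_velocity; apply: dv; rewrite h2.
have t0in : 0 < t0 < 1 by rewrite t00.
have [r1 r10 hr1] : exists2 r : R, 0 < r &
    forall t, 0 <= t <= t0 - d -> r <= cabs (G t - G t0).
  apply: curve_away => //; first by lra.
  move=> t /andP[_ h]; apply/eqP => E; move: h; rewrite E; lra.
have [r2 r20 hr2] : exists2 r : R, 0 < r &
    forall t, t0 + d <= t <= 1 -> r <= cabs (G t - G t0).
  apply: curve_away => //; first by lra.
  move=> t /andP[h _]; apply/eqP => E; move: h; rewrite E; lra.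
pose rho := Num.min r1 r2.
have rho0 : 0 < rho by rewrite lt_min r10.
have far t : 0 <= t <= 1 -> d <= `|t - t0| -> rho <= cabs (G t - G t0).
  move=> /andP[h0 h1]; rewrite ler_normr => /orP[h|h].
    by rewrite (le_trans _ (hr2 t _)) ?ge_min ?lexx ?orbT //; lra.
  by rewrite (le_trans _ (hr1 t _)) ?ge_min ?lexx //; lra.
have bvel := bmfun_velocity ps; have [_ _ [M velM]] := bvel.
have M0 : 0 <= M.
  by apply: (le_trans (cabs_ge0 _) (velM 0 _)); rewrite /= in_itv /= lexx ler01.
(* eps * B bounds the contribution of the rest of the curve *)
pose B := 8 * cabs v0 * M / rho ^+ 2.
have B0 : 0 <= B by rewrite divr_ge0 ?sqr_ge0 // !mulr_ge0 // ltW.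
have [eps [eps0 epsd epsr [epsrho epsB] epst0]] : exists eps : R,
    [/\ 0 < eps, eps <= d / 2, eps * cabs v0 < r, eps * cabs v0 <= rho / 2 /\ eps * B < 1
     & eps <= t0 /\ eps <= 1 - t0].
  pose x := Num.min (Num.min (d / 2) (r / 2 / cabs v0))
      (Num.min (Num.min (rho / 2 / cabs v0) (2^-1 / (B + 1))) (Num.min t0 (1 - t0))).
  have B1 : 0 < B + 1 by lra.
  have x0 : 0 < x.
    by rewrite !lt_min !divr_gt0 //= ?invr_gt0 // t00 subr_gt0.
  have : x <= x by [].
  rewrite {2}/x !le_min => /andP[/andP[h1 h2] /andP[/andP[h3 h4] /andP[h5 h6]]].
  move: h2 h3 h4; rewrite !ler_pdivlMr // => h2 h3 h4.
  exists x; split => //; first by lra.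
  by move: h4; rewrite mulrDr mulr1; lra.
have eps_d : eps < d by lra.
pose s := G t0; pose w := iunit R * creal eps * v0.
have cw : cabs w = eps * cabs v0.
  rewrite /w cabsM cabsM cabs_creal gtr0_norm // cabsE /= expr0n expr1n add0r sqrtr1.
  by rewrite mul1r.
have near_dist sg t : (sg = 1 \/ sg = -1 :> R[i]) -> 0 <= t <= 1 ->
    eps * cabs v0 / 2 <= cabs (G t - (s + sg * w)) /\
    (d <= `|t - t0| -> rho / 2 <= cabs (G t - (s + sg * w))).
  move=> hsg t_in.
  have csg : cabs sg = 1 by case: hsg => ->; rewrite ?cabsN cabs1.
  have far2 : d <= `|t - t0| -> rho / 2 <= cabs (G t - (s + sg * w)).
    move=> /(far t t_in) h.
    have -> : G t - (s + sg * w) = (G t - s) - sg * w by ring.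
    have := cabsBB (G t - s) (sg * w); rewrite cabsM csg mul1r cw.
    by move: h epsrho; rewrite -/s; lra.
  split => //; case: (ltP `|t - t0| d) => [td|/far2 h]; last first.
    by rewrite (le_trans _ h) //; move: epsrho cw; have := cabs_ge0 w; lra.
  have tE : t0 + (t - t0) = t by ring.
  have [_ _ h _] := hd _ td; rewrite tE -/s in h.
  set u := t - t0 in h *.
  have -> : G t - (s + sg * w) =
      (G t - s - creal u * v0) + (creal u * v0 - sg * w) by ring.
  have key : cabs (creal u * v0 - sg * w) = Num.sqrt (u ^+ 2 + eps ^+ 2) * cabs v0.
    have -> : creal u * v0 - sg * w = (creal u - sg * iunit R * creal eps) * v0.
      by rewrite /w; ring.
    rewrite cabsM cabsE !ReD !ImD !ReN !ImN !ReM !ImM /=.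
    by case: hsg => ->; rewrite /=; congr (Num.sqrt _ * _); ring.
  have sq1 : `|u| <= Num.sqrt (u ^+ 2 + eps ^+ 2).
    by rewrite -sqrtr_sqr ler_wsqrtr // lerDl sqr_ge0.
  have sq2 : eps <= Num.sqrt (u ^+ 2 + eps ^+ 2).
    by rewrite -{1}(ger0_norm (ltW eps0)) -sqrtr_sqr ler_wsqrtr // lerDr sqr_ge0.
  have := cabsBB (creal u * v0 - sg * w) (- (G t - s - creal u * v0)).
  rewrite opprK cabsN key (addrC (creal u * v0 - sg * w)) => h3.
  rewrite (le_trans _ h3) //.
  move: h sq1 sq2 v0p eps0; set S := Num.sqrt _; move=> h4 h5 h6 h7 h8.
  have h9 : 16^-1 * cabs v0 * `|u| <= 16^-1 * cabs v0 * S by rewrite ler_wpM2l // ltW.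
  have h10 : eps * cabs v0 <= S * cabs v0 by rewrite ler_wpM2r // ltW.
  have h11 : 0 < eps * cabs v0 by rewrite mulr_gt0.
  by lra.
pose zp := s + 1 * w; pose zm := s + (-1) * w.
have cwp : 0 < eps * cabs v0 by rewrite mulr_gt0.
have off sg : (sg = 1 \/ sg = -1 :> R[i]) -> ~ trace G (s + sg * w).
  move=> hsg [t /=]; rewrite in_itv /= => t_in Gt.
  have [+ _] := near_dist sg t hsg t_in.
  by rewrite Gt subrr cabs0 leNgt divr_gt0.
have zpG := off 1 (or_introl erefl); have zmG := off (-1) (or_intror erefl).
have czm : cabs (zm - G t0) = eps * cabs v0.
  by rewrite /zm -/s addrC addKr mulN1r cabsN cw.
exists zm; split; last 2 first.
- by rewrite czm.
- move=> t t_in; rewrite czm (cabsBC zm).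
  have [h _] := near_dist (-1) t (or_intror erefl) t_in.
  by rewrite -/zm in h; lra.
split => // bd.
have wm : winding G zm = 1 by apply: ccw.
have wp : winding G zp = 1 \/ winding G zp = 0.
  have [h|h] := pselect (cbounded (connected_component (~` trace G) zp)).
    by left; apply: ccw.
  by right; apply: (winding_outside ps (proj1 sc)).
have [bp bm] : bmfun I01 (fun t => (G t - zp)^-1) /\ bmfun I01 (fun t => (G t - zm)^-1).
  by split; apply: ccont_bmfun; exact: curve_inv_ccont.
have mI : measurable I01 by exact: measurable_itv.
have fin : (mu I01 < +oo)%E by exact: lebesgue_itvcc_fin.
pose h t := ((G t - zp)^-1 - (G t - zm)^-1) * velocity G t.
have bh : bmfun I01 h by apply: bmfunM => //; exact: bmfunB bp bm.
have WE : winding G zp - winding G zm = (twopii R)^-1 * cintegral mu `[0, 1] h.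
  rewrite !windingE -mulrBr; congr (_ * _).
  rewrite -(cintegralB mI fin (bmfun_curve_int ps bp) (bmfun_curve_int ps bm)).
  by apply: eq_cintegral => t _; rewrite /h mulrBl.
(* the imaginary part of h is at least 1 / (2 eps) for |t - t0| <= eps, nonnegative on the
   arc, and at least - eps * B elsewhere *)
have pos : 0 < complex.Im (cintegral mu `[0, 1] h).
  rewrite /=.
  pose P : set (measurableTypeR R) := `[t0 - eps, t0 + eps]%classic.
  pose g0 : measurableTypeR R -> R := fun=> (2 * eps)^-1.
  pose f1 := fun t : measurableTypeR R => (g0 \_ P) t - eps * B.
  have Psub : P `<=` I01.
    move=> t /=; rewrite /P /= !in_itv /= => /andP[h1 h2].
    have [k1 k2] := epst0; rewrite (le_trans _ h1) ?subr_ge0 //=.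
    by rewrite (le_trans h2) // -lerBrDl.
  have mP : measurable P by exact: measurable_itv.
  have IPE : I01 `&` P = P by apply/setIidPr.
  have icst (x : R) : mu.-integrable I01 (EFin \o (fun=> x)).
    apply: (@bounded_integrable _ _ _ mu I01 mI fin _ `|x|) => //.
  have iP : mu.-integrable I01 (EFin \o (g0 \_ P)).
    rewrite -restrict_EFin; apply/integrable_restrict => //.
    by rewrite IPE; apply: integrableS (icst _).
  have f1int : \int[mu]_(t in I01) f1 t = 1 - eps * B.
    rewrite RintegralB // -Rintegral_mkcondr IPE !Rintegral_cst //.
    have -> : fine (mu P) = 2 * eps.
      exact: lebesgue_itv_centered.
    have -> : fine (mu I01) = 1.
      by rewrite lebesgue_measure_itv /= lte_fin ltr01 /= subr0.
    by rewrite mulVf ?mulr1 // mulf_neq0 // gt_eqF.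
  apply: (@lt_le_trans _ _ (1 - eps * B)); first by rewrite subr_gt0.
  rewrite -f1int; apply: le_Rintegral => //.
  - have := @integrableB _ _ _ mu _ mI _ _ iP (icst (eps * B)).
    by apply: eq_integrable.
  - exact: (@bmfun_intIm _ _ _ mu _ mI fin _ bh).
  move=> t /=; rewrite in_itv /= => t_in; rewrite /f1.
  have epsB0 : 0 <= eps * B by rewrite mulr_ge0 // ltW.
  case: (ltP `|t - t0| d) => td.
    have tE : t0 + (t - t0) = t by ring.
    have [_ veq h1 h2] := hd _ td; rewrite tE -/s in veq h1 h2.
    set u := t - t0 in td h1.
    have hk : eps / (u ^+ 2 + eps ^+ 2) <= complex.Im (h t).
      rewrite /h veq; apply: (kernel_jump eps0 v00 _ _ h2).
        by move: h1; congr (cabs _ <= _); rewrite /zp -/s /w; ring.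
      by rewrite /zp /zm /w; ring.
    rewrite (le_trans _ hk) //.
    have D0 : 0 < u ^+ 2 + eps ^+ 2 by rewrite ltr_wpDl ?sqr_ge0 // exprn_gt0.
    rewrite patchE; case: ifPn => [|_].
      rewrite inE /P /= in_itv /= => /andP[g1 g2].
      rewrite lerBlDr ler_wpDr // ler_pdivlMr //.
      rewrite mulrC ler_pdivrMr ?mulr_gt0 //.
      have : u ^+ 2 <= eps ^+ 2.
        rewrite -real_normK ?num_real // lerXn2r ?nnegrE ?normr_ge0 ?(ltW eps0) //.
        rewrite /u ler_norml; apply/andP; split; first by rewrite lerBrDl.
        by rewrite lerBlDl.
      by move=> g; rewrite mulrCA -expr2 mulr_natl mulr2n lerD2r.
    by rewrite sub0r (le_trans (_ : _ <= 0)) ?oppr_le0 // divr_ge0 // ltW.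
  have tP : t \in P = false.
    apply/negbTE/negP; rewrite inE /P /= in_itv /= => tP.
    have /andP[k1 k2] := tP.
    have : `|t - t0| <= eps by rewrite ler_norml lerBrDl k1 lerBlDl.
    by rewrite leNgt (lt_le_trans eps_d td).
  rewrite patchE tP sub0r.
  have : cabs (h t) <= eps * B.
    have [_ /(_ td) hp] := near_dist 1 t (or_introl erefl) t_in.
    have [_ /(_ td) hm] := near_dist (-1) t (or_intror erefl) t_in.
    rewrite -/zp in hp; rewrite -/zm in hm.
    have rho20 : 0 < rho / 2 by rewrite divr_gt0.
    have hp0 := lt_le_trans rho20 hp; have hm0 := lt_le_trans rho20 hm.
    have -> : h t = 2 * w * velocity G t * ((G t - zp)^-1 * (G t - zm)^-1).
      have dif (x y : R[i]) : 0 < cabs x -> 0 < cabs y ->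
          x^-1 - y^-1 = (y - x) * (x^-1 * y^-1).
        by rewrite !cabs_gt0 => x0 y0; field; rewrite x0 y0.
      by rewrite /h (dif _ _ hp0 hm0) mulrAC; congr (_ * _ * _); rewrite /zp /zm; ring.
    have -> : eps * B = 2 * (eps * cabs v0) * M * ((rho / 2)^-1 * (rho / 2)^-1).
      by rewrite /B; field; rewrite gt_eqF.
    have c2 : cabs (2 : R[i]) = 2 by rewrite -(creal_nat R 2) cabs_creal normr_nat.
    rewrite (cabsM _ (_ * _)) (cabsM (2 * w)) (cabsM 2 w) cw c2.
    rewrite (cabsM (G t - zp)^-1) !cabsV.
    have w20 : 0 <= 2 * (eps * cabs v0) by apply: mulr_ge0 => //; exact: ltW cwp.
    apply: ler_pM.
    - by apply: mulr_ge0 => //; exact: cabs_ge0.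
    - by apply: mulr_ge0; rewrite invr_ge0 cabs_ge0.
    - by apply: ler_wpM2l => //; apply: velM; rewrite /= in_itv.
    - by apply: ler_pM; rewrite ?invr_ge0 ?cabs_ge0 // lef_pV2 // posrE.
  have := ler_Im_cabs (h t); rewrite ler_norml => /andP[+ _] => g1 g2.
  by rewrite (le_trans _ g1) // lerN2.
have : complex.Re (winding G zp - winding G zm) <= 0.
  by rewrite wm; case: wp => ->; rewrite ?subrr ?sub0r //= oppr_le0 ler01.
rewrite WE ReM ReV ImV /= mul0r mul0r sub0r mulNr opprK leNgt.
by rewrite mulr_gt0 // divr_gt0 ?exprn_gt0 ?cabs_gt0 ?twopii_neq0 // mulr_gt0 // pi_gt0.
Unshelve. all: by end_near.
Qed.

End Jump.

(** * Compactly carried measures *)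

(** The measure m is carried by the compact set S, which is the support of m in
    the applications. *)
Definition compactly_carried (R : realType)
    (m : {measure set (measurableTypeR R) -> \bar R}) (S : set R) : Prop :=
  [/\ closed S, exists M : R, forall x, S x -> `|x| <= M &
      m (~` S) = 0%E].

Section Support.
Variable R : realType.

Lemma cuts_closed (k : nat) (a b : 'I_k -> R) : closed (cuts a b).
Proof.
have -> : cuts a b = \bigcup_(j in [set: 'I_k]) [set` `[a j, b j]].
  apply/seteqP; split => x /=.
    by move=> [j xj]; exists j => //=; rewrite in_itv.
  by move=> [j _ /=]; rewrite in_itv /= => xj; exists j.
by apply: closed_bigcup => [|j _]; [exact: finite_finset|exact: itv_closed].
Qed.

Lemma range_closed (q : nat) (s : 'I_q -> R) : closed (range s).
Proof.
have -> : range s = \bigcup_(j in [set: 'I_q]) [set s j].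
  apply/seteqP; split => x /=.
    by move=> [j _ <-]; exists j.
  by move=> [j _ /= ->]; exists j.
by apply: closed_bigcup => [|j _]; [exact: finite_finset|exact: closed_eq].
Qed.

(** The support consists of the intervals and of the spikes. *)
Lemma spiked_support (m : {measure set (measurableTypeR R) -> \bar R})
    (k : nat) (a b : 'I_k -> R) (q : nat) (s : 'I_q -> R) :
  spiked_measure m a b s ->
  msupp m = cuts a b `|` range s /\ compactly_carried m (msupp m).
Proof.
move=> [ab sep sinj [h [w [mh h0 w0 mE hpos]]]].
set K := cuts a b `|` range s.
have clK : closed K by apply: closedU; [exact: cuts_closed|exact: range_closed].
have int0 A : (0 <= \int[lebesgue_measure]_(x in A) (h x)%:E)%E.
  by apply: integral_ge0 => x _; rewrite lee_fin.
have sum0 (A : set R) : 0 <= \sum_i w i * \1_A (s i).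
  by apply: sumr_ge0 => i _; rewrite mulr_ge0 // ltW.
have mK : measurable (~` K : set (measurableTypeR R)).
  by apply: measurableC; exact: closed_measurable.
have K0 : m (~` K) = 0%E.
  rewrite mE //; have -> : (~` K) `&` cuts a b = set0.
    by apply/seteqP; split => x //= [nK xc]; apply: nK; left.
  rewrite integral_set0 add0e big1 // => i _.
  rewrite indicE memNset ?mulr0 //= => nK; apply: nK; right; by exists i.
have suppE : msupp m = K.
  apply/seteqP; split => x.
    move=> xs; apply: contrapT => xK.
    have : nbhs x (~` K) by apply: open_nbhs_nbhs; split => //; exact: closed_openC.
    move=> /nbhs_ballP[e /= e0 eK]; have := xs e e0.
    suff -> : m (ball x e) = 0%E by rewrite ltxx.
    apply/eqP; rewrite -measure_le0 -K0; apply: le_measure => //.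
    + by rewrite inE; exact: measurable_ball.
    + by rewrite inE.
  move=> xK e e0; rewrite mE; last exact: measurable_ball.
  case: xK => [xc|[i _ <-]].
    by apply: (lt_le_trans (hpos x e xc e0)); rewrite leeDl // lee_fin.
  apply: (@lt_le_trans _ _ (\sum_j w j * \1_(ball (s i) e) (s j))%:E); last first.
    by rewrite leeDr.
  rewrite lte_fin (bigD1 i) //= ltr_pwDl //.
    by rewrite indicE mem_set ?mulr1 //; exact: ballxx.
  by apply: sumr_ge0 => j _; rewrite mulr_ge0 // ltW.
split=> //; rewrite suppE; split=> //.
exists (\sum_j (`|a j| + `|b j|) + \sum_i `|s i|) => x [[j /andP[ax xb]]|[i _ <-]].
  have h1 : `|a j| + `|b j| <= \sum_j (`|a j| + `|b j|).
    by rewrite [leRHS](bigD1 j) //= lerDl sumr_ge0.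
  have h2 : 0 <= \sum_i `|s i| by rewrite sumr_ge0.
  have := ler_norm (- a j); have := ler_norm (b j); rewrite normrN.
  have := normr_ge0 (a j); have := normr_ge0 (b j).
  by rewrite ler_norml => *; apply/andP; split; lra.
have h1 : 0 <= \sum_j (`|a j| + `|b j|) by rewrite sumr_ge0 // => j _; rewrite addr_ge0.
by rewrite (bigD1 i) //= addrCA lerDl addr_ge0 // sumr_ge0.
Qed.

End Support.

Section Carried.
Variables (R : realType) (m : {measure set (measurableTypeR R) -> \bar R}).
Variable S : set R.
Hypotheses (mfin : (m setT < +oo)%E) (mS : compactly_carried m S).

Lemma carried_measurable : measurable (S : set (measurableTypeR R)).
Proof. by have [clS _ _] := mS; exact: closed_measurable. Qed.

Lemma carried_fin : (m S < +oo)%E.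
Proof.
apply: le_lt_trans mfin; apply: le_measure => //; rewrite inE //.
exact: carried_measurable.
Qed.

Lemma carried_Rintegral (f : measurableTypeR R -> R) : measurable_fun setT f ->
  \int[m]_x f x = \int[m]_(x in S) f x.
Proof.
move=> mf; have mSm := carried_measurable; have [_ _ S0] := mS.
rewrite [RHS]Rintegral_mkcond /Rintegral; congr fine.
apply: ae_eq_integral => //.
- exact/measurable_EFinP.
- apply/measurable_EFinP/measurable_restrict => //.
  by apply: measurable_funS mf.
exists (~` S); split => //; first exact: measurableC.
move=> x /= h xS; apply: h => _; by rewrite patchE mem_set.
Qed.

Lemma carried_cintegral (f : R -> R[i]) :
  measurable_fun setT (fun x : measurableTypeR R => complex.Re (f x)) ->
  measurable_fun setT (fun x : measurableTypeR R => complex.Im (f x)) ->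
  cintegral m setT f = cintegral m S f.
Proof. by move=> mr mi; rewrite /cintegral !carried_Rintegral. Qed.

Lemma poly_measurable (q : {poly R}) (D : set (measurableTypeR R)) :
  measurable D -> measurable_fun D (fun x : measurableTypeR R => q.[x]).
Proof.
move=> mD; apply: measurable_funS (continuous_measurable_fun _) => //.
exact: continuous_horner.
Qed.

Lemma poly_bmfun (q : {poly R}) :
  bmfun (S : set (measurableTypeR R)) (fun x => creal q.[x]).
Proof.
have [clS [M SM] S0] := mS; have mSm := carried_measurable.
apply: (@bmfunS _ _ _ (`[- M, M] : set (measurableTypeR R))) => //.
  by move=> x /SM; rewrite ler_norml /= in_itv.
apply: ccont_bmfun; apply/ccontP => t _.
apply/cvg_cabsP => e e0; have /cvgrPdist_lt/(_ e e0) : q.[x] @[x --> t] --> q.[t].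
  exact: continuous_horner.
move=> h; rewrite near_withinE; near=> x => _; rewrite -crealB cabs_creal distrC.
by near: x.
Unshelve. all: by end_near.
Qed.

Lemma poly_integrable (q : {poly R}) :
  m.-integrable S (EFin \o (fun x => q.[x])).
Proof. exact: (bmfun_intRe carried_measurable carried_fin (poly_bmfun q)). Qed.

End Carried.

(** * Moments and Cauchy transforms *)

(** The moment functional of a measure on real polynomials. *)
Definition mom (R : realType) (m : {measure set (measurableTypeR R) -> \bar R})
  (q : {poly R}) : R := \int[m]_x q.[x].

(** The Cauchy transform of the measure with density q with respect to m. *)
Definition ctr (R : realType) (m : {measure set (measurableTypeR R) -> \bar R})
    (q : {poly R}) (z : R[i]) : R[i] :=
  (twopii R)^-1 * cintegral m setT (fun x => creal q.[x] / (creal x - z)).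

(** The value at a complex point of a polynomial with real coefficients. *)
Definition rpeval (R : realType) (q : {poly R}) (z : R[i]) : R[i] :=
  (map_poly (@creal R) q).[z].

Section Rpeval.
Variable R : realType.
Implicit Types (p q : {poly R}) (z : R[i]).

Lemma rpevalE q z : rpeval q z = (map_poly (real_complex R) q).[z].
Proof. by []. Qed.

Lemma rpevalC c z : rpeval c%:P z = creal c.
Proof. by rewrite rpevalE map_polyC /= hornerC. Qed.

Lemma rpevalMXaddC p c z : rpeval (p * 'X + c%:P) z = rpeval p z * z + creal c.
Proof.
by rewrite !rpevalE rmorphD rmorphM /= map_polyX map_polyC /= hornerMXaddC.
Qed.

End Rpeval.

Section Moments.
Variables (R : realType) (m : {measure set (measurableTypeR R) -> \bar R}).
Variable S : set R.
Hypotheses (mfin : (m setT < +oo)%E) (mS : compactly_carried m S).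
Implicit Types (p q P : {poly R}) (z w : R[i]).

Let mSm : measurable (S : set (measurableTypeR R)).
Proof. exact: carried_measurable mS. Qed.
Let Sfin : (m S < +oo)%E. Proof. exact: carried_fin mfin mS. Qed.

Lemma momE q : mom m q = \int[m]_(x in S) q.[x].
Proof. by apply: (carried_Rintegral mS); exact: poly_measurable. Qed.

Lemma momD p q : mom m (p + q) = mom m p + mom m q.
Proof.
rewrite !momE -RintegralD //; [|exact: poly_integrable..].
by apply: eq_Rintegral => x _; rewrite hornerD.
Qed.

Lemma momZ c q : mom m (c *: q) = c * mom m q.
Proof.
rewrite !momE -RintegralZl //; last exact: poly_integrable.
by apply: eq_Rintegral => x _; rewrite hornerZ.
Qed.

Lemma mom0 : mom m 0 = 0.
Proof. by rewrite -(scale0r (0 : {poly R})) momZ mul0r. Qed.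

Lemma mom_sum (I : Type) (r : seq I) (F : I -> {poly R}) :
  mom m (\sum_(i <- r) F i) = \sum_(i <- r) mom m (F i).
Proof.
by elim: r => [|i r IH]; rewrite ?big_nil ?mom0 // !big_cons momD IH.
Qed.

Lemma support_dist z : ~ (@creal R @` S) z ->
  exists2 e : R, 0 < e & forall x, S x -> e <= cabs (creal x - z).
Proof.
move=> zS; have [clS _ _] := mS.
have [Im0|Im_neq0] := eqVneq (complex.Im z) 0; last first.
  exists `|complex.Im z|; first by rewrite normr_gt0.
  move=> x _; rewrite (le_trans _ (ler_Im_cabs _)) //.
  by rewrite ImD ImN /= sub0r normrN.
have zE : z = creal (complex.Re z) by apply: complexP => //=.
have : nbhs (complex.Re z) (~` S).
  apply: open_nbhs_nbhs; split; first exact: closed_openC.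
  by move=> /= zS'; apply: zS; exists (complex.Re z).
move=> /nbhs_ballP[e /= e0 eS]; exists e => // x xS.
rewrite leNgt; apply/negP => xe; apply: (eS x) => //.
by rewrite -ball_normE /= distrC; move: xe; rewrite {1}zE -crealB cabs_creal.
Qed.

Lemma kernel_bmfun z : ~ (@creal R @` S) z ->
  bmfun (S : set (measurableTypeR R)) (fun x => (creal x - z)^-1).
Proof.
move=> /support_dist[e e0 ez]; apply: (bmfunV e0 ez).
apply: bmfunB; last exact: bmfun_cst.
have := poly_bmfun mS 'X; apply: eq_bmfun => x _; by rewrite hornerX.
Qed.

Lemma ctr_bmfun q z : ~ (@creal R @` S) z ->
  bmfun (S : set (measurableTypeR R)) (fun x => creal q.[x] / (creal x - z)).
Proof.
by move=> zS; apply: bmfunM; [exact: poly_bmfun mS q|exact: kernel_bmfun].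
Qed.

Lemma ctrE q z : ctr m q z =
  (twopii R)^-1 * cintegral m S (fun x => creal q.[x] / (creal x - z)).
Proof.
congr (_ * _); apply: (carried_cintegral mS).
  have mq := poly_measurable q measurableT.
  have mX := poly_measurable ('X - (complex.Re z)%:P) measurableT.
  have mN := measurable_funD (measurable_funX 2 mX)
    (@measurable_cst _ _ _ _ (setT : set (measurableTypeR R)) (complex.Im z ^+ 2)).
  have mV := measurableT_comp (measurable_powR (-1)) mN.
  apply: eq_measurable_fun (measurable_funM mq (measurable_funM mX mV)) => x _ /=.
  rewrite powR_inv1; last by rewrite addr_ge0 ?sqr_ge0.
  rewrite ReM /= mul0r subr0 ReV cabs_sqr ReD ImD ReN ImN /= sub0r sqrrN.
  by rewrite hornerD hornerN hornerX hornerC.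
have mq := poly_measurable q measurableT.
have mX := poly_measurable ('X - (complex.Re z)%:P) measurableT.
have mN := measurable_funD (measurable_funX 2 mX)
  (@measurable_cst _ _ _ _ (setT : set (measurableTypeR R)) (complex.Im z ^+ 2)).
have mV := measurableT_comp (measurable_powR (-1)) mN.
have mc := @measurable_cst _ _ _ _ (setT : set (measurableTypeR R)) (complex.Im z).
apply: eq_measurable_fun (measurable_funM mq (measurable_funM mc mV)) => x _ /=.
rewrite powR_inv1; last by rewrite addr_ge0 ?sqr_ge0.
rewrite ImM /= mul0r addr0 ImV cabs_sqr ReD ImD ReN ImN /= sub0r sqrrN.
by rewrite hornerD hornerN hornerX hornerC mulNr opprK.
Qed.

Lemma ctrD p q z : ~ (@creal R @` S) z ->
  ctr m (p + q) z = ctr m p z + ctr m q z.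
Proof.
move=> zS; rewrite !ctrE -mulrDr; congr (_ * _).
rewrite -cintegralD //; [|exact: ctr_bmfun..].
by apply: eq_cintegral => x _; rewrite hornerD crealD mulrDl.
Qed.

Lemma ctrZ (c : R) q z : ~ (@creal R @` S) z ->
  ctr m (c *: q) z = creal c * ctr m q z.
Proof.
move=> zS; rewrite !ctrE mulrCA; congr (_ * _).
rewrite -cintegralZ //; last exact: ctr_bmfun.
by apply: eq_cintegral => x _; rewrite hornerZ crealM mulrA.
Qed.

Lemma ctr0 z : ~ (@creal R @` S) z -> ctr m 0 z = 0.
Proof. by move=> zS; rewrite -(scale0r (0 : {poly R})) ctrZ // mul0r. Qed.

(** Multiplication by the variable and multiplication by z differ by a
    moment; the relations between orthogonal polynomials and their Cauchy
    transforms all come from this one. *)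
Lemma ctrMX q z : ~ (@creal R @` S) z ->
  ctr m (q * 'X) z = ctr m q z * z + (twopii R)^-1 * creal (mom m q).
Proof.
move=> zS; have [e e0 ez] := support_dist zS.
rewrite !ctrE -mulrA -mulrDr; congr (_ * _); rewrite [_ * z]mulrC.
rewrite -cintegralZ //; last exact: ctr_bmfun.
have -> : creal (mom m q) = cintegral m S (fun x => creal q.[x]).
  by rewrite momE; apply: complexP => //=; rewrite /Rintegral integral0.
rewrite -cintegralD //; last exact: poly_bmfun mS q.
- apply: eq_cintegral => x /ez xz; have x0 : creal x - z != 0.
    by rewrite -cabs_gt0 (lt_le_trans e0).
  by rewrite hornerM hornerX crealM; field.
- exact/bmfunZ/ctr_bmfun.
Qed.

(** Cauchy transforms are continuous off the support. *)
Lemma ctr_cvg q z : ~ (@creal R @` S) z ->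
  (ctr m q : R[i]^o -> R[i]^o) @ (z : R[i]^o) --> (ctr m q z : R[i]^o).
Proof.
move=> zS; have [e e0 ez] := support_dist zS.
have [_ _ [M qM]] := poly_bmfun mS q.
have e20 : 0 < e / 2 by rewrite divr_gt0.
have ew w : cabs (w - z) <= e / 2 -> forall x, S x -> e / 2 <= cabs (creal x - w).
  move=> wz x /ez h; have -> : creal x - w = (creal x - z) - (w - z) by ring.
  by have := cabsBB (creal x - z) (w - z); lra.
have off w : cabs (w - z) <= e / 2 -> ~ (@creal R @` S) w.
  move=> /ew h [x xS xw]; have := h x xS.
  by rewrite xw subrr cabs0 leNgt e20.
have [M0|M0] := leP 0 M; last first.
  have S0 : S = set0.
    apply/seteqP; split => x // /qM; rewrite leNgt => /negP; apply.
    exact: lt_le_trans M0 (cabs_ge0 _).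
  have E w : ctr m q w = 0.
    by rewrite ctrE S0 /cintegral !Rintegral_set0 mulr0.
  apply/cvg_nbhs_cabsP => r r0; exists 1 => // w _.
  by rewrite !E subrr cabs0.
pose K := cabs (twopii R)^-1 * (2 * (M * (e / 2)^-1 * (e / 2)^-1 * fine (m S))).
have K0 : 0 <= K.
  apply: mulr_ge0; first exact: cabs_ge0.
  apply: mulr_ge0 => //; apply: mulr_ge0; last exact: fine_ge0.
  by rewrite -mulrA; apply: mulr_ge0 => //; rewrite -expr2 sqr_ge0.
have lip w : cabs (w - z) <= e / 2 -> cabs (ctr m q w - ctr m q z) <= K * cabs (w - z).
  move=> wz; rewrite !ctrE -mulrBr cabsM -mulrA ler_wpM2l ?cabs_ge0 //.
  rewrite -cintegralB //; [|exact: ctr_bmfun (off _ wz)|exact: ctr_bmfun].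
  have bw := ctr_bmfun q (off _ wz); have bz := ctr_bmfun q zS.
  rewrite (_ : 2 * _ * cabs (w - z) =
    2 * (M * (e / 2)^-1 * (e / 2)^-1 * cabs (w - z) * fine (m S))); last by ring.
  apply: (cabs_cintegral_bound mSm Sfin (bmfunB bw bz)) => x xS.
  have dif (a b c : R[i]) : 0 < cabs a -> 0 < cabs b ->
      c / a - c / b = c * a^-1 * b^-1 * (b - a).
    by rewrite !cabs_gt0 => a0 b0; field; rewrite a0 b0.
  have h1 := ew w wz x xS.
  have h2 : e / 2 <= cabs (creal x - z) by have := ez x xS; lra.
  have g1 := lt_le_trans e20 h1; have g2 := lt_le_trans e20 h2.
  rewrite dif // !cabsM !cabsV (_ : creal x - z - (creal x - w) = w - z); last by ring.
  apply: ler_wpM2r; first exact: cabs_ge0.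
  apply: ler_pM.
  - by apply: mulr_ge0; rewrite ?invr_ge0 cabs_ge0.
  - by rewrite invr_ge0 cabs_ge0.
  - apply: ler_pM; rewrite ?invr_ge0 ?cabs_ge0 ?qM //.
    by rewrite lef_pV2 // posrE.
  - by rewrite lef_pV2 // posrE.
apply/cvg_nbhs_cabsP => r r0.
exists (Num.min (e / 2) (r / (K + 1))).
  by rewrite lt_min e20 divr_gt0 // ltr_wpDl.
move=> w; rewrite lt_min => /andP[/ltW h1].
rewrite ltr_pdivlMr; last by rewrite ltr_wpDl.
move=> h2; rewrite (le_lt_trans (lip w h1)) // (le_lt_trans _ h2) //.
by rewrite mulrC ler_wpM2l ?cabs_ge0 // lerDl.
Qed.

(** The Cauchy transform of q dm differs from q times the Cauchy transform of dm
    by a polynomial, the associated polynomial of q. *)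
Lemma ctr_second_kind q : exists Q : {poly R[i]}, forall z, ~ (@creal R @` S) z ->
  ctr m q z - rpeval q z * ctr m 1 z = Q.[z].
Proof.
elim/poly_ind: q => [|q c [Q QE]].
  exists 0 => z zS; rewrite horner0 rpevalE rmorph0 horner0 mul0r subr0.
  by rewrite ctr0.
exists (Q * 'X + ((twopii R)^-1 * creal (mom m q))%:P) => z zS.
rewrite hornerMXaddC -QE // rpevalMXaddC ctrD // ctrMX //.
by rewrite -alg_polyC ctrZ //; ring.
Qed.

(** A polynomial factor that is not too large can be moved inside the Cauchy
    transform of an orthogonal polynomial. *)
Lemma ctr_orthogonal q k P z :
  (forall Q : {poly R}, (size Q <= k)%N -> mom m (Q * q) = 0) -> (size P <= k.+1)%N ->
  ~ (@creal R @` S) z -> rpeval P z * ctr m q z = ctr m (P * q) z.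
Proof.
move=> ort + zS; elim/poly_ind: P => [|P c IH].
  move=> _; rewrite rpevalE rmorph0 horner0 !mul0r.
  by rewrite ctr0.
rewrite size_MXaddC; case: ifP => [/andP[/eqP -> /eqP ->] _|_].
  rewrite mul0r add0r rpevalC polyC0 !mul0r.
  by rewrite ctr0.
rewrite ltnS => sP; rewrite rpevalMXaddC mulrDl [RHS](_ : _ = ctr m (P * q * 'X + c *: q) z).
  by rewrite ctrD // ctrMX // ort // mulr0 addr0 ctrZ // -IH ?(leq_trans sP) //; ring.
by congr (ctr m _ z); rewrite mulrDl mul_polyC mulrAC.
Qed.

(** For the next degree there is a correction by the squared norm. *)
Lemma ctr_orthogonal_lead q k P z :
  (forall Q : {poly R}, (size Q <= k)%N -> mom m (Q * q) = 0) ->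
  q \is monic -> size q = k.+1 -> P \is monic -> size P = k.+2 ->
  ~ (@creal R @` S) z ->
  rpeval P z * ctr m q z =
    ctr m (P * q) z - (twopii R)^-1 * creal (mom m (q * q)).
Proof.
move=> ort qm sq; elim/poly_ind: P => [|P c _]; first by rewrite size_poly0.
move=> Pm; rewrite size_MXaddC; case: ifP => // _ [sP] zS.
have P0 : P != 0 by rewrite -size_poly_eq0 sP.
have {}Pm : P \is monic.
  move: Pm; rewrite !monicE lead_coefDl ?lead_coefMX // size_polyC size_mulX // sP.
  by case: (c == 0).
rewrite rpevalMXaddC mulrDl [in RHS](_ : (P * 'X + c%:P) * q = P * q * 'X + c *: q).
  rewrite ctrD // ctrMX // ctrZ // -(ctr_orthogonal ort (P := P)) ?sP //.
  have -> : mom m (P * q) = mom m (q * q); last by ring.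
  have -> : P * q = q * q + (P - q) * q by ring.
  rewrite momD (ort (P - q)) ?addr0 //.
  have /andP[/eqP lP /eqP lq] : (lead_coef P == 1) && (lead_coef q == 1).
    by rewrite -!monicE Pm qm.
  rewrite -ltnS; have /leq_sizeP hk : (size (P - q)%R <= k.+1)%N.
    by rewrite (leq_trans (size_polyD _ _)) // size_polyN sP sq maxnn.
  apply/leq_sizeP => j; rewrite leq_eqVlt => /orP[/eqP <-|jk]; last exact: hk.
  rewrite coefB; move: lP lq; rewrite /lead_coef sP sq /= => -> ->.
  by rewrite subrr.
by rewrite mulrDl mul_polyC mulrAC.
Qed.

End Moments.

(** * Orthogonal polynomials *)

Lemma poly_all_roots (F : fieldType) (Q : {poly F}) : Q != 0 ->
  exists l : seq F, (size l < size Q)%N /\ forall x, root Q x -> x \in l.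
Proof.
move: {2}(size Q) (leqnn (size Q)) => n; elim: n Q => [|n IH] Q sQ Q0.
  by move: sQ; rewrite leqn0 size_poly_eq0 (negPf Q0).
have [[x Qx]|nox] := pselect (exists x, root Q x); last first.
  exists [::]; split; first by rewrite /= lt0n size_poly_eq0.
  by move=> x Qx; case: nox; exists x.
have [Q' QE] := factor_theorem Q x Qx.
have Q'0 : Q' != 0 by apply: contra Q0; rewrite QE => /eqP ->; rewrite mul0r.
have sQE : size Q = (size Q').+1.
  by rewrite QE size_Mmonic ?monicXsubC // size_XsubC addn2.
have [|l [sl lroots]] := IH Q' _ Q'0; first by move: sQ; rewrite sQE ltnS.
exists (x :: l); split; first by rewrite sQE /= ltnS.
move=> y; rewrite QE rootM root_XsubC inE => /orP[/lroots ->|->//].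
by rewrite orbT.
Qed.

Lemma finite_seq_measurable (R : realType) (l : seq R) :
  measurable ([set` l] : set (measurableTypeR R)).
Proof.
elim: l => [|x l IH].
  by rewrite (_ : [set` [::]] = set0) //; apply/seteqP; split => y.
rewrite (_ : [set` x :: l] = [set x] `|` [set` l]); first exact: measurableU.
apply/seteqP; split => y /=; rewrite inE; last by case=> [->|->]; rewrite ?eqxx ?orbT.
by move=> /orP[/eqP ->|yl]; [left|right].
Qed.

Section Orthogonal.
Variables (R : realType) (m : {measure set (measurableTypeR R) -> \bar R}).
Variable S : set R.
Hypotheses (mfin : (m setT < +oo)%E) (mS : compactly_carried m S).
Implicit Types (p q P Q : {poly R}).

Let mSm : measurable (S : set (measurableTypeR R)).
Proof. exact: carried_measurable mS. Qed.

(** The inner product is definite on polynomials with fewer zeros than the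
    measure has points. *)
Lemma mom_sqr_gt0 n Q :
  (forall l : seq R, (size l < n)%N -> (0 < m (~` [set` l]))%E) ->
  Q != 0 -> (size Q <= n)%N -> 0 < mom m (Q * Q).
Proof.
move=> nd Q0 sQ.
have Q2 x : (Q * Q).[x] = Q.[x] ^+ 2 by rewrite hornerM expr2.
have ge0 : 0 <= mom m (Q * Q).
  by apply: Rintegral_ge0 => x _; rewrite Q2 sqr_ge0.
rewrite lt_def ge0 andbT; apply/eqP => mom0.
have iQ := poly_integrable mfin mS (Q * Q).
have int0 : (\int[m]_(x in S) `|((Q * Q).[x])%:E| = 0)%E.
  have E : (\int[m]_(x in S) `|((Q * Q).[x])%:E| =
      \int[m]_(x in S) ((Q * Q).[x])%:E)%E.
    by apply: eq_integral => x _; rewrite /= Q2 ger0_norm // sqr_ge0.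
  rewrite E -(fineK (integrable_fin_num mSm iQ)).
  by have := mom0; rewrite (momE mS) /Rintegral => ->.
have [N [mN N0 subN]] := (iffLR (ae_eq_integral_abs m mSm (measurable_int m iQ))) int0.
have [l [sl lroots]] := poly_all_roots Q0.
(* otherwise Q vanishes almost everywhere and its zeros carry the measure *)
have := nd l (leq_trans sl sQ); suff -> : m (~` [set` l]) = 0%E by rewrite ltxx.
have mlC : measurable (~` [set` l] : set (measurableTypeR R)).
  by apply: measurableC; exact: finite_seq_measurable.
have [_ _ S0] := mS.
apply/eqP; rewrite -measure_le0.
have mSC : measurable (~` S : set (measurableTypeR R)) by exact: measurableC.
apply: (@le_trans _ _ (m (N `|` ~` S))).
  apply: le_measure; rewrite ?inE //; first exact: measurableU.
  move=> x xl; have [xS|xS] := pselect (S x); last by right.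
  left; apply: subN => /= /(_ xS); rewrite Q2 => -[] /eqP.
  by rewrite expf_eq0 /= => /lroots.
have <- : (m N + m (~` S) = 0)%E by rewrite N0 S0 adde0.
exact: measureU2.
Qed.

Lemma mom_rVpoly n (v : 'rV[R]_n) P :
  mom m (rVpoly v * P) = \sum_(i < n) v 0 i * mom m ('X^i * P).
Proof.
have -> : rVpoly v = \sum_(i < n) v 0 i *: 'X^i.
  rewrite [in LHS]/rVpoly poly_def; apply: eq_bigr => i _.
  by rewrite insubT //= => ii; congr (v _ _ *: _); apply: val_inj.
rewrite mulr_suml (mom_sum mfin mS); apply: eq_bigr => i _.
by rewrite -scalerAl (momZ mfin mS).
Qed.

(** Existence, by invertibility of the Gram matrix of the monomials. *)
Lemma monic_orthogonal_exists n :
  (forall Q, Q != 0 -> (size Q <= n)%N -> 0 < mom m (Q * Q)) ->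
  exists P, monic_orthogonal m n P.
Proof.
move=> pos.
pose A : 'M[R]_n := \matrix_(i, j) mom m ('X^i * 'X^j).
have Au : A \in unitmx.
  rewrite unitmxE unitfE; apply/negP => /det0P[v v0 vA].
  have := pos (rVpoly v) _ (size_poly _ _).
  have Q0 : rVpoly v != 0.
    by apply: contra v0 => /eqP v0; rewrite -(rVpolyK v) v0 linear0.
  move=> /(_ Q0); rewrite mom_rVpoly big1 ?ltxx // => i _.
  have -> : mom m ('X^i * rVpoly v) = 0; last by rewrite mulr0.
  have /rowP/(_ i) := vA; rewrite !mxE => <-; rewrite mulrC mom_rVpoly.
  by apply: eq_bigr => j _; rewrite [A _ _]mxE.
(* the coefficients c of the correction of 'X^n solve c A = - b *)
pose b : 'rV[R]_n := \row_j mom m ('X^n * 'X^j).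
pose c := - (b *m invmx A).
have cA : c *m A = - b by rewrite /c mulNmx mulmxKV.
pose P := 'X^n + rVpoly c.
have sc : (size (rVpoly c) < size ('X^n : {poly R}))%N.
  by rewrite size_polyXn ltnS size_poly.
exists P; split.
- by rewrite monicE /P lead_coefDl // lead_coefXn.
- by rewrite /P size_polyDl // size_polyXn.
move=> Q sQ; have -> : \int[m]_x (P.[x] * Q.[x]) = mom m (Q * P).
  by apply: eq_Rintegral => x _; rewrite hornerM mulrC.
rewrite -(poly_rV_K sQ) mom_rVpoly big1 // => i _.
have -> : mom m ('X^i * P) = 0; last by rewrite mulr0.
rewrite mulrC /P mulrDl (momD mfin mS) mom_rVpoly.
have /rowP/(_ i) := cA; rewrite !mxE => E.
rewrite -[X in _ + X](_ : \sum_j c 0 j * A j i = _).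
  by rewrite E subrr.
by apply: eq_bigr => j _; rewrite [A _ _]mxE.
Qed.

Lemma opolyP n :
  (forall Q, Q != 0 -> (size Q <= n)%N -> 0 < mom m (Q * Q)) ->
  [/\ opoly m n \is monic, size (opoly m n) = n.+1 &
      forall Q, (size Q <= n)%N -> mom m (Q * opoly m n) = 0].
Proof.
move=> /monic_orthogonal_exists[P0 oP0].
have : [set P | monic_orthogonal m n P] (opoly m n) by apply: (xgetPex 0); exists P0.
move=> [Pm sP ort]; split => // Q sQ; rewrite -(ort Q sQ).
by apply: eq_Rintegral => x _; rewrite hornerM mulrC.
Qed.

Lemma opoly0 : opoly m 0 = 1.
Proof.
have : [set P | monic_orthogonal m 0 P] (opoly m 0).
  apply: (xgetPex 0); exists 1; split; rewrite ?monic1 ?size_poly1 // => Q.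
  rewrite leqn0 size_poly_eq0 => /eqP ->.
  by rewrite -(mom0 mfin mS); apply: eq_Rintegral => x _; rewrite !horner0 mulr0.
move=> [Pm sP _]; rewrite (size1_polyC (eq_leq sP)).
have -> : (opoly m 0)`_0 = lead_coef (opoly m 0) by rewrite /lead_coef sP.
by move: Pm; rewrite monicE => /eqP ->.
Qed.

End Orthogonal.

(** * Two by two matrices *)

Section Mx2.
Variable K : realType.
Implicit Types (a b c d : K[i]).

Lemma mx2M a b c d a' b' c' d' :
  mx2 a b c d *m mx2 a' b' c' d' =
  mx2 (a * a' + b * c') (a * b' + b * d') (c * a' + d * c') (c * b' + d * d').
Proof.
apply/matrixP => i j; rewrite !mxE !big_ord_recl big_ord0 !mxE addr0 /=.
by case: i => [[|[|//]] ?]; case: j => [[|[|//]] ?].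
Qed.

Lemma mx2_1 : mx2 1 0 0 1 = 1%:M :> 'M[K[i]]_2.
Proof.
apply/matrixP => i j; rewrite !mxE.
by case: i => [[|[|//]] ?]; case: j => [[|[|//]] ?].
Qed.

Lemma mx2_eta (A : 'M[K[i]]_2) : A = mx2 (A 0 0) (A 0 1) (A 1 0) (A 1 1).
Proof.
apply/matrixP => i j; rewrite !mxE.
by case: i => [[|[|//]] ?]; case: j => [[|[|//]] ?] /=; congr (A _ _); apply: val_inj.
Qed.

Lemma invmx_right (A B : 'M[K[i]]_2) : A *m B = 1%:M -> A \in unitmx /\ invmx A = B.
Proof.
move=> AB; have [Au _] := mulmx1_unit AB; split => //.
by rewrite -[LHS]mulmx1 -AB mulKmx.
Qed.

Lemma mx2_inv a b c d : a * d - b * c = 1 ->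
  mx2 a b c d \in unitmx /\ invmx (mx2 a b c d) = mx2 d (- b) (- c) a.
Proof.
move=> det; apply: invmx_right; rewrite mx2M -mx2_1; congr mx2.
- by rewrite mulrN.
- by ring.
- by ring.
- by rewrite -det; ring.
Qed.

Lemma ord2P (P : 'I_2 -> Prop) : P 0 -> P 1 -> forall i, P i.
Proof.
move=> P0 P1 [[|[|//]] h]; [rewrite (_ : Ordinal h = 0)|rewrite (_ : Ordinal h = 1)] => //;
  exact: val_inj.
Qed.

End Mx2.

Section Mxabs.
Variable R : realType.
Implicit Types A : 'M[R[i]]_2.

Lemma mxabs_ge A i j : cabs (A i j) <= mxabs A.
Proof.
have h : `|A i j| <= `|A|.
  rewrite /Num.norm /= mx_normE; apply: (le_trans _ (_ : (`|A i j|%:nng)%:num <= _)) => //.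
  by rewrite num_le; exact: (le_bigmax _ (fun k : 'I_2 * 'I_2 => `|A k.1 k.2|%:nng) (i, j)).
by move: h; rewrite lecE /mxabs /cabs => /andP[].
Qed.

Lemma mxabs_le A (B : R) : 0 <= B -> (forall i j, cabs (A i j) <= B) -> mxabs A <= B.
Proof.
move=> B0 AB; have [A0|/mx_norm_neq0[[i j] /= E]] := eqVneq (mx_norm A) 0.
  by rewrite /mxabs /Num.norm /= A0.
by rewrite /mxabs /Num.norm /= E; exact: AB.
Qed.

Lemma mxabs_ge0 A : 0 <= mxabs A.
Proof. exact: le_trans (cabs_ge0 _) (mxabs_ge A 0 0). Qed.

End Mxabs.

(** * The matrix of orthogonal polynomials *)

(** A finite compactly carried measure for which the inner product is definite
    on polynomials of degree less than n. *)
Definition op_measure (R : realType)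
    (m : {measure set (measurableTypeR R) -> \bar R}) (S : set R) (n : nat) :=
  [/\ (m setT < +oo)%E, compactly_carried m S &
      forall Q : {poly R}, Q != 0 -> (size Q <= n)%N -> 0 < mom m (Q * Q)].

(** A polynomial is determined by its values off the real line. *)
Lemma poly_eq_off_real (R : realType) (p q : {poly R[i]}) :
  (forall z : R[i], complex.Im z != 0 -> p.[z] = q.[z]) -> p = q.
Proof.
move=> pq; apply/eqP; rewrite -subr_eq0; apply/negPn/negP => d0.
pose rs := [seq (Complex 0 k.+1%:R : R[i]) | k <- iota 0 (size (p - q))].
have : (size rs < size (p - q)%R)%N.
  apply: max_poly_roots => //.
    apply/allP => _ /mapP[k _ ->]; rewrite /root hornerD hornerN pq ?subrr //.
    by change (k.+1%:R != 0 :> R); rewrite pnatr_eq0.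
  rewrite map_inj_uniq ?iota_uniq // => j k [] /eqP.
  by rewrite eqr_nat => /eqP[].
by rewrite size_map size_iota ltnn.
Qed.

Section OneMeasure.
Variables (R : realType) (m : {measure set (measurableTypeR R) -> \bar R}).
Variables (S : set R) (n : nat).
Hypotheses (n1 : (1 <= n)%N) (hm : op_measure m S n).
Implicit Types (z : R[i]).

Lemma op_props : [/\ opoly m n \is monic, size (opoly m n) = n.+1 &
  forall Q : {poly R}, (size Q <= n)%N -> mom m (Q * opoly m n) = 0].
Proof. by case: hm => mfin mS pos; exact: (opolyP mfin mS pos). Qed.

Lemma op_pred_props : [/\ opoly m n.-1 \is monic, size (opoly m n.-1) = n &
  forall Q : {poly R}, (size Q <= n.-1)%N -> mom m (Q * opoly m n.-1) = 0].
Proof.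
case: hm => mfin mS pos; rewrite -[in size _ = n](prednK n1); apply: (opolyP mfin mS) => Q Q0 sQ.
by apply: pos => //; rewrite (leq_trans sQ) // leq_pred.
Qed.

Lemma op_pred_norm_gt0 : 0 < mom m (opoly m n.-1 * opoly m n.-1).
Proof.
case: hm => _ _; apply; have [pm sp _] := op_pred_props; last by rewrite sp.
exact: monic_neq0.
Qed.

(** The normalization of the second row. *)
Lemma gammaop_norm :
  gammaop m n.-1 * ((twopii R)^-1 * creal (mom m (opoly m n.-1 * opoly m n.-1))) = -1.
Proof.
have h0 := op_pred_norm_gt0.
have -> : gammaop m n.-1 =
    - twopii R / creal (mom m (opoly m n.-1 * opoly m n.-1)).
  congr (- _ / creal _); apply: eq_Rintegral => x _; by rewrite hornerM expr2.
set h := creal _; have hn0 : h != 0 by rewrite creal_eq0 gt_eqF.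
by field; rewrite twopii_neq0 hn0.
Qed.

Lemma YopE z : Yop m n z =
  mx2 (rpeval (opoly m n) z) (ctr m (opoly m n) z)
      (gammaop m n.-1 * rpeval (opoly m n.-1) z) (gammaop m n.-1 * ctr m (opoly m n.-1) z).
Proof. by []. Qed.

(** The determinant is 1, a form of the Liouville-Ostrogradsky identity. *)
Lemma Yop_det z : ~ (@creal R @` S) z ->
  rpeval (opoly m n) z * (gammaop m n.-1 * ctr m (opoly m n.-1) z)
  - ctr m (opoly m n) z * (gammaop m n.-1 * rpeval (opoly m n.-1) z) = 1.
Proof.
move=> zS; have [mfin mS _] := hm.
have [pm sp ort] := op_props; have [pm' sp' ort'] := op_pred_props.
have e1 : rpeval (opoly m n.-1) z * ctr m (opoly m n) z =
    ctr m (opoly m n.-1 * opoly m n) z.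
  by apply: (ctr_orthogonal mfin mS ort) => //; rewrite sp'.
have e2 : rpeval (opoly m n) z * ctr m (opoly m n.-1) z =
    ctr m (opoly m n * opoly m n.-1) z
    - (twopii R)^-1 * creal (mom m (opoly m n.-1 * opoly m n.-1)).
  by apply: (ctr_orthogonal_lead mfin mS ort'); rewrite // ?sp ?sp' prednK.
rewrite mulrCA [X in _ - X]mulrCA [X in _ - _ * X]mulrC e1 e2.
rewrite [opoly m n.-1 * opoly m n]mulrC -mulrBr addrAC subrr add0r mulrN.
by rewrite gammaop_norm opprK.
Qed.

Lemma Yop_inv z : ~ (@creal R @` S) z ->
  Yop m n z \in unitmx /\ invmx (Yop m n z) =
  mx2 (gammaop m n.-1 * ctr m (opoly m n.-1) z) (- ctr m (opoly m n) z)
      (- (gammaop m n.-1 * rpeval (opoly m n.-1) z)) (rpeval (opoly m n) z).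
Proof. by move=> /Yop_det det; rewrite YopE; exact: mx2_inv. Qed.

Lemma cauchyop0 z : cauchyop m 0 z = ctr m 1 z.
Proof. by case: hm => mfin mS _; rewrite -(opoly0 mfin mS). Qed.

(** Removing the jump of the second column makes the matrix polynomial. *)
Lemma Yop_inside : exists p11 p12 p21 p22 : {poly R[i]},
  (forall z, ~ (@creal R @` S) z ->
    Yop m n z *m mx2 1 (- cauchyop m 0 z) 0 1 =
    mx2 p11.[z] p12.[z] p21.[z] p22.[z]) /\
  p11 * p22 - p12 * p21 = 1.
Proof.
have [mfin mS _] := hm.
have [Q1 Q1E] := ctr_second_kind mfin mS (opoly m n).
have [Q2 Q2E] := ctr_second_kind mfin mS (opoly m n.-1).
pose g := (gammaop m n.-1)%:P.
pose P1 := map_poly (@creal R) (opoly m n); pose P2 := map_poly (@creal R) (opoly m n.-1).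
have E z : ~ (@creal R @` S) z ->
    Yop m n z *m mx2 1 (- cauchyop m 0 z) 0 1 =
    mx2 P1.[z] Q1.[z] (g * P2).[z] (g * Q2).[z].
  move=> zS; rewrite YopE cauchyop0 mx2M !hornerM !hornerC -Q1E // -Q2E //.
  by rewrite -/(rpeval _ _) -/(rpeval _ _); congr mx2; ring.
exists P1, Q1, (g * P2), (g * Q2); split => //.
apply: poly_eq_off_real => z zI.
have zS : ~ (@creal R @` S) z.
  by move=> [x _ xz]; move: zI; rewrite -xz eqxx.
rewrite hornerD hornerN !(hornerM, hornerC) -Q1E // -Q2E //.
rewrite -(Yop_det zS) /rpeval -/P1 -/P2; ring.
Qed.

(** Off the support the matrix is continuous. *)
Lemma Yop_cvg z i j : ~ (@creal R @` S) z ->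
  ((fun w => Yop m n w i j) : R[i]^o -> R[i]^o) @ (z : R[i]^o) --> (Yop m n z i j : R[i]^o).
Proof.
move=> zS; have [mfin mS _] := hm.
have cP (q : {poly R}) : (rpeval q : R[i]^o -> R[i]^o) @ (z : R[i]^o) --> (rpeval q z : R[i]^o).
  exact: horner_cvg.
have cC (q : {poly R}) := ctr_cvg mfin mS (q := q) zS.
have cM (f : R[i] -> R[i]) (l : R[i]) :
    (f : R[i]^o -> R[i]^o) @ (z : R[i]^o) --> (l : R[i]^o) ->
    ((fun w => gammaop m n.-1 * f w) : R[i]^o -> R[i]^o) @ (z : R[i]^o)
      --> (gammaop m n.-1 * l : R[i]^o).
  by move=> fl; apply: (@ccvgM _ (fun=> gammaop m n.-1)); [exact: ccvg_cst|exact: fl].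
have E (w : R[i]) : Yop m n w i j = (mx2 (rpeval (opoly m n) w) (ctr m (opoly m n) w)
      (gammaop m n.-1 * rpeval (opoly m n.-1) w) (gammaop m n.-1 * ctr m (opoly m n.-1) w)) i j.
  by [].
rewrite E; under eq_fun do rewrite E.
rewrite !mxE; under eq_fun do rewrite mxE.
by case: (i == 0); case: (j == 0); [exact: cP|exact: cC|apply: cM; exact: cP|apply: cM; exact: cC].
Qed.

End OneMeasure.

Section TwoMeasures.
Variables (R : realType) (mu nu : {measure set (measurableTypeR R) -> \bar R}).
Variables (Sm Sn : set R) (n : nat).
Hypotheses (n1 : (1 <= n)%N) (hmu : op_measure mu Sm n) (hnu : op_measure nu Sn n).

(** The quotient of the two matrices is, off the supports, the identity plus
    Cauchy transforms with polynomial densities of the difference of the two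
    measures; in particular it tends to the identity at infinity. *)
Lemma Yop_quotient : exists (kappa : 'I_2 -> 'I_2 -> R[i])
    (r : 'I_2 -> 'I_2 -> {poly R}),
  forall z, ~ (@creal R @` Sm) z -> ~ (@creal R @` Sn) z -> forall i j,
  (Yop nu n z *m invmx (Yop mu n z)) i j =
    (i == j)%:R + kappa i j * (ctr mu (r i j) z - ctr nu (r i j) z).
Proof.
have [mfin mS _] := hmu; have [nfin nS _] := hnu.
have [pm sp ort] := op_props hmu; have [pm' sp' ort'] := op_pred_props n1 hmu.
have [qm sq nort] := op_props hnu; have [qm' sq' nort'] := op_pred_props n1 hnu.
have gm := gammaop_norm n1 hmu; have gn := gammaop_norm n1 hnu.
set p := opoly mu n in pm sp ort *; set p' := opoly mu n.-1 in pm' sp' ort' gm *.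
set q := opoly nu n in qm sq nort *; set q' := opoly nu n.-1 in qm' sq' nort' gn *.
set g := gammaop mu n.-1 in gm *; set h := gammaop nu n.-1 in gn *.
exists (fun i j => mx2 g (-1) (h * g) (- h) i j).
exists (fun i j => if i == 0 then if j == 0 then q * p' else q * p
                   else if j == 0 then q' * p' else q' * p).
move=> z zm zn i j; have [_ ->] := Yop_inv n1 hmu zm; rewrite YopE mx2M.
rewrite -/p -/p' -/q -/q' -/g -/h.
have lead_mu : rpeval q z * ctr mu p' z = ctr mu (q * p') z
    - (twopii R)^-1 * creal (mom mu (p' * p')).
  by apply: (ctr_orthogonal_lead mfin mS ort'); rewrite // ?sq ?sp' prednK.
have lead_nu : rpeval p z * ctr nu q' z = ctr nu (p * q') z
    - (twopii R)^-1 * creal (mom nu (q' * q')).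
  by apply: (ctr_orthogonal_lead nfin nS nort'); rewrite // ?sp ?sq' prednK.
have o1 (P : {poly R}) : (size P <= n.+1)%N -> rpeval P z * ctr mu p z = ctr mu (P * p) z.
  by move=> sP; exact: (ctr_orthogonal mfin mS ort).
have o2 (P : {poly R}) : (size P <= n.+1)%N -> rpeval P z * ctr nu q z = ctr nu (P * q) z.
  by move=> sP; exact: (ctr_orthogonal nfin nS nort).
have o3 : rpeval q' z * ctr mu p' z = ctr mu (q' * p') z.
  by apply: (ctr_orthogonal mfin mS ort') => //; rewrite sq' prednK.
have o4 : rpeval p' z * ctr nu q' z = ctr nu (p' * q') z.
  by apply: (ctr_orthogonal nfin nS nort') => //; rewrite sp' prednK.
have o2p' := o2 p' (eq_leq (esym _)).
have sp'n : (size p' <= n.+1)%N by rewrite sp'.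
have sq'n : (size q' <= n.+1)%N by rewrite sq'.
have o2p := o2 p (eq_leq sp); have {}o2p' := o2 p' sp'n.
have o1q := o1 q (eq_leq sq); have o1q' := o1 q' sq'n.
move: i j; apply: ord2P; apply: ord2P; rewrite !mxE /=.
- rewrite (_ : _ + _ = g * (rpeval q z * ctr mu p' z) - g * (rpeval p' z * ctr nu q z)); last by ring.
  rewrite lead_mu o2p' mulrBr gm [p' * q]mulrC; ring.
- rewrite (_ : _ + _ = - (rpeval q z * ctr mu p z) + (rpeval p z * ctr nu q z)); last by ring.
  rewrite o1q o2p [p * q]mulrC; ring.
- rewrite (_ : _ + _ = h * g * (rpeval q' z * ctr mu p' z - rpeval p' z * ctr nu q' z)); last by ring.
  rewrite o3 o4 [p' * q']mulrC; ring.
- rewrite (_ : _ + _ = - h * (rpeval q' z * ctr mu p z) + h * (rpeval p z * ctr nu q' z)); last by ring.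
  rewrite o1q' lead_nu mulrBr gn [p * q']mulrC; ring.
Qed.

End TwoMeasures.

(** * Cauchy integrals along the curve *)

(** Fubini's theorem for bounded functions on a rectangle of finite measure. *)
Lemma Rintegral_swap (R : realType) d1 d2 (T1 : measurableType d1)
    (T2 : measurableType d2) (m1 : {sigma_finite_measure set T1 -> \bar R})
    (m2 : {sigma_finite_measure set T2 -> \bar R}) (D1 : set T1) (D2 : set T2)
    (F : T1 * T2 -> R) (M : R) :
  measurable D1 -> measurable D2 -> (m1 D1 < +oo)%E -> (m2 D2 < +oo)%E ->
  measurable_fun (D1 `*` D2) F ->
  (forall u, (D1 `*` D2) u -> `|F u| <= M) ->
  \int[m1]_(x in D1) \int[m2]_(y in D2) F (x, y) =
  \int[m2]_(y in D2) \int[m1]_(x in D1) F (x, y).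
Proof.
move=> mD1 mD2 fD1 fD2 mF FM.
have mD : measurable (D1 `*` D2) by exact: measurableX.
have fD : ((m1 \x m2)%E (D1 `*` D2) < +oo)%E.
  by rewrite product_measure1E //= lte_mul_pinfty // ge0_fin_numE.
pose F' := F \_ (D1 `*` D2).
have mF' : measurable_fun setT F'.
  by apply/measurable_restrict => //; rewrite setTI.
have bF' u : `|F' u| <= `|M|.
  rewrite /F' patchE; case: ifPn => [/set_mem /FM h|_]; last by rewrite normr0.
  exact: le_trans h (ler_norm _).
have iF' : (m1 \x m2)%E.-integrable setT (EFin \o F').
  rewrite /F' -restrict_EFin; apply/integrable_restrict => //.
  rewrite setTI; apply: (bounded_integrable mD fD (M := M)) => //.
have in1 (x : T1) : D1 x -> (\int[m2]_y (F' (x, y))%:E)%E = (\int[m2]_(y in D2) F (x, y))%:E.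
  move=> xD; have iF2 : m2.-integrable D2 (EFin \o (fun y => F' (x, y))).
    apply: (bounded_integrable mD2 fD2 (M := `|M|)) => //.
    apply: (measurable_funS measurableT (@subsetT _ _)).
    exact: measurableT_comp mF' (pair1_measurable x).
  have E : (\int[m2]_y (F' (x, y))%:E = \int[m2]_(y in D2) (F' (x, y))%:E)%E.
    rewrite [RHS]integral_mkcond; apply: eq_integral => y _; rewrite patchE.
    case: ifPn => // yD; rewrite /F' patchE memNset // => -[_ /= yD'].
    by move: yD; rewrite mem_set.
  rewrite E -(fineK (integrable_fin_num mD2 iF2)); congr (_%:E).
  by apply: eq_Rintegral => y /set_mem yD; rewrite /F' patchE mem_set.
have in2 (y : T2) : D2 y -> (\int[m1]_x (F' (x, y))%:E)%E = (\int[m1]_(x in D1) F (x, y))%:E.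
  move=> yD; have iF1 : m1.-integrable D1 (EFin \o (fun x => F' (x, y))).
    apply: (bounded_integrable mD1 fD1 (M := `|M|)) => //.
    apply: (measurable_funS measurableT (@subsetT _ _)).
    exact: measurableT_comp mF' (pair2_measurable y).
  have E : (\int[m1]_x (F' (x, y))%:E = \int[m1]_(x in D1) (F' (x, y))%:E)%E.
    rewrite [RHS]integral_mkcond; apply: eq_integral => x _; rewrite patchE.
    case: ifPn => // xD; rewrite /F' patchE memNset // => -[/= xD' _].
    by move: xD; rewrite mem_set.
  rewrite E -(fineK (integrable_fin_num mD1 iF1)); congr (_%:E).
  by apply: eq_Rintegral => x /set_mem xD; rewrite /F' patchE mem_set.
have out1 (x : T1) : ~ D1 x -> (\int[m2]_y (F' (x, y))%:E)%E = 0%E.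
  move=> xD; rewrite integral0_eq // => y _.
  by rewrite /F' patchE memNset // => -[].
have out2 (y : T2) : ~ D2 y -> (\int[m1]_x (F' (x, y))%:E)%E = 0%E.
  move=> yD; rewrite integral0_eq // => x _.
  by rewrite /F' patchE memNset // => -[].
have := Fubini iF'; rewrite /Rintegral => fub.
have -> : (\int[m1]_(x in D1) (fine (\int[m2]_(y in D2) (F (x, y))%:E))%:E)%E =
    (\int[m1]_x \int[m2]_y (EFin \o F') (x, y))%E.
  rewrite integral_mkcond; apply: eq_integral => x _; rewrite patchE.
  by case: ifPn => [/set_mem /in1 -> //|/negP xD]; rewrite out1 // => /mem_set.
rewrite fub; congr fine.
rewrite [RHS]integral_mkcond; apply: eq_integral => y _; rewrite patchE.
by case: ifPn => [/set_mem /in2 -> //|/negP yD]; rewrite out2 // => /mem_set.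
Qed.

(** The same for complex functions of two real variables. *)
Lemma cintegral_swap (R : realType)
    (m1 m2 : {sigma_finite_measure set (measurableTypeR R) -> \bar R})
    (D1 D2 : set (measurableTypeR R)) (f : R -> R -> R[i]) :
  measurable D1 -> measurable D2 -> (m1 D1 < +oo)%E -> (m2 D2 < +oo)%E ->
  bmfun (D1 `*` D2 : set (measurableTypeR R * measurableTypeR R)%type)
    (fun u => f u.1 u.2) ->
  cintegral m1 D1 (fun x => cintegral m2 D2 (fun y => f x y)) =
  cintegral m2 D2 (fun y => cintegral m1 D1 (fun x => f x y)).
Proof.
move=> mD1 mD2 f1 f2 [mr mi [M fM]]; apply: complexP => /=.
  apply: (@Rintegral_swap _ _ _ _ _ m1 m2 D1 D2 (fun u => complex.Re (f u.1 u.2)) M) => //.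
  by move=> u /fM; exact: le_trans (ler_Re_cabs _).
apply: (@Rintegral_swap _ _ _ _ _ m1 m2 D1 D2 (fun u => complex.Im (f u.1 u.2)) M) => //.
by move=> u /fM; exact: le_trans (ler_Im_cabs _).
Qed.

Section CauchyCurve.
Variables (R : realType) (G : R -> R[i]).
Hypotheses (ps : piecewise_smooth G) (sc : simple_closed G).
Hypothesis ccw : counterclockwise G.
Notation mu := (@lebesgue_measure R).
Notation I01 := (`[0%R, 1%R]%classic : set (measurableTypeR R)).
Notation cint f := (cintegral mu `[0%R, 1%R]%classic f).

Let mI : measurable I01. Proof. exact: measurable_itv. Qed.
Let fin : (mu I01 < +oo)%E. Proof. exact: lebesgue_itvcc_fin. Qed.
Let closedG : G 0 = G 1. Proof. by case: sc. Qed.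

Lemma trace_neq z t : ~ trace G z -> 0 <= t <= 1 -> G t - z != 0.
Proof.
move=> zG t01; apply/eqP => /eqP; rewrite subr_eq0 => /eqP Gt.
by apply: zG; rewrite -Gt; exact: trace_in.
Qed.

Lemma winding_inside z : inside G z -> winding G z = 1.
Proof. exact: ccw. Qed.

(** The Cauchy transform along the curve of a simple fraction with its pole
    inside. *)
Lemma cauchy_fraction x z : inside G x -> ~ trace G z ->
  (twopii R)^-1 * cint (fun t => (x - G t)^-1 * (G t - z)^-1 * velocity G t) =
  (winding G z - 1) / (x - z).
Proof.
move=> xin zG; have [xG _] := xin.
have [->|xz] := eqVneq x z.
  rewrite subrr invr0 mulr0.
  rewrite (eq_cintegral _ (h := fun t => (-1) * ((G t - z)^-1 ^+ 2 * velocity G t))).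
    rewrite cintegralZ //; first by rewrite curve_int_inv2 // !mulr0.
    apply: (bmfun_curve ps); apply: ccontX; exact: curve_inv_ccont.
  move=> t /=; rewrite in_itv /= => /(trace_neq zG) Gt.
  by rewrite -(opprB (G t)) invrN; ring.
rewrite -(winding_inside xin) !windingE -mulrBr -[in RHS]mulrA; congr (_ * _).
have bx := bmfun_curve ps (curve_inv_ccont ps xG).
have bz := bmfun_curve ps (curve_inv_ccont ps zG).
rewrite -(cintegralB mI fin bz bx) mulrC -(cintegralZ mI fin _ (bmfunB bz bx)).
apply: eq_cintegral => t /=; rewrite in_itv /= => t01.
have h1 := trace_neq zG t01; have h2 := trace_neq xG t01.
have h3 : x - z != 0 by rewrite subr_eq0.
have h4 : x - G t != 0 by rewrite -opprB oppr_eq0.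
by field; rewrite h1 h2 h3 h4.
Qed.

Lemma cauchyE (U : R[i] -> R[i]) z : cauchy_transform G U z =
  (twopii R)^-1 * cint (fun t => U (G t) * ((G t - z)^-1 * velocity G t)).
Proof. by congr (_ * _); apply: eq_cintegral => t _; rewrite mulrA. Qed.

(** Cauchy's formula for polynomials. *)
Lemma cauchy_horner (P : {poly R[i]}) z : ~ trace G z ->
  cauchy_transform G (horner P) z = P.[z] * winding G z.
Proof.
move=> zG.
have cG := curve_ccont ps.
have cP (Q : {poly R[i]}) : ccont 0 1 (fun t => Q.[G t]).
  elim/poly_ind: Q => [|Q c IH].
    by under eq_fun do rewrite horner0; exact: ccont_cst.
  under eq_fun do rewrite hornerMXaddC.
  by apply: ccontD; [exact: ccontM IH cG|exact: ccont_cst].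
have int0 (Q : {poly R[i]}) : cint (fun t => Q.[G t] * velocity G t) = 0.
  under [X in cintegral _ _ X]eq_fun do rewrite horner_coef mulr_suml.
  rewrite cintegral_sum //.
    apply: big1 => i _.
    rewrite (eq_cintegral _ (h := fun t => Q`_i * (G t ^+ i * velocity G t))).
      by rewrite (cintegralZ mI fin _ (bmfun_curve ps (ccontX (n := i) cG))) curve_int_pow // mulr0.
    by move=> t _; rewrite mulrA.
  move=> i.
  exact: (bmfun_curve ps (ccontM (@ccont_cst R 0 1 Q`_i) (ccontX (n := i) cG))).
rewrite cauchyE windingE.
elim/poly_ind: P => [|P c IH].
  rewrite horner0 mul0r (eq_cintegral _ (h := fun t => 0 * velocity G t)).
    by rewrite (cintegralZ mI fin 0 (bmfun_velocity ps)) mul0r mulr0.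
  by move=> t _; rewrite horner0 !mul0r.
have bz := bmfun_curve ps (curve_inv_ccont ps zG).
have bP := bmfun_curve ps (cP P).
have bPz : bmfun I01 (fun t => P.[G t] * ((G t - z)^-1 * velocity G t)).
  by apply: bmfunM => //; exact: ccont_bmfun (cP P).
rewrite (eq_cintegral _ (h := fun t => P.[G t] * velocity G t +
  (z * (P.[G t] * ((G t - z)^-1 * velocity G t)) +
   c * ((G t - z)^-1 * velocity G t)))).
  rewrite cintegralD //; last by apply: bmfunD; exact: bmfunZ.
  rewrite cintegralD //; [|exact: bmfunZ..].
  rewrite !cintegralZ // int0 add0r mulrDr mulrCA IH hornerMXaddC; ring.
move=> t /=; rewrite in_itv /= => /(trace_neq zG) Gt.
by rewrite hornerMXaddC; field.
Qed.

Section Density.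
Variables (m : {finite_measure set (measurableTypeR R) -> \bar R}) (S : set R).
Hypothesis mS : compactly_carried m S.
Hypothesis Sin : forall x, S x -> inside G (creal x).

Let mSm : measurable (S : set (measurableTypeR R)).
Proof. exact: carried_measurable mS. Qed.

Lemma finite_measure_setT : (m setT < +oo)%E.
Proof. by rewrite -ge0_fin_numE // fin_num_measure. Qed.

Let Sfin : (m S < +oo)%E. Proof. exact: carried_fin finite_measure_setT mS. Qed.

Lemma trace_off t : 0 <= t <= 1 -> ~ (@creal R @` S) (G t).
Proof.
by move=> t01 [x /Sin[nt _] xG]; apply: nt; rewrite xG; exact: trace_in.
Qed.

(** The curve stays at a positive distance of the support. *)
Lemma support_gap : exists2 e : R, 0 < e &
  forall t x, 0 <= t <= 1 -> S x -> e <= cabs (creal x - G t).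
Proof.
have [S0|/set0P S0] := eqVneq S set0.
  by exists 1 => // t x _; rewrite S0.
have [clS [M SM] _] := mS.
have cS : compact S.
  apply: (subclosed_compact clS (@segment_compact R (- M) M)) => x /SM.
  by rewrite ler_norml /= in_itv.
have cA := compact_setX cS (@segment_compact R 0 1).
have A0 : (S `*` `[0, 1 : R]%classic) !=set0.
  by have [x xS] := S0; exists (x, 0); split => //=; rewrite in_itv /= lexx ler01.
have cf : {within S `*` `[0, 1 : R]%classic, continuous
    (fun u : R * R => cabs (creal u.1 - G u.2))}.
  apply/subspace_continuousP => -[x t] [/= xS t01].
  apply/cvgrPdist_lt => e e0 /=.
  have e20 : 0 < e / 2 by rewrite divr_gt0.
  have /ccontP/(_ t t01)/cvg_cabsP/(_ _ e20) := curve_ccont ps.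
  rewrite near_withinE => hG.
  exists (ball x (e / 2), [set u | u \in `[0, 1] -> cabs (G u - G t) < e / 2]).
    by split => //=; exact: nbhsx_ballx.
  move=> [y u] /= [xy hu] [/= yS u01].
  have h1 := hu u01; move: xy; rewrite /ball /= => h2.
  have h3 : cabs ((creal x - G t) - (creal y - G u)) < e.
    have -> : (creal x - G t) - (creal y - G u) = creal (x - y) + (G u - G t).
      by rewrite crealB; ring.
    by rewrite (le_lt_trans (cabsD _ _)) // cabs_creal [ltRHS]splitr ltrD.
  apply: le_lt_trans h3; rewrite ler_norml cabsBB andbT lerNl opprB.
  by rewrite [leRHS]cabsBC cabsBB.
have [[x0 t0]] := compact_EVT_min A0 cA cf.
rewrite inE => -[/= x0S t0I] hmin.
exists (cabs (creal x0 - G t0)).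
  rewrite cabs_gt0 subr_eq0; apply/eqP => E.
  by apply: (trace_off t0I); exists x0.
by move=> t x t01 xS; apply: (hmin (x, t)); rewrite inE; split.
Qed.

(** The Cauchy transform along the curve of the Cauchy transform of a measure
    supported inside the curve. *)
Lemma cauchy_ctr (q : {poly R}) z : ~ trace G z ->
  cauchy_transform G (ctr m q) z =
  (twopii R)^-1 *
    cintegral m S (fun x => creal q.[x] * ((winding G z - 1) / (creal x - z))).
Proof.
move=> zG; have [e e0 gap] := support_gap; have mfin := finite_measure_setT.
rewrite cauchyE; congr (_ * _).
pose H (t x : R) := creal q.[x] *
  ((twopii R)^-1 * ((creal x - G t)^-1 * (G t - z)^-1 * velocity G t)).
have HE t : 0 <= t <= 1 ->
    ctr m q (G t) * ((G t - z)^-1 * velocity G t) = cintegral m S (H t).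
  move=> t01; have off := trace_off t01; have bc := ctr_bmfun mS q off.
  rewrite (ctrE mS) mulrAC -cintegralZ //; apply: eq_cintegral => x _.
  by rewrite /H; ring.
rewrite (eq_cintegral _ (h := fun t => cintegral m S (H t))); last first.
  by move=> t /=; rewrite in_itv /= => /HE.
have bv := bmfun_velocity ps.
have mD : measurable (I01 `*` (S : set (measurableTypeR R))) by exact: measurableX.
have mfst : measurable_fun (I01 `*` (S : set (measurableTypeR R))) fst.
  by apply: (measurable_funS measurableT (@subsetT _ _)).
have msnd : measurable_fun (I01 `*` (S : set (measurableTypeR R))) snd.
  by apply: (measurable_funS measurableT (@subsetT _ _)).
have b1 f : bmfun I01 f -> bmfun (I01 `*` (S : set (measurableTypeR R))) (fun u => f u.1).
  by move=> bf; apply: (bmfun_comp mI mfst _ bf) => u [].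
have b2 f : bmfun (S : set (measurableTypeR R)) f ->
    bmfun (I01 `*` (S : set (measurableTypeR R))) (fun u => f u.2).
  by move=> bf; apply: (bmfun_comp mSm msnd _ bf) => u [].
have bX : bmfun (S : set (measurableTypeR R)) (fun x => creal x).
  by have := poly_bmfun mS 'X; apply: eq_bmfun => x _; rewrite hornerX.
have bH : bmfun (I01 `*` (S : set (measurableTypeR R))) (fun u => H u.1 u.2).
  apply: bmfunM; first exact: b2 (poly_bmfun mS q).
  apply: bmfunZ; apply: bmfunM; last exact: b1 bv.
  apply: bmfunM; last exact: b1 (ccont_bmfun (curve_inv_ccont ps zG)).
  apply: (@bmfunV _ _ _ _ (fun u => creal u.2 - G u.1) e e0).
    by move=> [t x] [/= t01 xS]; exact: gap.
  by apply: bmfunB; [exact: b2 bX|exact: b1 (ccont_bmfun (curve_ccont ps))].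
rewrite (@cintegral_swap _ mu m _ _ H mI mSm fin Sfin bH).
apply: eq_cintegral => x xS; have xin := Sin xS; have [xG _] := xin.
have bk : bmfun I01 (fun t => (creal x - G t)^-1 * (G t - z)^-1 * velocity G t).
  apply: (bmfun_curve ps); apply: ccontM; last exact: curve_inv_ccont.
  apply: ccontV; first by move=> t t01; rewrite -opprB oppr_eq0 trace_neq.
  exact: ccontB (@ccont_cst R 0 1 _) (curve_ccont ps).
rewrite /H cintegralZ ?cintegralZ ?cauchy_fraction //; exact: bmfunZ.
Qed.

Lemma cauchy_ctr_inside (q : {poly R}) z : inside G z ->
  cauchy_transform G (ctr m q) z = 0.
Proof.
move=> zin; have [zG _] := zin; rewrite cauchy_ctr // winding_inside // subrr.
rewrite (eq_cintegral _ (h := fun x => 0 * creal q.[x])).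
  by rewrite (cintegralZ mSm Sfin 0 (poly_bmfun mS q)) mul0r mulr0.
by move=> x _; rewrite !mul0r mulr0.
Qed.

Lemma cauchy_ctr_outside (q : {poly R}) z : outside G z ->
  cauchy_transform G (ctr m q) z = - ctr m q z.
Proof.
move=> zout; have [zG nb] := zout.
have zS : ~ (@creal R @` S) z.
  by move=> [x /Sin[_ +] xz]; rewrite xz.
rewrite cauchy_ctr // (winding_outside ps closedG zout) sub0r.
rewrite (ctrE mS) -mulrN; congr (_ * _).
rewrite -(cintegralN mSm Sfin (ctr_bmfun mS q zS)).
by apply: eq_cintegral => x _; rewrite mulN1r mulrN.
Qed.

End Density.

End CauchyCurve.

(** * The jump relation *)

(** [clim] is the limit of a convergent function along a proper filter. *)
Lemma clim_eq (R : realType) (F : set_system R[i]^o) (PF : ProperFilter F)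
    (f : R[i] -> R[i]) (l : R[i]) :
  (forall e : R, 0 < e -> \forall w \near F, cabs (f w - l) < e) -> clim F f = l.
Proof.
move=> fl; apply: (@cvg_lim _ (@norm_hausdorff _ R[i]^o)).
by apply/cvg_cabsP.
Qed.

Lemma nt_exterior_filter (R : realType) (G : R -> R[i]) (s : R[i]) :
  Filter (nt_exterior G s).
Proof.
split.
- by move=> c; exact: filterT.
- by move=> A B hA hB c; apply: filterI; [exact: hA|exact: hB].
- by move=> A B AB hA c; apply: filterS (hA c).
Qed.

(** Non-tangential limits from the exterior make sense at the smooth points
    of the curve. *)
Lemma nt_exterior_proper (R : realType) (G : R -> R[i]) (t : R) :
  piecewise_smooth G -> simple_closed G -> counterclockwise G ->
  smooth_at G t -> ProperFilter (nt_exterior G (G t)).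
Proof.
move=> ps sc ccw sm; apply: Build_ProperFilter; last exact: nt_exterior_filter.
move=> /(_ 2); rewrite /within /= => /nbhs_cabsP[r r0 hr].
have [z [zo zr zd]] := exterior_approach ps sc ccw sm r0.
apply: (hr z zr); split => // u; rewrite in_itv /=; exact: zd.
Qed.

(** A subset of the real line has empty interior in the plane. *)
Lemma within_proper (R : realType) (S : set R) (z : R[i]) :
  ProperFilter (within (~` (@creal R @` S : set R[i]^o)) (nbhs (z : R[i]^o))).
Proof.
apply: Build_ProperFilter; rewrite /within /= => /nbhs_cabsP[r r0 hr].
pose w (x : R) : R[i] := z + Complex 0 x.
have wz x : cabs (w x - z) = `|x|.
  by rewrite /w addrC addKr cabsE /= expr0n add0r sqrtr_sqr.
have [Im0|Im0] := eqVneq (complex.Im z) 0.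
  apply: (hr (w (r / 2))).
    by rewrite wz ger0_norm ?divr_ge0 ?(ltW r0) // ltr_pdivrMr // ltr_pMr // ltr1n.
  move=> [x _ /(congr1 (@complex.Im R))]; rewrite /w ImD Im0 /= add0r => /esym/eqP.
  by rewrite gt_eqF // divr_gt0.
apply: (hr z); first by rewrite subrr cabs0.
by move=> [x _ xz]; move: Im0; rewrite -xz eqxx.
Qed.

(** Inside the curve the matrix is polynomial, with determinant 1; at the points
    of the support this holds because polynomials are continuous. *)
Lemma Ytilde_inside (R : realType) (G : R -> R[i])
    (m : {measure set (measurableTypeR R) -> \bar R}) (n : nat) :
  (1 <= n)%N -> op_measure m (msupp m) n ->
  exists p11 p12 p21 p22 : {poly R[i]},
  [/\ forall z, ~ (@creal R @` msupp m) z ->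
    Yop m n z *m mx2 1 (- cauchyop m 0 z) 0 1 =
    mx2 p11.[z] p12.[z] p21.[z] p22.[z],
   forall z, inside G z -> Ytilde G m n z = mx2 p11.[z] p12.[z] p21.[z] p22.[z] &
   p11 * p22 - p12 * p21 = 1].
Proof.
move=> n1 hm; have [p11 [p12 [p21 [p22 [E det]]]]] := Yop_inside n1 hm.
exists p11, p12, p21, p22; split => // z zin.
rewrite /Ytilde asboolT //; case: ifPn => [/asboolP zS|/asboolPn zS]; last exact: E.
pose P (i j : 'I_2) : {poly R[i]} := if i == 0 then (if j == 0 then p11 else p12)
  else (if j == 0 then p21 else p22).
have PE w i j : mx2 p11.[w] p12.[w] p21.[w] p22.[w] i j = (P i j).[w].
  by rewrite mxE /P; case: (i == 0); case: (j == 0).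
apply/matrixP => i j; rewrite PE mxE; apply: clim_eq; first exact: within_proper.
move=> e e0; rewrite near_withinE.
have /cvg_nbhs_cabsP/(_ e e0)[d d0 dP] := @horner_cvg R (P i j) z.
apply/nbhs_cabsP; exists d => // w wd wS; rewrite E // PE; exact: dP.
Qed.

Lemma Ytilde_not_inside (R : realType) (G : R -> R[i])
    (m : {measure set (measurableTypeR R) -> \bar R}) (n : nat) z :
  ~ inside G z -> Ytilde G m n z = Yop m n z.
Proof. by move=> zin; rewrite /Ytilde asboolF. Qed.

Lemma mulmx_conj_cancel (K : pzRingType) k (E Ei A Ai C N : 'M[K]_k) :
  Ei *m E = 1%:M -> Ai *m A = 1%:M ->
  E *m (C *m Ai) *m Ei *m (E *m (A *m N *m Ai) *m Ei) =
  E *m (C *m N *m Ai) *m Ei.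
Proof.
move=> EiE AiA; rewrite !mulmxA -(mulmxA _ Ei E) EiE mulmx1.
by rewrite -(mulmxA _ Ai A) AiA mulmx1.
Qed.

Section Linear.
Variables (R : realType) (G : R -> R[i]).
Hypothesis ps : piecewise_smooth G.
Notation mu := (@lebesgue_measure R).
Notation I01 := (`[0%R, 1%R]%classic : set (measurableTypeR R)).

Let mI : measurable I01. Proof. exact: measurable_itv. Qed.
Let fin : (mu I01 < +oo)%E. Proof. exact: lebesgue_itvcc_fin. Qed.

Lemma bmfun_cauchy (U : R[i] -> R[i]) z : ~ trace G z ->
  bmfun I01 (fun t => U (G t)) ->
  bmfun I01 (fun t => U (G t) * ((G t - z)^-1 * velocity G t)).
Proof.
move=> zG bU; apply: bmfunM => //.
exact: (bmfun_curve ps (curve_inv_ccont ps zG)).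
Qed.

Lemma eq_cauchy (U V : R[i] -> R[i]) z :
  (forall t, 0 <= t <= 1 -> U (G t) = V (G t)) ->
  cauchy_transform G U z = cauchy_transform G V z.
Proof.
move=> UV; congr (_ * _); apply: eq_cintegral => t /=; rewrite in_itv /= => t01.
by rewrite UV.
Qed.

Lemma cauchyD (U V : R[i] -> R[i]) z : ~ trace G z ->
  bmfun I01 (fun t => U (G t)) -> bmfun I01 (fun t => V (G t)) ->
  cauchy_transform G (fun s => U s + V s) z =
  cauchy_transform G U z + cauchy_transform G V z.
Proof.
move=> zG bU bV; rewrite !cauchyE -mulrDr; congr (_ * _).
rewrite -(cintegralD mI fin (bmfun_cauchy zG bU) (bmfun_cauchy zG bV)).
by apply: eq_cintegral => t _; rewrite mulrDl.
Qed.

Lemma cauchyZ (c : R[i]) (U : R[i] -> R[i]) z : ~ trace G z ->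
  bmfun I01 (fun t => U (G t)) ->
  cauchy_transform G (fun s => c * U s) z = c * cauchy_transform G U z.
Proof.
move=> zG bU; rewrite !cauchyE mulrCA; congr (_ * _).
rewrite -(cintegralZ mI fin _ (bmfun_cauchy zG bU)).
by apply: eq_cintegral => t _; rewrite mulrA.
Qed.

End Linear.

Section RHP.
Variables (R : realType) (G : R -> R[i]).
Hypotheses (ps : piecewise_smooth G) (sc : simple_closed G).
Hypothesis ccw : counterclockwise G.
Variables (cc : R[i]) (p n : nat).
Hypotheses (cc0 : cc != 0) (n1 : (1 <= n)%N).
Variables mu nu : {finite_measure set (measurableTypeR R) -> \bar R}.
Hypotheses (hmu : op_measure mu (msupp mu) n) (hnu : op_measure nu (msupp nu) n).
Hypothesis muin : forall x, msupp mu x -> inside G (creal x).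
Hypothesis nuin : forall x, msupp nu x -> inside G (creal x).
Notation I01 := (`[0%R, 1%R]%classic : set (measurableTypeR R)).

Let closedG : G 0 = G 1. Proof. by case: sc. Qed.

Let e : int := n%:Z - p%:Z.
(* E is the constant factor of [Ycheck], and Ei its inverse. *)
Let E := mx2 (cc ^ e) 0 0 (cc ^ (- e)).
Let Ei := mx2 (cc ^ (- e)) 0 0 (cc ^ e).

Let Ecoef (i j : 'I_2) : R[i] := E i i * Ei j j.

Lemma conj_entry (A : 'M[R[i]]_2) i j : (E *m A *m Ei) i j = Ecoef i j * A i j.
Proof.
rewrite /Ecoef; move: i j; apply: ord2P; apply: ord2P;
by rewrite (mx2_eta A) /E /Ei !mx2M !mxE /=; ring.
Qed.

Lemma Ecoef_id i : Ecoef i i = 1.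
Proof.
have h : cc ^ e * cc ^ (- e) = 1 by rewrite -expfzDr // subrr expr0z.
by rewrite /Ecoef; move: i; apply: ord2P; rewrite !mxE /= // mulrC.
Qed.

Lemma EEi : E *m Ei = 1%:M.
Proof.
apply/matrixP => i j; rewrite -[E]mulmx1 conj_entry !mxE.
by have [->|ij] := eqVneq i j; rewrite ?Ecoef_id ?mulr1 ?mulr0.
Qed.

Lemma invmx_E (A : 'M[R[i]]_2) : A \in unitmx -> invmx (E *m A) = invmx A *m Ei.
Proof.
move=> Au; apply: (proj2 (invmx_right _)).
by rewrite mulmxA mulmxK // EEi.
Qed.

Lemma mu_off z : ~ inside G z -> ~ (@creal R @` msupp mu) z.
Proof. by move=> zin [x /muin xin xz]; apply: zin; rewrite -xz. Qed.

Lemma nu_off z : ~ inside G z -> ~ (@creal R @` msupp nu) z.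
Proof. by move=> zin [x /nuin xin xz]; apply: zin; rewrite -xz. Qed.

Lemma Ycheck_E m z : Ycheck G cc p m n z = E *m Ytilde G m n z.
Proof. by []. Qed.

(** The boundary values of X from the exterior, given on the curve by the formula
    that defines X outside. *)
Definition Xbd (s : R[i]) : 'M[R[i]]_2 :=
  E *m (Yop nu n s *m invmx (Yop mu n s)) *m Ei.
(** The matrix M, with the value of the continuous matrix [Yop] in place of its
    non-tangential limit. *)
Definition Mbd (s : R[i]) : 'M[R[i]]_2 :=
  E *m (Yop mu n s *m mx2 0 1 0 0 *m invmx (Yop mu n s)) *m Ei.
(** The matrix J - 1, in the same sense. *)
Definition Jbd (s : R[i]) : 'M[R[i]]_2 := c0diff mu nu s *: Mbd s.

Lemma Xmat_not_inside z : ~ inside G z -> Xmat G cc p mu nu n z = Xbd z.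
Proof.
move=> zin; rewrite /Xmat !Ycheck_E !Ytilde_not_inside //.
have [Yu _] := Yop_inv n1 hmu (mu_off zin).
by rewrite invmx_E // /Xbd !mulmxA.
Qed.

(** Inside the curve X is polynomial, and on the curve it takes the values
    X_- + X_- (J - 1). *)
Lemma Xmat_inside : exists Q : 'I_2 -> 'I_2 -> {poly R[i]},
  (forall z, inside G z -> forall i j, Xmat G cc p mu nu n z i j = (Q i j).[z]) /\
  (forall s, ~ inside G s -> forall i j,
     (Q i j).[s] = Xbd s i j + (Xbd s *m Jbd s) i j).
Proof.
have [a [b [c [d [Emu Imu det_mu]]]]] := Ytilde_inside G n1 hmu.
have [a' [b' [c' [d' [Enu Inu _]]]]] := Ytilde_inside G n1 hnu.
pose Q (i j : 'I_2) : {poly R[i]} := (Ecoef i j)%:P *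
  (if i == 0 then if j == 0 then a' * d - b' * c else b' * a - a' * b
   else if j == 0 then c' * d - d' * c else d' * a - c' * b).
have detz z : a.[z] * d.[z] - b.[z] * c.[z] = 1.
  by rewrite -!hornerM -hornerN -hornerD det_mu hornerC.
have QE z i j : (Q i j).[z] = (E *m (mx2 a'.[z] b'.[z] c'.[z] d'.[z] *m
     invmx (mx2 a.[z] b.[z] c.[z] d.[z])) *m Ei) i j.
  rewrite conj_entry /Q hornerM hornerC; congr (_ * _).
  have [_ ->] := mx2_inv (detz z); rewrite mx2M mxE.
  by case: (i == 0); case: (j == 0); rewrite hornerD hornerN !hornerM; ring.
exists Q; split => [z zin i j|s sin i j].
  rewrite QE /Xmat !Ycheck_E Imu // Inu //.
  have [Yu _] := mx2_inv (detz z).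
  by rewrite invmx_E // !mulmxA.
rewrite QE -Emu; last exact: mu_off.
rewrite -Enu; last exact: nu_off.
have [Yu Yi] := Yop_inv n1 hmu (mu_off sin).
set Ym := Yop mu n s in Yu *; set Yn := Yop nu n s.
have tri (x : R[i]) : mx2 1 (- x) 0 1 *m mx2 1 x 0 1 = 1%:M.
  by rewrite mx2M -mx2_1; congr mx2; ring.
(* the triangular factors of the two matrices combine into J *)
have -> : invmx (Ym *m mx2 1 (- cauchyop mu 0 s) 0 1) =
    mx2 1 (cauchyop mu 0 s) 0 1 *m invmx Ym.
  apply: (proj2 (invmx_right _)).
  by rewrite mulmxA -[_ *m _ *m mx2 1 (cauchyop mu 0 s) 0 1]mulmxA tri mulmx1 mulmxV.
have XJ : Xbd s *m Jbd s =
    E *m (Yn *m (c0diff mu nu s *: mx2 0 1 0 0) *m invmx Ym) *m Ei.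
  rewrite /Jbd /Xbd /Mbd -/Ym -/Yn -!scalemxAr -!scalemxAl -!scalemxAr -!scalemxAl; congr (_ *: _).
  have EiE : Ei *m E = 1%:M by exact: mulmx1C EEi.
  exact: mulmx_conj_cancel EiE (mulVmx Yu).
rewrite XJ [RHS](_ : _ = (E *m (Yn *m mx2 1 (c0diff mu nu s) 0 1 *m invmx Ym) *m Ei) i j).
  congr (fun_of_matrix (E *m _ *m Ei) i j).
  rewrite !mulmxA; congr (_ *m _); rewrite -mulmxA; congr (_ *m _).
  by rewrite mx2M /c0diff; congr mx2; ring.
have -> : mx2 1 (c0diff mu nu s) 0 1 = 1%:M + c0diff mu nu s *: mx2 0 1 0 0.
  rewrite -mx2_1; apply/matrixP; apply: ord2P; apply: ord2P; rewrite !mxE /=; ring.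
have -> : E *m (Yn *m (1%:M + c0diff mu nu s *: mx2 0 1 0 0) *m invmx Ym) *m Ei =
    Xbd s + E *m (Yn *m (c0diff mu nu s *: mx2 0 1 0 0) *m invmx Ym) *m Ei.
  by rewrite /Xbd mulmxDr mulmx1 mulmxDl mulmxDr mulmxDl.
by rewrite [RHS]mxE.
Qed.

End RHP.

(** * Boundary values and the Cauchy formula for X *)

Lemma eq_ccont (R : realType) (a b : R) (f h : R -> R[i]) :
  (forall t, a <= t <= b -> f t = h t) -> ccont a b f -> ccont a b h.
Proof.
move=> fh /ccontP cf; apply/ccontP => t tab; rewrite -(fh t tab).
apply: cvg_trans (cf t tab); apply: near_eq_cvg; rewrite near_withinE.
by apply: nearW => u /=; rewrite in_itv /= => /fh.
Qed.

Lemma ccont_comp (R : realType) (G : R -> R[i]) (f : R[i] -> R[i]) :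
  ccont 0 1 G ->
  (forall t, 0 <= t <= 1 ->
    (f : R[i]^o -> R[i]^o) @ (G t : R[i]^o) --> (f (G t) : R[i]^o)) ->
  ccont 0 1 (fun t => f (G t)).
Proof.
move=> /ccontP cG cf; apply/ccontP => t t01; apply/cvg_cabsP => e e0.
have /cvg_nbhs_cabsP/(_ e e0)[d d0 hd] := cf t t01.
have /cvg_cabsP/(_ d d0) := cG t t01.
by apply: filterS => u; exact: hd.
Qed.

Lemma nt_exterior_near (R : realType) (G : R -> R[i]) (s : R[i]) (P : R[i] -> Prop) (d : R) :
  0 < d -> (forall w, outside G w -> cabs (w - s) < d -> P w) ->
  \forall w \near nt_exterior G s, P w.
Proof.
move=> d0 hP c; rewrite /within /=; apply/nbhs_cabsP; exists d => // w wd [wo _].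
exact: hP.
Qed.

Section RHP2.
Variables (R : realType) (G : R -> R[i]).
Hypotheses (ps : piecewise_smooth G) (sc : simple_closed G).
Hypothesis ccw : counterclockwise G.
Variables (cc : R[i]) (p n : nat).
Hypotheses (cc0 : cc != 0) (n1 : (1 <= n)%N).
Variables mu nu : {finite_measure set (measurableTypeR R) -> \bar R}.
Hypotheses (hmu : op_measure mu (msupp mu) n) (hnu : op_measure nu (msupp nu) n).
Hypothesis muin : forall x, msupp mu x -> inside G (creal x).
Hypothesis nuin : forall x, msupp nu x -> inside G (creal x).
Notation I01 := (`[0%R, 1%R]%classic : set (measurableTypeR R)).
Notation Xb := (Xbd cc p n mu nu).
Notation Mb := (Mbd cc p n mu).
Notation Jb := (Jbd cc p n mu nu).

Let closedG : G 0 = G 1. Proof. by case: sc. Qed.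

(** The expansion of [Yop_quotient], for X itself. *)
Lemma Xbd_entries : exists (k : 'I_2 -> 'I_2 -> R[i]) (r : 'I_2 -> 'I_2 -> {poly R}),
  forall z, ~ inside G z -> forall i j,
  Xb z i j = (i == j)%:R + k i j * (ctr mu (r i j) z - ctr nu (r i j) z).
Proof.
have [k [r kr]] := Yop_quotient n1 hmu hnu.
pose e : int := n%:Z - p%:Z.
pose Ec (i j : 'I_2) := mx2 (cc ^ e) 0 0 (cc ^ (- e)) i i * mx2 (cc ^ (- e)) 0 0 (cc ^ e) j j.
exists (fun i j => Ec i j * k i j), r => z zin i j.
rewrite /Xbd conj_entry kr; [|exact: mu_off zin|exact: nu_off zin].
rewrite mulrDr mulrA; congr (_ + _).
have [->|ij] := eqVneq i j; last by rewrite mulr0.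
by rewrite Ecoef_id // mulr1.
Qed.

Lemma trace_not_inside t : 0 <= t <= 1 -> ~ inside G (G t).
Proof. by move=> t01 [nt _]; apply: nt; exact: trace_in. Qed.

Lemma mu_trace_off t : 0 <= t <= 1 -> ~ (@creal R @` msupp mu) (G t).
Proof. by move=> t01; exact: trace_off muin _ t01. Qed.

Lemma nu_trace_off t : 0 <= t <= 1 -> ~ (@creal R @` msupp nu) (G t).
Proof. by move=> t01; exact: trace_off nuin _ t01. Qed.

Lemma ctr_curve_ccont (q : {poly R}) :
  ccont 0 1 (fun t => ctr mu q (G t)) /\ ccont 0 1 (fun t => ctr nu q (G t)).
Proof.
have [mf ms _] := hmu; have [nf ns _] := hnu.
split; apply: (ccont_comp (curve_ccont ps)) => t t01.
  exact: ctr_cvg mf ms _ _ (mu_trace_off t01).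
exact: ctr_cvg nf ns _ _ (nu_trace_off t01).
Qed.

Lemma Xbd_ccont i j : ccont 0 1 (fun t => Xb (G t) i j).
Proof.
have [k [r kr]] := Xbd_entries; have [c1 c2] := ctr_curve_ccont (r i j).
have c3 := ccontM (@ccont_cst R 0 1 (k i j)) (ccontB c1 c2).
apply: eq_ccont (ccontD (@ccont_cst R 0 1 (i == j)%:R) c3) => t t01.
by rewrite (kr _ (trace_not_inside t01)).
Qed.

(** The boundary values of M are polynomial: they only involve the first column
    of the matrix of orthogonal polynomials. *)
Lemma Mbd_entries : exists P : 'I_2 -> 'I_2 -> {poly R[i]},
  forall z, ~ inside G z -> forall i j, Mb z i j = (P i j).[z].
Proof.
pose a := map_poly (@creal R) (opoly mu n).
pose c := (gammaop mu n.-1)%:P * map_poly (@creal R) (opoly mu n.-1).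
pose e : int := n%:Z - p%:Z.
pose Ec (i j : 'I_2) := mx2 (cc ^ e) 0 0 (cc ^ (- e)) i i * mx2 (cc ^ (- e)) 0 0 (cc ^ e) j j.
exists (fun i j => (Ec i j)%:P * (if i == 0 then if j == 0 then - (a * c) else a * a
   else if j == 0 then - (c * c) else c * a)) => z zin i j.
rewrite /Mbd conj_entry hornerM hornerC; congr (_ * _).
have [_ ->] := Yop_inv n1 hmu (mu_off muin zin); rewrite YopE !mx2M mxE.
rewrite -[rpeval (opoly mu n) z]/(a.[z]).
have -> : gammaop mu n.-1 * rpeval (opoly mu n.-1) z = c.[z].
  by rewrite hornerM hornerC.
by case: (i == 0); case: (j == 0); rewrite ?hornerN !hornerM; ring.
Qed.

Lemma c0diffE z : c0diff mu nu z = ctr mu 1 z - ctr nu 1 z.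
Proof. by rewrite /c0diff (cauchyop0 hmu) (cauchyop0 hnu). Qed.

Lemma Jbd_ccont i j : ccont 0 1 (fun t => Jb (G t) i j).
Proof.
have [P PE] := Mbd_entries; have [c1 c2] := ctr_curve_ccont 1.
have cP : ccont 0 1 (fun t => (P i j).[G t]).
  by apply: (ccont_comp (curve_ccont ps)) => t t01; exact: horner_cvg.
apply: eq_ccont (ccontM (ccontB c1 c2) cP) => t t01.
by rewrite /Jbd mxE c0diffE (PE _ (trace_not_inside t01)).
Qed.

Lemma mulmx2 (A B : 'M[R[i]]_2) i j : (A *m B) i j = A i 0 * B 0 j + A i 1 * B 1 j.
Proof.
rewrite mxE !big_ord_recl big_ord0 addr0; congr (_ + A i _ * B _ j); exact: val_inj.
Qed.

Lemma XJ_ccont i j : ccont 0 1 (fun t => (Xb (G t) *m Jb (G t)) i j).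
Proof.
have h k := ccontM (@Xbd_ccont i k) (@Jbd_ccont k j).
by apply: eq_ccont (ccontD (h 0) (h 1)) => t _; rewrite mulmx2.
Qed.

(** Cauchy's formula for X: the jump relation expresses X - 1 as the Cauchy
    transform of its exterior boundary values times J - 1. *)
Lemma Xmat_cauchy z i j : ~ trace G z ->
  Xmat G cc p mu nu n z i j - (i == j)%:R =
  cauchy_transform G (fun s => (Xb s *m Jb s) i j) z.
Proof.
move=> zG.
have [Q [Qin Qjump]] := Xmat_inside p cc0 n1 hmu hnu muin nuin.
have [k [r kr]] := Xbd_entries.
have [mf ms _] := hmu; have [nf ns _] := hnu.
have [cm cn] := ctr_curve_ccont (r i j).
have bm := ccont_bmfun cm; have bn := ccont_bmfun cn.
pose P := Q i j - ((i == j)%:R)%:P.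
have bP : bmfun I01 (fun t => P.[G t]).
  apply: ccont_bmfun; apply: (ccont_comp (curve_ccont ps)) => t t01; exact: horner_cvg.
have bmZ := bmfunZ (- k i j) bm; have bnZ := bmfunZ (k i j) bn.
rewrite (eq_cauchy z (V := fun s => P.[s] +
    (- k i j * ctr mu (r i j) s + k i j * ctr nu (r i j) s))); last first.
  move=> t t01; have tin := trace_not_inside t01.
  rewrite /P hornerD hornerN hornerC Qjump // [Xb _ i j]kr //; ring.
rewrite (cauchyD ps (U := horner P) zG bP (bmfunD bmZ bnZ)).
rewrite (cauchyD ps (U := fun s => - k i j * ctr mu (r i j) s) zG bmZ bnZ).
rewrite (cauchyZ ps (- k i j) (U := ctr mu (r i j)) zG bm).
rewrite (cauchyZ ps (k i j) (U := ctr nu (r i j)) zG bn).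
rewrite (cauchy_horner ps sc P zG).
have [zin|zin] := pselect (inside G z).
  rewrite (cauchy_ctr_inside ps sc ccw ms muin) //.
  rewrite (cauchy_ctr_inside ps sc ccw ns nuin) //.
  by rewrite (winding_inside ccw zin) Qin // /P hornerD hornerN hornerC; ring.
have zout : outside G z.
  by split => // bd; apply: zin.
rewrite (cauchy_ctr_outside ps sc ccw ms muin) //.
rewrite (cauchy_ctr_outside ps sc ccw ns nuin) //.
rewrite (winding_outside ps closedG zout) Xmat_not_inside // kr //; ring.
Qed.

Lemma outside_not_inside z : outside G z -> ~ inside G z.
Proof. by move=> [_ h] [_]. Qed.

(** The non-tangential exterior limits at the smooth points of the curve are
    the values of the continuous extensions. *)
Lemma Mmat_smooth t : 0 <= t <= 1 -> smooth_at G t ->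
  Mmat G cc p mu n (G t) = Mb (G t).
Proof.
move=> t01 sm; have toff := mu_trace_off t01.
pose e : int := n%:Z - p%:Z.
have [Yu Yi] := Yop_inv n1 hmu toff.
have E : mxlim (nt_exterior G (G t)) (Ycheck G cc p mu n) =
    mx2 (cc ^ e) 0 0 (cc ^ (- e)) *m Yop mu n (G t).
  apply/matrixP => i j; rewrite mxE; apply: clim_eq.
    exact: nt_exterior_proper.
  move=> r r0.
  have : ((fun w => (mx2 (cc ^ e) 0 0 (cc ^ (- e)) *m Yop mu n w) i j) : R[i]^o -> R[i]^o)
      @ (G t : R[i]^o) --> ((mx2 (cc ^ e) 0 0 (cc ^ (- e)) *m Yop mu n (G t)) i j : R[i]^o).
    under eq_fun do rewrite mulmx2; rewrite mulmx2.
    apply: (@ccvgD _ (fun w => _ * Yop mu n w 0 j) (fun w => _ * Yop mu n w 1 j)).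
      apply: (@ccvgM _ (fun=> _) (fun w => Yop mu n w 0 j)); first exact: ccvg_cst.
      exact: (Yop_cvg hmu).
    apply: (@ccvgM _ (fun=> _) (fun w => Yop mu n w 1 j)); first exact: ccvg_cst.
    exact: (Yop_cvg hmu).
  move=> /cvg_nbhs_cabsP/(_ r r0)[d d0 hd]; apply: (nt_exterior_near d0) => w wo wd.
  rewrite /Ycheck Ytilde_not_inside; last exact: outside_not_inside.
  exact: hd.
rewrite /Mmat E /Mbd invmx_E // !mulmxA //.
Qed.

(** The exterior values of X converge to those of [Xbd] at a smooth point. *)
Lemma Xbd_cvg t i j : 0 <= t <= 1 -> smooth_at G t -> forall r : R, 0 < r ->
  \forall w \near nt_exterior G (G t),
    cabs (Xmat G cc p mu nu n w i j - Xb (G t) i j) < r.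
Proof.
move=> t01 sm r r0; have [k [q kq]] := Xbd_entries.
have [mf ms _] := hmu; have [nf ns _] := hnu.
have : ((fun w => (i == j)%:R + k i j * (ctr mu (q i j) w + (-1) * ctr nu (q i j) w))
    : R[i]^o -> R[i]^o) @ (G t : R[i]^o) -->
    ((i == j)%:R + k i j * (ctr mu (q i j) (G t) + (-1) * ctr nu (q i j) (G t)) : R[i]^o).
  apply: (@ccvgD _ (fun=> _)
    (fun w => k i j * (ctr mu (q i j) w + (-1) * ctr nu (q i j) w))); first exact: ccvg_cst.
  apply: (@ccvgM _ (fun=> _)
    (fun w => ctr mu (q i j) w + (-1) * ctr nu (q i j) w)); first exact: ccvg_cst.
  apply: (@ccvgD _ (ctr mu (q i j)) (fun w => (-1) * ctr nu (q i j) w)).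
    exact: ctr_cvg mf ms _ _ (mu_trace_off t01).
  apply: (@ccvgM _ (fun=> _) (ctr nu (q i j))); first exact: ccvg_cst.
  exact: ctr_cvg nf ns _ _ (nu_trace_off t01).
move=> /cvg_nbhs_cabsP/(_ r r0)[d d0 hd]; apply: (nt_exterior_near d0) => w wo wd.
have win := outside_not_inside wo.
rewrite (Xmat_not_inside p cc0 n1 nu hmu muin win) (kq w win i j).
rewrite (kq _ (trace_not_inside t01) i j).
by have := hd w wd; rewrite !mulN1r.
Qed.

End RHP2.

(** * Integrals and bounds that hold almost everywhere *)

Section Ae.
Variable R : realType.
Notation mu := (@lebesgue_measure R).
Notation I01 := (`[0%R, 1%R]%classic : set (measurableTypeR R)).

Let mI : measurable I01. Proof. exact: measurable_itv. Qed.
Let fin : (mu I01 < +oo)%E. Proof. exact: lebesgue_itvcc_fin. Qed.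

Lemma lebesgue_seq0 (l : seq R) : mu [set` l] = 0%E.
Proof.
by apply: countable_lebesgue_measure0; apply: finite_set_countable; exact: finite_seq.
Qed.

Lemma ae_off_seq (l : seq R) (P : R -> Prop) :
  (forall t, 0 <= t <= 1 -> t \notin l -> P t) ->
  {ae mu, forall t : measurableTypeR R, t \in `[0, 1] -> P t}.
Proof.
move=> hP; exists [set` l]; split.
- exact: finite_seq_measurable.
- exact: lebesgue_seq0.
move=> t /= h; apply: contrapT => /negP tl; apply: h; rewrite in_itv /= => t01.
exact: hP.
Qed.

Lemma Rintegral_ae_le (f h : measurableTypeR R -> R) :
  mu.-integrable I01 (EFin \o f) -> mu.-integrable I01 (EFin \o h) ->
  {ae mu, forall t : measurableTypeR R, t \in `[0, 1] -> f t <= h t} ->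
  \int[mu]_(t in I01) f t <= \int[mu]_(t in I01) h t.
Proof.
move=> iF iH [N [mN N0 hN]].
rewrite /Rintegral (negligible_integral mN mI iF N0) (negligible_integral mN mI iH N0).
have mD : measurable (I01 `\` N) by exact: measurableD.
have sub : I01 `\` N `<=` I01 by move=> t [].
apply: le_Rintegral => //.
- exact: integrableS iF.
- exact: integrableS iH.
move=> t [tI tN]; apply: contrapT => nle; apply: tN; apply: hN => /= /(_ tI).
exact: nle.
Qed.

Lemma bmfun_seq (l : seq R) (f : R -> R[i]) :
  bmfun ([set` l] : set (measurableTypeR R)) f.
Proof.
elim: l => [|x l IH].
  rewrite (_ : [set` [::]] = set0); last by apply/seteqP; split.
  by split; [exact: measurable_fun_set0..|exists 0].
rewrite (_ : [set` x :: l] = [set x] `|` [set` l]).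
  apply: bmfunU => //; first exact: finite_seq_measurable.
  split; [exact: measurable_fun_set1..|].
  by exists (cabs (f x)) => _ ->.
apply/seteqP; split => y /=; rewrite inE; last by case=> [->|->]; rewrite ?eqxx ?orbT.
by move=> /orP[/eqP ->|yl]; [left|right].
Qed.

(** The values at finitely many points do not matter, even for the measurability
    of the integrand. *)
Lemma eq_cintegral_seq (l : seq R) (f h : R -> R[i]) : bmfun I01 h ->
  (forall t, 0 <= t <= 1 -> t \notin l -> f t = h t) ->
  cintegral mu `[0, 1] f = cintegral mu `[0, 1] h.
Proof.
move=> bh fh.
have ml : measurable ([set` l] : set (measurableTypeR R)) by exact: finite_seq_measurable.
have mIl : measurable (I01 `\` [set` l]) by exact: measurableD.
have bf : bmfun I01 f.
  apply: (@bmfunS _ _ _ ((I01 `\` [set` l]) `|` [set` l])).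
  - exact: measurableU.
  - move=> t tI; have [tl|tl] := pselect ([set` l] t); [by right|by left].
  apply: bmfunU => //; last exact: bmfun_seq.
  apply: (eq_bmfun (f := h)).
    move=> t [/=]; rewrite in_itv /= => t01 /negP tl; by rewrite fh.
  by apply: bmfunS bh => // t [].
have key (F H : R -> R) : mu.-integrable I01 (EFin \o F) -> mu.-integrable I01 (EFin \o H) ->
    (forall t, 0 <= t <= 1 -> t \notin l -> F t = H t) ->
    \int[mu]_(t in I01) F t = \int[mu]_(t in I01) H t.
  move=> iF iH FH; apply/eqP; rewrite eq_le; apply/andP; split; apply: Rintegral_ae_le => //;
  by apply: (@ae_off_seq l) => t t01 tl; rewrite FH.
apply: complexP => /=; apply: key => [||t t01 tl].
- exact: bmfun_intRe bf.
- exact: bmfun_intRe bh.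
- by rewrite fh.
- exact: bmfun_intIm bf.
- exact: bmfun_intIm bh.
- by rewrite fh.
Qed.

(** The essential supremum is an extended real number and [norm_Linfty] is its
    real part, which is 0 when it is infinite. Boundedness off a finite set
    excludes this case. *)
Lemma norm_Linfty_ae (G : R -> R[i]) (F : R[i] -> 'M[R[i]]_2) (l : seq R) (B : R) :
  (forall t, 0 <= t <= 1 -> t \notin l -> mxabs (F (G t)) <= B) ->
  0 <= norm_Linfty G F /\
  {ae mu, forall t : measurableTypeR R, t \in `[0, 1] -> mxabs (F (G t)) <= norm_Linfty G F}.
Proof.
move=> FB; set m' := mrestr mu (measurable_itv `[0, 1]).
pose f (t : measurableTypeR R) : \bar R := (mxabs (F (G t)))%:E.
have up : (ess_sup m' f <= B%:E)%E.
  apply/ess_supP; exists ([set` l] `|` ~` I01); split.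
  - apply: measurableU; [exact: finite_seq_measurable|exact: measurableC].
  - change (mu (([set` l] `|` ~` I01) `&` `[0, 1]%classic) = 0%E).
    apply: (@subset_measure0 _ _ _ mu _ [set` l]) => //.
    + apply: measurableI => //; apply: measurableU; [exact: finite_seq_measurable|exact: measurableC].
    + exact: finite_seq_measurable.
    + by move=> t [[//|nI] /nI].
    + exact: lebesgue_seq0.
  - move=> t /= nle; have [tl|tl] := pselect ([set` l] t); first by left.
    right => /=; rewrite in_itv /= => t01; apply: nle.
    by rewrite /f lee_fin; apply: FB => //; exact/negP.
have lo : (0 <= ess_sup m' f)%E.
  apply: ess_sup_gee.
    have h : (0 < mu I01)%E.
      by rewrite lebesgue_measure_itv /= lte_fin ltr01 oppr0 adde0 lte_fin ltr01.
    by rewrite -(setTI I01) in h; exact: h.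
  by apply: nearW => t; rewrite lee_fin mxabs_ge0.
have finE : (norm_Linfty G F)%:E = ess_sup m' f.
  rewrite /norm_Linfty fineK // fin_real //.
  by rewrite (lt_le_trans _ lo) ?ltNyr //= (le_lt_trans up) ?ltry.
split; first by rewrite -lee_fin finE.
have [N [mN N0 hN]] := ess_sup_ge m' f.
exists (N `&` `[0, 1]%classic); split => //.
  exact: measurableI.
move=> t /= h; split; last by apply: contrapT => nI; apply: h => /nI.
apply: hN => /= h2; apply: h => _; by rewrite -lee_fin finE.
Qed.

End Ae.

(** * The estimate in L2 *)

(** The squared norm of a function of the parameter in L2 of the arc length. *)
Definition energy (R : realType) (G f : R -> R[i]) : R :=
  \int[lebesgue_measure]_(t in `[0, 1]) (cabs (f t) ^+ 2 * cabs (velocity G t)).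

Section Energy.
Variables (R : realType) (G : R -> R[i]).
Hypothesis ps : piecewise_smooth G.
Notation mu := (@lebesgue_measure R).
Notation I01 := (`[0%R, 1%R]%classic : set (measurableTypeR R)).

Let mI : measurable I01. Proof. exact: measurable_itv. Qed.
Let fin : (mu I01 < +oo)%E. Proof. exact: lebesgue_itvcc_fin. Qed.

Lemma integrable_vel : mu.-integrable I01 (EFin \o (fun t => cabs (velocity G t))).
Proof. exact: (@bmfun_intcabs _ _ _ mu _ mI fin _ (bmfun_velocity ps)). Qed.

Lemma integrable_energy (f : R -> R[i]) : bmfun I01 f ->
  mu.-integrable I01 (EFin \o (fun t => cabs (f t) ^+ 2 * cabs (velocity G t))).
Proof.
move=> bf.
have b := bmfunM (bmfunX 2 bf) (bmfun_velocity ps).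
have := @bmfun_intcabs _ _ _ mu _ mI fin _ b.
by apply: eq_integrable => // t _ /=; rewrite cabsM cabsX.
Qed.

Lemma energy_ge0 (f : R -> R[i]) : 0 <= energy G f.
Proof. by apply: Rintegral_ge0 => t _; apply: mulr_ge0; [exact: sqr_ge0|exact: cabs_ge0]. Qed.

Lemma bmfun_in_L2 (U : R[i] -> R[i]) : bmfun I01 (fun t => U (G t)) -> in_L2 G U.
Proof.
move=> bU; have [mr mi _] := bU; split => //.
have /integrableP[_] := integrable_energy bU; apply: le_lt_trans.
apply: ge0_le_integral => //.
- by move=> t _; rewrite lee_fin; apply: mulr_ge0; [exact: sqr_ge0|exact: cabs_ge0].
- have /integrableP[h _] := integrable_energy bU; exact: h.
- have /integrableP[h _] := integrable_energy bU; exact: measurableT_comp h.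
- by move=> t _ /=; rewrite lee_fin ler_norm.
Qed.

Lemma in_L2_integrable (U : R[i] -> R[i]) : in_L2 G U ->
  mu.-integrable I01 (EFin \o (fun t => cabs (U (G t)) ^+ 2 * cabs (velocity G t))).
Proof.
move=> [mr mi fi]; apply/integrableP; split.
  apply/measurable_EFinP; apply: measurable_funM; last first.
    exact: (bmfun_cabs_measurable (bmfun_velocity ps)).
  apply: eq_measurable_fun
    (measurable_funD (measurable_funX 2 mr) (measurable_funX 2 mi)) => t _ /=.
  by rewrite cabs_sqr.
apply: le_lt_trans fi; rewrite le_eqVlt; apply/orP; left; apply/eqP.
apply: eq_integral => t _ /=; rewrite ger0_norm //.
by apply: mulr_ge0; [exact: sqr_ge0|exact: cabs_ge0].
Qed.

Lemma norm_L2_sqr (U : R[i] -> R[i]) :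
  norm_L2 G U ^+ 2 = energy G (fun t => U (G t)).
Proof. by rewrite /norm_L2 sqr_sqrtr //; exact: energy_ge0. Qed.

Lemma norm_L2_ge0 (U : R[i] -> R[i]) : 0 <= norm_L2 G U.
Proof. exact: sqrtr_ge0. Qed.

Lemma energy_ae_le (f h : R -> R[i]) :
  mu.-integrable I01 (EFin \o (fun t => cabs (f t) ^+ 2 * cabs (velocity G t))) ->
  mu.-integrable I01 (EFin \o (fun t => cabs (h t) ^+ 2 * cabs (velocity G t))) ->
  {ae mu, forall t : measurableTypeR R, t \in `[0, 1] -> f t = h t} ->
  energy G f <= energy G h.
Proof.
move=> iF iH fh; apply: Rintegral_ae_le => //.
by apply: filterS fh => t h1 /h1 ->.
Qed.

End Energy.

Lemma sqr_sum3_le (R : realFieldType) (a b : R) :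
  (1 + a + b) ^+ 2 <= 3 * (1 + (a ^+ 2 + b ^+ 2)).
Proof.
rewrite -subr_ge0 (_ : _ - _ = (1 - a) ^+ 2 + (1 - b) ^+ 2 + (a - b) ^+ 2); last by ring.
by rewrite !addr_ge0 // sqr_ge0.
Qed.

(** Arithmetic-geometric mean inequality with a weight. *)
Lemma amgm_weight (R : realFieldType) (a l : R) : 0 < l ->
  a <= 2^-1 * (l + a ^+ 2 / l).
Proof.
move=> l0; rewrite -subr_ge0.
rewrite (_ : _ - _ = 2^-1 * (a - l) ^+ 2 / l); last by field; rewrite gt_eqF.
by apply: divr_ge0; [apply: mulr_ge0 => //; exact: sqr_ge0|exact: ltW].
Qed.

Section Estimate.
Variables (R : realType) (G : R -> R[i]).
Hypotheses (ps : piecewise_smooth G) (sc : simple_closed G).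
Hypothesis ccw : counterclockwise G.
Variables (cc : R[i]) (p n : nat).
Hypotheses (cc0 : cc != 0) (n1 : (1 <= n)%N).
Variables mu nu : {finite_measure set (measurableTypeR R) -> \bar R}.
Hypotheses (hmu : op_measure mu (msupp mu) n) (hnu : op_measure nu (msupp nu) n).
Hypothesis muin : forall x, msupp mu x -> inside G (creal x).
Hypothesis nuin : forall x, msupp nu x -> inside G (creal x).
Variable C : R.
Hypothesis hC : cauchy_minus_bounded_by G C.
Notation leb := (@lebesgue_measure R).
Notation I01 := (`[0%R, 1%R]%classic : set (measurableTypeR R)).
Notation Xb := (Xbd cc p n mu nu).
Notation Jb := (Jbd cc p n mu nu).
Notation len := (curve_length G).

Let mI : measurable I01. Proof. exact: measurable_itv. Qed.
Let fin : (leb I01 < +oo)%E. Proof. exact: lebesgue_itvcc_fin. Qed.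

(** Deviation from the identity of the exterior boundary values of X. *)
Definition dev (i k : 'I_2) (t : R) : R[i] := Xb (G t) i k - (i == k)%:R.

Lemma dev_ccont i k : ccont 0 1 (dev i k).
Proof.
exact: ccontB (@Xbd_ccont _ _ ps cc p n cc0 n1 mu nu hmu hnu muin nuin i k) (@ccont_cst R 0 1 _).
Qed.

Lemma dev_bmfun i k : bmfun I01 (dev i k).
Proof. exact: ccont_bmfun (@dev_ccont i k). Qed.

(** The exterior boundary values of the Cauchy transform of X (J - 1) are
    those of X - 1. *)
Lemma cauchy_minus_dev i k V : cauchy_minus G (fun s => (Xb s *m Jb s) i k) V ->
  {ae leb, forall t : measurableTypeR R, t \in `[0, 1] -> dev i k t = V (G t)}.
Proof.
move=> cV; have [l hl] := curve_smooth_at ps.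
have sm : {ae leb, forall t : measurableTypeR R, t \in `[0, 1] -> smooth_at G t}.
  by apply: (@ae_off_seq _ l) => t t01 tl; exact: hl.
apply: filterS2 cV sm => t ct st tI; have t01 : 0 <= t <= 1 by [].
have PF := nt_exterior_proper ps sc ccw (st tI).
have h1 := ct tI; have h2 := @Xbd_cvg _ _ cc p n cc0 n1 mu nu hmu hnu muin nuin t i k t01 (st tI).
apply/eqP; rewrite -subr_eq0 -cabs_eq0 eq_le cabs_ge0 andbT.
apply/ler_addgt0Pr => e e0; rewrite add0r.
have e20 : 0 < e / 2 by rewrite divr_gt0.
have /cvg_cabsP/(_ _ e20) g1 := h1.
have g2 := h2 _ e20.
have g3 : \forall w \near nt_exterior G (G t), outside G w.
  exact: (nt_exterior_near ltr01).
have [w [[k1 k2] [zG _]]] := filter_ex (filterI (filterI g1 g2) g3).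
rewrite -(@Xmat_cauchy _ _ ps sc ccw cc p n cc0 n1 mu nu hmu hnu muin nuin w i k zG) in k1.
have -> : dev i k t - V (G t) =
   (Xmat G cc p mu nu n w i k - (i == k)%:R - V (G t))
   - (Xmat G cc p mu nu n w i k - Xb (G t) i k) by rewrite /dev; ring.
by rewrite (le_trans (cabsB _ _)) // [leRHS]splitr lerD // ltW.
Qed.

(** The hypothesis on the Cauchy operator, applied to X (J - 1). *)
Lemma dev_energy i k :
  energy G (dev i k) <= C ^+ 2 * energy G (fun t => (Xb (G t) *m Jb (G t)) i k).
Proof.
have bU := ccont_bmfun (@XJ_ccont _ _ ps cc p n cc0 n1 mu nu hmu hnu muin nuin i k).
have [V [VL2 cV nV]] := hC (bmfun_in_L2 ps (U := fun s => (Xb s *m Jb s) i k) bU).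
have le1 : energy G (dev i k) <= energy G (fun t => V (G t)).
  apply: energy_ae_le; last exact: cauchy_minus_dev.
    exact: integrable_energy (dev_bmfun _ _).
  exact: in_L2_integrable.
apply: (le_trans le1).
rewrite -norm_L2_sqr -(norm_L2_sqr G (fun s => (Xb s *m Jb s) i k)) -exprMn.
by rewrite lerXn2r // nnegrE ?norm_L2_ge0 // (le_trans (norm_L2_ge0 _ _) nV).
Qed.

Variable j : R.
Hypothesis j0 : 0 <= j.
Hypothesis Jj : {ae leb, forall t : measurableTypeR R, t \in `[0, 1] -> mxabs (Jb (G t)) <= j}.

Lemma Xrow_le i t : cabs (Xb (G t) i 0) + cabs (Xb (G t) i 1) <=
  1 + cabs (dev i 0 t) + cabs (dev i 1 t).
Proof.
have h k : Xb (G t) i k = (i == k)%:R + dev i k t by rewrite /dev addrC subrK.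
rewrite !h (le_trans (lerD (cabsD _ _) (cabsD _ _))) //.
have -> : cabs ((i == 0)%:R : R[i]) + cabs (dev i 0 t) +
    (cabs ((i == 1)%:R : R[i]) + cabs (dev i 1 t)) =
  (cabs ((i == 0)%:R : R[i]) + cabs ((i == 1)%:R : R[i])) + cabs (dev i 0 t) + cabs (dev i 1 t).
  by ring.
rewrite !lerD2r; move: i {h}; apply: ord2P; by rewrite /= cabs0 cabs1 ?addr0 ?add0r.
Qed.

(** The squared L2 norm of a row of X - 1. *)
Definition row_energy i := energy G (dev i 0) + energy G (dev i 1).

(** The squared L2 norm of X (J - 1), in terms of that of X - 1. *)
Lemma XJ_energy i k :
  energy G (fun t => (Xb (G t) *m Jb (G t)) i k) <= 3 * j ^+ 2 * (len + row_energy i).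
Proof.
have iv := integrable_vel ps.
have i0 := integrable_energy ps (dev_bmfun i 0).
have i1 := integrable_energy ps (dev_bmfun i 1).
pose a01 t := cabs (dev i 0 t) ^+ 2 * cabs (velocity G t)
  + cabs (dev i 1 t) ^+ 2 * cabs (velocity G t).
have i01 : leb.-integrable I01 (EFin \o a01).
  by have := integrableD mI i0 i1; apply: eq_integrable.
have ivd : leb.-integrable I01 (EFin \o (fun t => cabs (velocity G t) + a01 t)).
  by have := integrableD mI iv i01; apply: eq_integrable.
have iZ : leb.-integrable I01
    (EFin \o (fun t => 3 * j ^+ 2 * (cabs (velocity G t) + a01 t))).
  by have := integrableZl mI (3 * j ^+ 2) ivd; apply: eq_integrable.
have -> : 3 * j ^+ 2 * (len + row_energy i) =
    \int[leb]_(t in I01) (3 * j ^+ 2 * (cabs (velocity G t) + a01 t)).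
  by rewrite (RintegralZl _ mI ivd) (RintegralD mI iv i01) (RintegralD mI i0 i1).
have bU := ccont_bmfun (@XJ_ccont _ _ ps cc p n cc0 n1 mu nu hmu hnu muin nuin i k).
apply: Rintegral_ae_le.
- exact: integrable_energy.
- exact: iZ.
apply: filterS Jj => t ht tI; have Jt := ht tI.
rewrite /a01 -mulrDl -[X in X + _]mul1r -mulrDl mulrA ler_wpM2r ?cabs_ge0 //.
have h1 : cabs ((Xb (G t) *m Jb (G t)) i k) <= j * (1 + cabs (dev i 0 t) + cabs (dev i 1 t)).
  rewrite mulmx2 (le_trans (cabsD _ _)) // !cabsM.
  have J0 := le_trans (mxabs_ge (Jb (G t)) 0 k) Jt.
  have J1 := le_trans (mxabs_ge (Jb (G t)) 1 k) Jt.
  apply: (@le_trans _ _ (cabs (Xb (G t) i 0) * j + cabs (Xb (G t) i 1) * j)).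
    by apply: lerD; apply: ler_wpM2l => //; exact: cabs_ge0.
  by rewrite -mulrDl mulrC ler_wpM2l // Xrow_le.
apply: (@le_trans _ _ ((j * (1 + cabs (dev i 0 t) + cabs (dev i 1 t))) ^+ 2)).
  by rewrite lerXn2r // nnegrE ?cabs_ge0 // (le_trans (cabs_ge0 _) h1).
rewrite exprMn [leRHS]mulrAC [leRHS]mulrC ler_wpM2l ?sqr_ge0 //.
exact: sqr_sum3_le.
Qed.

(** The two previous estimates bound [row_energy] in terms of itself, with a
    factor 6 (C j)^2 that is at most 1/2. *)
Lemma row_energy_le i : 12 * (C * j) ^+ 2 <= 1 ->
  row_energy i <= 12 * (C * j) ^+ 2 * len.
Proof.
move=> small.
have key k : energy G (dev i k) <= 3 * (C * j) ^+ 2 * (len + row_energy i).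
  apply: (le_trans (dev_energy i k)).
  have -> : 3 * (C * j) ^+ 2 * (len + row_energy i) =
    C ^+ 2 * (3 * j ^+ 2 * (len + row_energy i)) by ring.
  by rewrite ler_wpM2l ?sqr_ge0 // XJ_energy.
have L0 := curve_length_ge0 G.
have S0 : 0 <= row_energy i by rewrite addr_ge0 // energy_ge0.
have := lerD (key 0) (key 1); rewrite -/(row_energy i).
set x := (C * j) ^+ 2 in small *; set s := row_energy i in S0 *; move: (curve_length G) L0 => L L0.
have x0 : 0 <= x by exact: sqr_ge0.
have : 12 * x * s <= 1 * s by rewrite ler_wpM2r.
by lra.
Qed.

End Estimate.

(** * The error term *)

Section ErrorBound.
Variables (R : realType) (G : R -> R[i]).
Hypotheses (ps : piecewise_smooth G) (sc : simple_closed G).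
Hypothesis ccw : counterclockwise G.
Variables (cc : R[i]) (p n : nat).
Hypotheses (cc0 : cc != 0) (n1 : (1 <= n)%N).
Variables mu nu : {finite_measure set (measurableTypeR R) -> \bar R}.
Hypotheses (hmu : op_measure mu (msupp mu) n) (hnu : op_measure nu (msupp nu) n).
Hypothesis muin : forall x, msupp mu x -> inside G (creal x).
Hypothesis nuin : forall x, msupp nu x -> inside G (creal x).
Variable C : R.
Hypothesis hC : cauchy_minus_bounded_by G C.
Notation leb := (@lebesgue_measure R).
Notation I01 := (`[0%R, 1%R]%classic : set (measurableTypeR R)).
Notation Xb := (Xbd cc p n mu nu).
Notation Jb := (Jbd cc p n mu nu).
Notation dv := (dev G cc p n mu nu).
Notation len := (curve_length G).

Let mI : measurable I01. Proof. exact: measurable_itv. Qed.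
Let fin : (leb I01 < +oo)%E. Proof. exact: lebesgue_itvcc_fin. Qed.

(** The function integrated in the statement is J - 1 off finitely many points. *)
Lemma jump_density_smooth : exists l : seq R, forall t, 0 <= t <= 1 -> t \notin l ->
  c0diff mu nu (G t) *: Mmat G cc p mu n (G t) = Jb (G t).
Proof.
have [l hl] := curve_smooth_at ps; exists l => t t01 tl.
by rewrite (@Mmat_smooth _ _ ps sc ccw cc p n cc0 n1 mu hmu muin t t01 (hl t t01 tl)).
Qed.

Lemma norm_Linfty_jump (j : R) :
  j = norm_Linfty G (fun z => Jmat G cc p mu nu n z - 1%:M) ->
  0 <= j /\ {ae leb, forall t : measurableTypeR R, t \in `[0, 1] -> mxabs (Jb (G t)) <= j}.
Proof.
move=> ->; have [l hl] := jump_density_smooth.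
have FE t : 0 <= t <= 1 -> t \notin l -> Jmat G cc p mu nu n (G t) - 1%:M = Jb (G t).
  by move=> t01 tl; rewrite /Jmat addrC addKr hl.
have cJ i k := ccont_bounded (@Jbd_ccont _ _ ps cc p n n1 mu nu hmu hnu muin nuin i k).
have [B00 h00] := cJ 0 0; have [B01 h01] := cJ 0 1.
have [B10 h10] := cJ 1 0; have [B11 h11] := cJ 1 1.
pose B := `|B00| + `|B01| + `|B10| + `|B11|.
have [] := @norm_Linfty_ae _ G (fun z => Jmat G cc p mu nu n z - 1%:M) l B.
  move=> t t01 tl; rewrite FE //.
  have e00 := le_trans (h00 t t01) (ler_norm _); have e01 := le_trans (h01 t t01) (ler_norm _).
  have e10 := le_trans (h10 t t01) (ler_norm _); have e11 := le_trans (h11 t t01) (ler_norm _).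
  have n00 := normr_ge0 B00; have n01 := normr_ge0 B01.
  have n10 := normr_ge0 B10; have n11 := normr_ge0 B11.
  apply: mxabs_le; first by rewrite /B; lra.
  by apply: ord2P; apply: ord2P; rewrite /B; lra.
move=> j0 jae; split => //.
have FEae : {ae leb, forall t : measurableTypeR R, t \in `[0, 1] ->
    Jmat G cc p mu nu n (G t) - 1%:M = Jb (G t)}.
  by apply: (@ae_off_seq _ l) => t; exact: FE.
by apply: filterS2 jae FEae => t h1 h2 tI; rewrite -h2 // h1.
Qed.

Variable j : R.
Hypothesis j0 : 0 <= j.
Hypothesis Jj : {ae leb, forall t : measurableTypeR R, t \in `[0, 1] -> mxabs (Jb (G t)) <= j}.

(** The difference between X - 1 and the Cauchy transform of J - 1 is the
    Cauchy transform of (X - 1) (J - 1). *)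
Lemma error_representation i k z : ~ trace G z ->
  Xmat G cc p mu nu n z i k - (i == k)%:R
  - cauchy_transform G (fun s => (c0diff mu nu s *: Mmat G cc p mu n s) i k) z =
  (twopii R)^-1 * cintegral leb `[0, 1] (fun t =>
    (dv i 0 t * Jb (G t) 0 k + dv i 1 t * Jb (G t) 1 k)
     * ((G t - z)^-1 * velocity G t)).
Proof.
move=> zG; rewrite (@Xmat_cauchy _ _ ps sc ccw cc p n cc0 n1 mu nu hmu hnu muin nuin z i k zG).
have [l hl] := jump_density_smooth.
have bX := ccont_bmfun (@XJ_ccont _ _ ps cc p n cc0 n1 mu nu hmu hnu muin nuin i k).
have bJ := ccont_bmfun (@Jbd_ccont _ _ ps cc p n n1 mu nu hmu hnu muin nuin i k).
have b1 := bmfun_cauchy ps (U := fun s => (Xb s *m Jb s) i k) zG bX.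
have b2 := bmfun_cauchy ps (U := fun s => Jb s i k) zG bJ.
rewrite !cauchyE -mulrBr; congr (_ * _).
rewrite (@eq_cintegral_seq _ l
  (fun t => (c0diff mu nu (G t) *: Mmat G cc p mu n (G t)) i k * ((G t - z)^-1 * velocity G t))
  _ b2); last by move=> t t01 tl; rewrite hl.
rewrite -(cintegralB mI fin b1 b2); apply: eq_cintegral => t _.
rewrite -mulrBl; congr (_ * _); rewrite mulmx2 /dev.
by move: i {bX b1 bJ b2}; apply: ord2P; rewrite /=; ring.
Qed.

(** The parameter lam stands for C j, but is positive. *)
Lemma error_bound i k z (delta lam : R) : 0 < delta -> 0 < lam ->
  (forall t, 0 <= t <= 1 -> delta <= cabs (G t - z)) ->
  12 * (C * j) ^+ 2 <= 1 -> (C * j) ^+ 2 <= lam ^+ 2 ->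
  cabs (Xmat G cc p mu nu n z i k - (i == k)%:R
    - cauchy_transform G (fun s => (c0diff mu nu s *: Mmat G cc p mu n s) i k) z)
  <= j / delta * (7 * lam * len).
Proof.
move=> delta0 lam0 dz small Clam.
have zG : ~ trace G z.
  move=> [t /=]; rewrite in_itv /= => /dz + Gt.
  by rewrite Gt subrr cabs0 leNgt delta0.
rewrite error_representation //.
have bd k' := @dev_bmfun _ _ ps cc p n cc0 n1 mu nu hmu hnu muin nuin i k'.
have bJ k' := ccont_bmfun (@Jbd_ccont _ _ ps cc p n n1 mu nu hmu hnu muin nuin k' k).
have bK := bmfun_curve ps (curve_inv_ccont ps zG).
have bD := bmfunM (bmfunD (bmfunM (bd 0) (bJ 0)) (bmfunM (bd 1) (bJ 1))) bK.
rewrite cabsM cabsV cabs_twopii.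
have ineq : (2 * pi)^-1 * (2 * \int[leb]_(t in I01) cabs
     ((dv i 0 t * Jb (G t) 0 k + dv i 1 t * Jb (G t) 1 k)
     * ((G t - z)^-1 * velocity G t))) <= j / delta * (7 * lam * len); last first.
  apply: le_trans ineq; rewrite ler_wpM2l ?invr_ge0 ?mulr_ge0 ?pi_ge0 //.
  exact: (cabs_cintegral_le mI fin bD).
set I := Rintegral _ _ _.
have I0 : 0 <= I by apply: Rintegral_ge0 => t _; exact: cabs_ge0.
have pi1 : 1 <= pi :> R by have := pi_ge2 R; lra.
apply: (@le_trans _ _ I).
  have aux (q x : R) : q != 0 -> (2 * q)^-1 * (2 * x) = q^-1 * x by move=> q0; field.
  rewrite aux; last exact: lt0r_neq0 (pi_gt0 R).
  by rewrite ler_piMl // invf_le1 // (pi_gt0 R).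
have iv := integrable_vel ps.
have i0 := integrable_energy ps (bd 0); have i1 := integrable_energy ps (bd 1).
pose a01 t := cabs (dv i 0 t) ^+ 2 * cabs (velocity G t)
  + cabs (dv i 1 t) ^+ 2 * cabs (velocity G t).
have i01 : leb.-integrable I01 (EFin \o a01).
  by have := integrableD mI i0 i1; apply: eq_integrable.
have i01Z : leb.-integrable I01 (EFin \o (fun t => (2 * lam)^-1 * a01 t)).
  by have := integrableZl mI (2 * lam)^-1 i01; apply: eq_integrable.
have ivZ : leb.-integrable I01 (EFin \o (fun t => lam * cabs (velocity G t))).
  by have := integrableZl mI lam iv; apply: eq_integrable.
have isum : leb.-integrable I01 (EFin \o (fun t => lam * cabs (velocity G t) + (2 * lam)^-1 * a01 t)).
  by have := integrableD mI ivZ i01Z; apply: eq_integrable.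
have iall : leb.-integrable I01
    (EFin \o (fun t => j / delta * (lam * cabs (velocity G t) + (2 * lam)^-1 * a01 t))).
  by have := integrableZl mI (j / delta) isum; apply: eq_integrable.
apply: (@le_trans _ _ (\int[leb]_(t in I01)
    (j / delta * (lam * cabs (velocity G t) + (2 * lam)^-1 * a01 t)))).
  apply: Rintegral_ae_le => //; first exact: (@bmfun_intcabs _ _ _ leb _ mI fin _ bD).
  apply: filterS Jj => t ht tI; have Jt := ht tI; have t01 : 0 <= t <= 1 by [].
  have J0 := le_trans (mxabs_ge (Jb (G t)) 0 k) Jt.
  have J1 := le_trans (mxabs_ge (Jb (G t)) 1 k) Jt.
  have K1 : cabs (G t - z)^-1 <= delta^-1.
    by rewrite cabsV lef_pV2 ?posrE ?dz // (lt_le_trans delta0) // dz.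
  have D1 : cabs (dv i 0 t * Jb (G t) 0 k + dv i 1 t * Jb (G t) 1 k) <=
      j * (cabs (dv i 0 t) + cabs (dv i 1 t)).
    rewrite (le_trans (cabsD _ _)) // !cabsM mulrDr.
    by apply: lerD; rewrite mulrC; apply: ler_wpM2r => //; exact: cabs_ge0.
  have D2 : cabs (dv i 0 t) + cabs (dv i 1 t) <=
      lam + (2 * lam)^-1 * (cabs (dv i 0 t) ^+ 2 + cabs (dv i 1 t) ^+ 2).
    apply: (le_trans (lerD (amgm_weight (cabs (dv i 0 t)) lam0)
      (amgm_weight (cabs (dv i 1 t)) lam0))).
    rewrite le_eqVlt; apply/orP; left; apply/eqP; field.
    by rewrite gt_eqF.
  have vE : lam * cabs (velocity G t) + (2 * lam)^-1 * a01 t =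
      (lam + (2 * lam)^-1 * (cabs (dv i 0 t) ^+ 2 + cabs (dv i 1 t) ^+ 2)) * cabs (velocity G t).
    by rewrite /a01; ring.
  rewrite vE mulrA cabsM (cabsM (G t - z)^-1) mulrA ler_wpM2r ?cabs_ge0 //.
  rewrite mulrAC; apply: ler_pM => //; [exact: cabs_ge0|exact: cabs_ge0|].
  by apply: (le_trans D1); rewrite ler_wpM2l.
rewrite (RintegralZl _ mI isum) (RintegralD mI ivZ i01Z) (RintegralZl _ mI iv).
rewrite (RintegralZl _ mI i01) (RintegralD mI i0 i1).
rewrite ler_wpM2l ?divr_ge0 // ?(ltW delta0) //.
have S12 := @row_energy_le _ _ ps sc ccw cc p n cc0 n1 mu nu hmu hnu muin nuin C hC j j0 Jj i small.
have S7 : row_energy G cc p n mu nu i <= 12 * lam ^+ 2 * len.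
  apply: (le_trans S12); rewrite ler_wpM2r ?curve_length_ge0 //.
  by rewrite ler_wpM2l.
rewrite [7 * lam * len](_ : _ = lam * len + (2 * lam)^-1 * (12 * lam ^+ 2 * len)); last first.
  by field; rewrite gt_eqF.
rewrite lerD2l ler_wpM2l // invr_ge0 mulr_ge0 // ltW //.
Qed.

Lemma len_gt0 (z : R[i]) : inside G z -> 0 < len.
Proof.
move=> zin; have [zG _] := zin; have [e e0 ez] := trace_dist ps zG.
have := winding_bound ps e0 ez; rewrite (winding_inside ccw zin) cabs1 => h.
rewrite lt_def curve_length_ge0 andbT; apply/eqP => L0.
by move: h; rewrite L0 !mulr0 leNgt ltr01.
Qed.

(** The constant function 1 has a positive norm. *)
Lemma operator_bound_ge0 (z : R[i]) : inside G z -> 0 <= C.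
Proof.
move=> /len_gt0 L0.
have [V [_ _ nV]] := hC (bmfun_in_L2 ps (U := fun=> 1) (bmfun_cst _ 1)).
have n1' : norm_L2 G (fun=> 1) = Num.sqrt len.
  rewrite /norm_L2; congr Num.sqrt; apply: eq_Rintegral => t _.
  by rewrite cabs1 expr1n mul1r.
have := le_trans (norm_L2_ge0 G V) nV; rewrite n1' pmulr_lge0 //.
by rewrite sqrtr_gt0.
Qed.

(** A curve that winds around x comes close to x, as its winding number is small
    at points that are far from it; hence it stays in a bounded region. *)
Lemma curve_bounded (x : R[i]) t : inside G x -> 0 <= t <= 1 ->
  cabs (G t) <= cabs x + (6 * len + 1).
Proof.
move=> xin t01; have L0 := curve_length_ge0 G.
have [u u01 ux] : exists2 u, 0 <= u <= 1 & cabs (G u - x) < 2 * len + 1.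
  apply: contrapT => h.
  have far u : 0 <= u <= 1 -> 2 * len + 1 <= cabs (G u - x).
    by move=> u01; rewrite leNgt; apply/negP => ux; apply: h; exists u.
  have e0 : 0 < 2 * len + 1 by lra.
  have := winding_bound ps e0 far; rewrite (winding_inside ccw xin) cabs1.
  rewrite mulrCA ler_pdivlMl // mulr1; lra.
have := curve_chord ps t01 u01.
have -> : G t = (G t - G u) + (G u - x) + x by ring.
have := cabsD (G t - G u + (G u - x)) x; have := cabsD (G t - G u) (G u - x).
have -> : G t - G u + (G u - x) + x - G u = G t - G u by ring.
by lra.
Qed.

End ErrorBound.

Section Infinite.
Variable R : realType.

Lemma seq_isolated (x : R) (l : seq R) : x \notin l ->
  exists2 e : R, 0 < e & forall y, y \in l -> e <= `|x - y|.
Proof.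
elim: l => [|y l IH]; first by exists 1.
rewrite inE negb_or => /andP[xy /IH[e e0 he]].
exists (Num.min e `|x - y|); first by rewrite lt_min e0 normr_gt0 subr_eq0.
move=> z; rewrite inE => /orP[/eqP ->|/he h]; rewrite ge_min ?lexx ?orbT //.
by rewrite h.
Qed.

(** A measure with a nonempty absolutely continuous part is not carried by
    finitely many points. *)
Lemma spiked_infinite (m : {measure set (measurableTypeR R) -> \bar R})
    (k : nat) (a b : 'I_k -> R) (q : nat) (s : 'I_q -> R) (i : 'I_k) :
  spiked_measure m a b s ->
  forall l : seq R, (0 < m (~` [set` l]))%E.
Proof.
move=> [ab sep sinj [h [w [mh h0 w0 mE hpos]]]] l.
have [x [xab xl]] : exists x, a i <= x <= b i /\ x \notin l.
  apply: contrapT => no.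
  have sub : `[a i, b i] `<=` [set` l].
    move=> x /=; rewrite in_itv /= => xab; apply: contrapT => /negP xl.
    by apply: no; exists x.
  have : (@lebesgue_measure R `[a i, b i] <= 0)%E.
    rewrite -(lebesgue_seq0 l); apply: le_measure => //; rewrite inE //.
    exact: finite_seq_measurable.
  rewrite lebesgue_measure_itv /= lte_fin ab -EFinB lee_fin subr_le0.
  by rewrite leNgt ab.
have [e e0 he] := seq_isolated xl.
apply: (@lt_le_trans _ _ (m (ball x e))).
  rewrite mE; last exact: measurable_ball.
  apply: (lt_le_trans (hpos x e _ e0)); first by exists i.
  rewrite leeDl // lee_fin; apply: sumr_ge0 => r _.
  by apply: mulr_ge0; [exact: ltW|rewrite indicE ler0n].
apply: le_measure; rewrite ?inE; first exact: measurable_ball.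
  by apply: measurableC; exact: finite_seq_measurable.
by move=> y; rewrite -ball_normE /= => xy yl; have := he y yl; rewrite leNgt xy.
Qed.

End Infinite.

Lemma spiked_op_measure (R : realType)
    (m : {finite_measure set (measurableTypeR R) -> \bar R})
    (k : nat) (a b : 'I_k -> R) (q : nat) (s : 'I_q -> R) (n : nat) :
  spiked_measure m a b s ->
  (forall l : seq R, (size l < n)%N -> (0 < m (~` [set` l]))%E) ->
  op_measure m (msupp m) n.
Proof.
move=> hm nd; have [_ mS] := spiked_support hm; have mfin := finite_measure_setT m.
split => // Q Q0 sQ; exact: (mom_sqr_gt0 mfin mS nd Q0 sQ).
Qed.

Lemma le_limit_param (R : realFieldType) (c x y : R) : 0 <= c -> 0 <= x ->
  (forall lam, 0 < lam -> x <= lam -> y <= c * lam) -> y <= c * x.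
Proof.
move=> c0 x0 h; apply/ler_addgt0Pr => e e0.
have c1 : 0 < c + 1 by rewrite ltr_wpDl.
have d0 : 0 < e / (c + 1) by rewrite divr_gt0.
apply: (le_trans (h (x + e / (c + 1)) _ _)).
- by rewrite ltr_wpDl.
- by rewrite lerDl ltW.
rewrite mulrDr lerD2l mulrCA ler_piMr ?(ltW e0) // ler_pdivrMr // mul1r lerDl //.
Qed.

Theorem proposition2p1 (R : realType)
  (g p : nat) (a b : 'I_g.+1 -> R) (s : 'I_p -> R)
  (mu : probability (measurableTypeR R) R)
  (hmu : spiked_measure mu a b s)
  (cc : R[i]) (hcc : cconst a b cc) (cc0 : cc != 0)
  (n : nat -> nat) (n1 : forall N, (1 <= n N)%N)
  (nu : nat -> {finite_measure set (measurableTypeR R) -> \bar R})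
  (hnu : forall N, exists (k q : nat) (a' b' : 'I_k -> R) (s' : 'I_q -> R),
     spiked_measure (nu N) a' b' s')
  (* nu(N) is not carried by fewer than n(N) points: pi_n(.; nu) is unique
     and pi_{n-1}(.; nu) has nonzero norm *)
  (nunondeg : forall N (l : seq R), (size l < n N)%N ->
     (0 < nu N (~` [set` l]))%E)
  (Gam : nat -> R -> R[i])
  (Gsmooth : forall N, piecewise_smooth (Gam N))
  (Gsimple : forall N, simple_closed (Gam N))
  (Gccw : forall N, counterclockwise (Gam N))
  (Gmu : forall N x, msupp mu x -> inside (Gam N) (creal x))
  (Gnu : forall N x, msupp (nu N) x -> inside (Gam N) (creal x))
  (C : nat -> R)
  (hC : forall N, cauchy_minus_bounded_by (Gam N) (C N))
  (hJ : (fun N => C N *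
           norm_Linfty (Gam N)
             (fun z => Jmat (Gam N) cc p mu (nu N) (n N) z - 1%:M))
        @ \oo --> (0 : R)) :
  (* the implied constant depends on the distance d to Gamma(N) and on a
     bound L for the length of Gamma(N) *)
  forall d L : R, 0 < d ->
  exists K : R, \forall N \near \oo,
    curve_length (Gam N) <= L ->
    forall z : R[i],
      (forall t, t \in `[0, 1] -> d <= cabs (z - Gam N t)) ->
      mxabs (Xmat (Gam N) cc p mu (nu N) (n N) z
             - (1%:M + mxcauchy_transform (Gam N)
                  (fun z' => c0diff mu (nu N) z' *:
                               Mmat (Gam N) cc p mu (n N) z') z))
      <= K * (C N *
                norm_Linfty (Gam N)
                  (fun z' => Jmat (Gam N) cc p mu (nu N) (n N) z' - 1%:M) ^+ 2
              / (1 + cabs z)).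
Proof.
move=> d L d0.
have musupp : msupp mu (a ord0).
  have [-> _] := spiked_support hmu; left; exists ord0.
  by case: hmu => ab _ _ _; rewrite lexx ltW.
have hmuop N : op_measure mu (msupp mu) (n N).
  exact: (spiked_op_measure hmu (fun l _ => spiked_infinite ord0 hmu l)).
have hnuop N : op_measure (nu N) (msupp (nu N)) (n N).
  have [k [q [a' [b' [s' hs]]]]] := hnu N.
  exact: spiked_op_measure hs (nunondeg N).
set A := cabs (creal (a ord0)).
pose K1 := (1 + (A + (6 * L + 1))) / d + 1.
exists (7 * L * K1).
have /cvgrPdist_lt/(_ (4^-1)) hJ4 := hJ.
have : \forall N \near \oo, `|0 - C N * norm_Linfty (Gam N)
    (fun z => Jmat (Gam N) cc p mu (nu N) (n N) z - 1%:M)| < 4^-1.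
  by apply: hJ4; rewrite invr_gt0.
apply: filterS => N; rewrite sub0r normrN.
set j := norm_Linfty _ _ => Cj4 lenL z dz.
have ps := Gsmooth N; have sc := Gsimple N; have ccw := Gccw N.
set G := Gam N in ps sc ccw dz lenL j Cj4 *.
have xin : inside G (creal (a ord0)) by exact: Gmu.
have L0 := curve_length_ge0 G.
have C0 : 0 <= C N := operator_bound_ge0 ps ccw (hC N) xin.
have [j0 Jj] := @norm_Linfty_jump _ G ps sc ccw cc p (n N) cc0 (n1 N) mu (nu N)
  (hmuop N) (hnuop N) (Gmu N) (Gnu N) j erefl.
have Cj0 : 0 <= C N * j by rewrite mulr_ge0.
have small : 12 * (C N * j) ^+ 2 <= 1.
  have : C N * j <= 4^-1 by rewrite (le_trans (ler_norm _)) // ltW.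
  by rewrite expr2; move: (C N * j) Cj0 => x x0 x4; nra.
have A0 : 0 <= A by exact: cabs_ge0.
have LL : 0 <= L := le_trans L0 lenL.
have K1p : 0 < K1.
  by rewrite /K1 ltr_pwDr // divr_ge0 ?(ltW d0) //; lra.
have z1 : 0 < 1 + cabs z by rewrite ltr_pwDl // cabs_ge0.
pose delta := (1 + cabs z) / K1.
have delta0 : 0 < delta by rewrite divr_gt0.
(* the distance of z to the curve is comparable to 1 + |z| *)
have dist t : 0 <= t <= 1 -> delta <= cabs (G t - z).
  move=> t01; rewrite ler_pdivrMr // cabsBC.
  have zd := dz t t01; set x := cabs (z - G t) in zd *.
  have Gt : cabs (G t) <= A + (6 * L + 1).
    apply: (le_trans (curve_bounded ps ccw xin t01)); rewrite lerD2l; lra.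
  have tri : cabs z <= x + cabs (G t).
    by rewrite /x -[in X in X <= _](subrK (G t) z) cabsD.
  have B1 : 1 + (A + (6 * L + 1)) <= x * ((1 + (A + (6 * L + 1))) / d).
    rewrite mulrA ler_pdivlMr // mulrC ler_wpM2r //; lra.
  rewrite /K1 mulrDr mulr1; lra.
have entry i k : cabs ((Xmat G cc p mu (nu N) (n N) z
     - (1%:M + mxcauchy_transform G
       (fun z' => c0diff mu (nu N) z' *: Mmat G cc p mu (n N) z') z)) i k)
    <= (7 * j / delta * curve_length G) * (C N * j).
  have entryE (X M : 'M[R[i]]_2) : (X - (1%:M + M)) i k = X i k - (i == k)%:R - M i k.
    by rewrite !mxE opprD addrA.
  rewrite entryE [mxcauchy_transform _ _ _ i k]mxE.
  apply: le_limit_param => // [|lam lam0 Clam].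
    by rewrite mulr_ge0 // divr_ge0 ?(ltW delta0) // mulr_ge0.
  have lam2 : (C N * j) ^+ 2 <= lam ^+ 2 by rewrite lerXn2r // nnegrE ltW.
  have := @error_bound _ G ps sc ccw cc p (n N) cc0 (n1 N) mu (nu N)
    (hmuop N) (hnuop N) (Gmu N) (Gnu N) (C N) (hC N) j j0 Jj i k z delta lam
    delta0 lam0 dist small lam2.
  rewrite [j / delta * _](_ : _ = 7 * j / delta * curve_length G * lam) //; ring.
have final : 7 * j / delta * curve_length G * (C N * j) <=
    7 * L * K1 * (C N * j ^+ 2 / (1 + cabs z)).
  have -> : 7 * j / delta * curve_length G * (C N * j) =
      curve_length G * (7 * K1 * (C N * j ^+ 2 / (1 + cabs z))).
    by rewrite /delta; field; rewrite gt_eqF // gt_eqF.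
  have -> : 7 * L * K1 * (C N * j ^+ 2 / (1 + cabs z)) =
      L * (7 * K1 * (C N * j ^+ 2 / (1 + cabs z))) by ring.
  rewrite ler_wpM2r // mulr_ge0 ?mulr_ge0 ?sqr_ge0 ?invr_ge0 ?(ltW K1p) ?(ltW z1) //.
apply: (le_trans _ final); apply: mxabs_le => //.
by rewrite mulr_ge0 // mulr_ge0 // divr_ge0 ?(ltW delta0) // mulr_ge0.
Qed.
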